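(* Subgroup Membership is (uniformly) decidable in $G \wr \mathbb{Z}^n$ for finite $G$ and $n \in \mathbb{N}$. That is, there is an algorithm which takes as input a finite group $G$, a number $n\in\mathbb{N}$, and elements $h_1, \ldots, h_k, h \in G \wr \mathbb{Z}^n$, and decides whether $h$ is in the subgroup of $G\wr\mathbb{Z}^n$ generated by $h_1, \ldots, h_k$.
   Context: $\mathbb{N}$ contains $0$. $G^{(\mathbb{Z}^n)}$ is the group, under pointwise multiplication, of maps $f\colon\mathbb{Z}^n\to G$ with $f(\alpha)\neq e$ for only finitely many $\alpha$. For $\beta\in\mathbb{Z}^n$, ${}^{\beta}f(\alpha)=f(\alpha-\beta)$. The (restricted) wreath product $G\wr\mathbb{Z}^n$ is the group of pairs $(f,\alpha)$, $f\in G^{(\mathbb{Z}^n)}$, $\alpha\in\mathbb{Z}^n$, with multiplication $(f,\alpha)\cdot(g,\beta)=(f\cdot{}^{\alpha}g,\ \alpha+\beta)$. The finite group $G$ is given by an effective representation such as its multiplication table; elements of $G\wr\mathbb{Z}^n$ are given by the finite list of non-trivial values of $f$ together with $\alpha$. *)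

(* Defs.v *)
From HB Require Import structures.
From mathcomp Require Import all_boot all_order all_algebra all_fingroup.
From mathcomp Require Import finmap.

Set Implicit Arguments.
Unset Strict Implicit.
Unset Printing Implicit Defensive.

Import GRing.Theory.

(* The total recursive functions on natural numbers. Minimisation is only      *)
(* applied to regular functions, so that partial functions are never needed.   *)
Inductive recursive : forall k, (k.-tuple nat -> nat) -> Prop :=
| rec_zero : recursive (fun _ : 0.-tuple nat => 0)
| rec_succ : recursive (fun v : 1.-tuple nat => (thead v).+1)
| rec_proj k (i : 'I_k) : recursive (fun v : k.-tuple nat => tnth v i)
| rec_comp k m (g : m.-tuple nat -> nat) (h : 'I_m -> k.-tuple nat -> nat) :
    recursive g -> (forall i, recursive (h i)) ->
    recursive (fun v => g [tuple h i v | i < m])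
| rec_prim k (g : k.-tuple nat -> nat) (h : k.+2.-tuple nat -> nat)
    (f : k.+1.-tuple nat -> nat) :
    recursive g -> recursive h ->
    (forall v : k.-tuple nat, f [tuple of 0 :: v] = g v) ->
    (forall m (v : k.-tuple nat),
       f [tuple of m.+1 :: v] =
       h [tuple of m :: f [tuple of m :: v] :: v]) ->
    recursive f
| rec_min k (g : k.+1.-tuple nat -> nat) (f : k.-tuple nat -> nat) :
    recursive g ->
    (forall v : k.-tuple nat, g [tuple of f v :: v] = 0 /\
       forall j, j < f v -> g [tuple of j :: v] <> 0) ->
    recursive f.

(* Prop-valued, so that the subgroups need not be decidable. *)
Definition is_subgroup (W : groupType) (S : W -> Prop) : Prop :=
  [/\ S 1%g,
      forall x y, S x -> S y -> S (x * y)%g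
    & forall x, S x -> S (x^-1)%g].

Definition in_generated (W : groupType) (hs : seq W) (h : W) : Prop :=
  forall S : W -> Prop,
    is_subgroup S -> (forall x, x \in hs -> S x) -> S h.

Section Wreath.
Variables (G : groupType) (n : nat).
Local Open Scope fset_scope.
Local Open Scope ring_scope.

Definition lamps := {fsfun 'rV[int]_n -> G with 1%g}.
Implicit Types (f g : lamps) (a b : 'rV[int]_n).

Definition lamps1 : lamps := [fsfun with 1%g].
Definition lampsM f g : lamps :=
  [fsfun a in finsupp f `|` finsupp g => (f a * g a)%g].
Definition lampsV f : lamps := [fsfun a in finsupp f => ((f a)^-1)%g].
Definition shift b f : lamps :=
  [fsfun a in [fset (c + b)%R | c in finsupp f] => f (a - b)].

Lemma lamps1E a : lamps1 a = 1%g.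
Proof. by rewrite fsfunE. Qed.

Lemma lampsME f g a : lampsM f g a = (f a * g a)%g.
Proof.
rewrite fsfunE in_fsetU; case: ifP => // /norP[fa ga].
by rewrite !fsfun_dflt // mulg1.
Qed.

Lemma lampsVE f a : lampsV f a = ((f a)^-1)%g.
Proof.
by rewrite fsfunE; case: ifPn => // fa; rewrite fsfun_dflt // invg1.
Qed.

Lemma shiftE b f a : shift b f a = f (a - b).
Proof.
rewrite fsfunE; case: ifPn => // fa; rewrite fsfun_dflt //.
by apply: contraNN fa => fa; apply/imfsetP; exists (a - b); rewrite //= subrK.
Qed.

Record wreath := Wreath { lamp : lamps; pos : 'rV[int]_n }.

Definition wreath_pair (w : wreath) := (lamp w, pos w).
Definition pair_wreath (p : lamps * 'rV[int]_n) := Wreath p.1 p.2.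
Lemma wreath_pairK : cancel wreath_pair pair_wreath.
Proof. by case. Qed.
HB.instance Definition _ := Choice.copy wreath (can_type wreath_pairK).

Implicit Types x y z : wreath.

Definition wreath1 := Wreath lamps1 0.
Definition wreathM x y :=
  Wreath (lampsM (lamp x) (shift (pos x) (lamp y))) (pos x + pos y).
Definition wreathV x := Wreath (shift (- pos x) (lampsV (lamp x))) (- pos x).

Lemma wreath_eq x y : lamp x =1 lamp y -> pos x = pos y -> x = y.
Proof. by case: x y => [f a] [g b] /= /fsfunP -> ->. Qed.

Lemma wreathMA : associative wreathM.
Proof.
move=> x y z; apply: wreath_eq => [a|] /=; last by rewrite addrA.
by rewrite !(lampsME, shiftE) mulgA opprD addrA.
Qed.

Lemma wreath1M : left_id wreath1 wreathM.
Proof.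
move=> x; apply: wreath_eq => [a|] /=; last by rewrite add0r.
by rewrite lampsME shiftE lamps1E mul1g subr0.
Qed.

Lemma wreathM1 : right_id wreath1 wreathM.
Proof.
move=> x; apply: wreath_eq => [a|] /=; last by rewrite addr0.
by rewrite lampsME shiftE lamps1E mulg1.
Qed.

Lemma wreathVM : left_inverse wreath1 wreathV wreathM.
Proof.
move=> x; apply: wreath_eq => [a|] /=; last by rewrite addNr.
by rewrite lampsME !shiftE lampsVE lamps1E mulVg.
Qed.

Lemma wreathMV : right_inverse wreath1 wreathV wreathM.
Proof.
move=> x; apply: wreath_eq => [a|] /=; last by rewrite subrr.
by rewrite lampsME !shiftE lampsVE lamps1E opprK subrK mulgV.
Qed.

HB.instance Definition _ :=
  isGroup.Build wreath wreathMA wreath1M wreathM1 wreathVM wreathMV.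

End Wreath.

(* Inputs are given to algorithms as natural numbers, through the bijection    *)
(* CodeSeq.code between seq nat and nat. An element of a finite group is       *)
(* represented by its index in a duplicate-free enumeration r of the group.    *)
Section Encoding.
Variables (gT : finGroupType) (r : seq gT).

Definition enumerates : Prop := uniq r /\ forall x : gT, x \in r.

Definition int_code (z : int) : nat :=
  match z with Posz m => m.*2 | Negz m => m.*2.+1 end.

Definition vec_code n (a : 'rV[int]_n) : nat :=
  CodeSeq.code [seq int_code (a ord0 i) | i <- enum 'I_n].

Definition table_code : nat :=
  CodeSeq.code
    [seq CodeSeq.code [seq index (x * y)%g r | y <- r] | x <- r].

(* A relation and not a function: the non-trivial values of the lamp           *)
(* configuration may be listed in any order.                                   *)
Definition element_code n (w : wreath gT n) (c : nat) : Prop :=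
  exists2 s : seq 'rV[int]_n, perm_eq s (finsupp (lamp w)) &
    c = CodeSeq.code
      [:: CodeSeq.code
            [seq CodeSeq.code [:: vec_code a; index (lamp w a) r] | a <- s];
          vec_code (pos w)].

Definition instance_code n (hs : seq (wreath gT n)) (h : wreath gT n)
    (c : nat) : Prop :=
  exists cs d,
    [/\ size cs = size hs,
        forall i, i < size hs -> element_code (nth 1%g hs i) (nth 0 cs i),
        element_code h d
      & c = CodeSeq.code [:: table_code; n; CodeSeq.code cs; d]].

End Encoding.

(* Main.v *)
(* Products of the generators and their inverses can be enumerated, so it is    *)
(* enough to certify non-membership by finite data that a program can check.    *)
(* Let H be the subgroup. By the Smith normal form, H contains u_1, ..., u_n    *)
(* whose positions span the lattice of all positions of H and become diagonal   *)
(* after a unimodular change of coordinates. Fix t = u_i0 of nonzero position   *)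
(* (or t = 1 if there is none) and let S be the group of lamp configurations x  *)
(* such that the translate of x by m pos(t) is in H for all large m.            *)
(* Conjugation by t^m separates the lamps of an element of H from those of t,   *)
(* and H is generated by the u_i and by the x such that t^m x t^-m is in S for  *)
(* all large m; hence H is determined by S. Now S is invariant under the        *)
(* lattice, like a submodule of a module over Laurent polynomials, except that  *)
(* G need not be abelian. Order Z^n by a well-order compatible with             *)
(* translations away from the origin. By Dickson's lemma the leading lamps of   *)
(* elements of S are those of the lattice translates of finitely many elements, *)
(* the letters; and, as in the theory of Groebner bases, finitely many          *)
(* identities between nearby translates of letters imply that every element of  *)
(* the group that the letters generate has the leading lamp of a letter. A      *)
(* certificate consists of the u_i, the letters, these identities, words        *)
(* showing that the given generators lie in the group built from the u_i and    *)
(* the letters, and an irreducible remainder of h.                              *)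

Require Import Defs.
From HB Require Import structures.
From mathcomp Require Import all_boot all_order all_algebra all_fingroup.
From mathcomp Require Import finmap.
From mathcomp Require Import zify ring.
From Stdlib Require Import Classical FunctionalExtensionality.

Set Implicit Arguments.
Unset Strict Implicit.
Unset Printing Implicit Defensive.
Import GRing.Theory Order.TTheory Num.Theory.

(** Membership and non-membership both have finite certificates that a program can check. Hence a
    search through all numbers always ends ([Decided_total]), and [recursive_search] makes it a
    total recursive function. A membership certificate is a word in the generators
    ([in_generated_words]). A non-membership certificate ([separating]) describes a subgroup that
    contains the generators but not [h]; by [separating_sound] and [separating_complete] such a
    description is conclusive and exists for every non-member.

    The positions of a finitely generated subgroup form a lattice in Z^n, diagonal in suitable
    coordinates and spanned by the positions of elements [us] ([lattice_basis]). The rest of the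
    subgroup is its part K at position 0. If [us] normalise K and their commutators lie in K, then
    [adjoins K us] is a group ([adjoins_subgroup]). The obstacle is that conjugation by an element
    [u] both translates a lamp configuration and conjugates it by the lamps of [u]. Away from the
    lamps of [u] only the translation remains. So fix [t] among [us] with nonzero position, or
    [t = 1] if there is none, and let S consist of the configurations whose translates far out along
    [pos t] lie in the subgroup. Then S is invariant under translation by the lattice
    ([at_infinity_shc]) and determines K ([untwist_infinity]). Conversely, given a lattice-invariant
    S, the group [untwist] is normalised by [u] once it contains the commutator of [t] and [u]
    ([untwist_normalizes]).

    S is treated like a submodule of a module over Laurent polynomials, with a non-abelian
    coefficient group. As G is finite, Dickson's lemma gives finitely many elements whose lattice
    translates, the letters, attain all leading lamps of S ([finite_letters]). In the other
    direction, [grobner_lead] is a Buchberger criterion, where conjugation identities join those for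
    quotients. The order respects only translations away from the origin, and [check_near] moves
    every pair of overlapping letters into a finite box, so finitely many identities suffice
    ([letters_lead]). An element outside S reduces to a remainder whose leading lamp belongs to no
    letter ([complete_irreducible]), and this can be checked in a box as well
    ([irreducible_sound]). *)

Notation cod := CodeSeq.code.
Notation dec := CodeSeq.decode.

(** * Total recursive functions *)

Definition recursive1 (f : nat -> nat) := recursive (fun v : 1.-tuple nat => f (thead v)).
Definition recursive2 (f : nat -> nat -> nat) :=
  recursive (fun v : 2.-tuple nat => f (tnth v ord0) (tnth v (@Ordinal 2 1 isT))).

Lemma recursive_ext k (f g : k.-tuple nat -> nat) : f =1 g -> recursive f -> recursive g.
Proof. by move=> /functional_extensionality ->. Qed.

Lemma recursive_id : recursive1 id.
Proof. by apply: (recursive_ext _ (rec_proj (@ord0 0))). Qed.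

Lemma recursive_succ k (g : k.-tuple nat -> nat) : recursive g -> recursive (fun v => (g v).+1).
Proof.
move=> rg; apply: (recursive_ext _ (rec_comp (h := fun _ : 'I_1 => g) rec_succ _)) => // v.
by rewrite /thead tnth_mktuple.
Qed.

Lemma recursive_comp1 k f (g : k.-tuple nat -> nat) :
  recursive1 f -> recursive g -> recursive (fun v => f (g v)).
Proof.
move=> rf rg; apply: (recursive_ext _ (rec_comp (h := fun _ : 'I_1 => g) rf _)) => // v.
by rewrite /thead tnth_mktuple.
Qed.

Lemma recursive_comp2 k f (g h : k.-tuple nat -> nat) :
  recursive2 f -> recursive g -> recursive h -> recursive (fun v => f (g v) (h v)).
Proof.
move=> rf rg rh.
apply: (recursive_ext _
  (rec_comp (h := fun i : 'I_2 => if val i is 0 then g else h) rf _)).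
  by move=> v; rewrite !tnth_mktuple.
by case=> [[|i] ?].
Qed.

Lemma recursive_const k m : recursive (fun _ : k.-tuple nat => m).
Proof.
elim: m => [|m IH]; last exact: recursive_succ.
case: k => [|k].
  by apply: (recursive_ext _ rec_zero).
have r0 : forall k, recursive (fun _ : k.-tuple nat => 0).
  elim=> [|k' IH]; first exact: rec_zero.
  exact: (rec_prim (g := fun _ => 0) (h := fun v => tnth v (@Ordinal k'.+2 1 isT)) IH (rec_proj _)).
exact: r0.
Qed.

Lemma recursive2_prim (f : nat -> nat -> nat) (g : nat -> nat) (h : 3.-tuple nat -> nat) :
  recursive1 g -> recursive h ->
  (forall x, f 0 x = g x) ->
  (forall m x, f m.+1 x = h [tuple m; f m x; x]) ->
  recursive2 f.
Proof.
move=> rg rh f0 fS.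
apply: (rec_prim rg rh) => [v|m v]; first by rewrite -f0 /thead !(tnth_nth 0).
rewrite [LHS]fS; congr h; apply: val_inj; rewrite /= !(tnth_nth 0) /=.
by case: v => [[|x []]].
Qed.

Lemma recursive2C f : recursive2 f -> recursive2 (fun x y => f y x).
Proof. by move=> rf; apply: (recursive_comp2 rf); apply: rec_proj. Qed.

Lemma recursive_add : recursive2 addn.
Proof.
apply: (@recursive2_prim _ id (fun v => (tnth v (@Ordinal 3 1 isT)).+1)) => //.
- exact: recursive_id.
- exact/recursive_succ/rec_proj.
Qed.

Lemma recursive_mul : recursive2 muln.
Proof.
apply: (@recursive2_prim _ (fun _ => 0) (fun v => tnth v (@Ordinal 3 1 isT) + tnth v (@Ordinal 3 2 isT))).
- exact: recursive_const.
- by apply: (recursive_comp2 recursive_add); apply: rec_proj.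
- exact: mul0n.
- by move=> m x; rewrite mulSn addnC.
Qed.

Lemma recursive_exp2 : recursive1 (expn 2).
Proof.
have r : recursive2 (fun m _ => 2 ^ m).
  apply: (@recursive2_prim _ (fun _ => 1) (fun v => 2 * tnth v (@Ordinal 3 1 isT))).
  - exact: recursive_const.
  - by apply: (recursive_comp2 recursive_mul); [apply: recursive_const|apply: rec_proj].
  - by [].
  - by move=> m x; rewrite expnS.
by apply: (recursive_comp2 r); apply: recursive_id.
Qed.

Lemma recursive_sub : recursive2 subn.
Proof.
have rp : recursive1 predn.
  have r : recursive2 (fun m _ => m.-1).
    apply: (@recursive2_prim _ (fun _ => 0) (fun v => tnth v (@Ordinal 3 0 isT))) => //.
      exact: recursive_const.
    exact: rec_proj.
  by apply: (recursive_comp2 r); apply: recursive_id.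
apply: (recursive2C (f := fun m x => x - m)).
apply: (@recursive2_prim _ id (fun v => (tnth v (@Ordinal 3 1 isT)).-1)).
- exact: recursive_id.
- by apply: (recursive_comp1 rp); apply: rec_proj.
- exact: subn0.
- by move=> m x; rewrite subnS !(tnth_nth 0).
Qed.

Lemma recursive_odd : recursive1 (fun m => odd m).
Proof.
have r : recursive2 (fun m _ => odd m).
  apply: (@recursive2_prim _ (fun _ => 0) (fun v => 1 - tnth v (@Ordinal 3 1 isT))) => //.
  - exact: recursive_const.
  - by apply: (recursive_comp2 recursive_sub); [apply: recursive_const|apply: rec_proj].
  - by move=> m x /=; case: (odd m).
by apply: (recursive_comp2 r); apply: recursive_id.
Qed.

Lemma recursive_half : recursive1 half.
Proof.
have r : recursive2 (fun m _ => m./2).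
  apply: (@recursive2_prim _ (fun _ => 0)
            (fun v => odd (tnth v (@Ordinal 3 0 isT)) + tnth v (@Ordinal 3 1 isT))) => //.
  - exact: recursive_const.
  - apply: (recursive_comp2 recursive_add); last exact: rec_proj.
    by apply: (recursive_comp1 recursive_odd); apply: rec_proj.
  - by move=> m x; rewrite !(tnth_nth 0) /= uphalf_half.
by apply: (recursive_comp2 r); apply: recursive_id.
Qed.

Lemma recursive_if k (c a b : k.-tuple nat -> nat) :
  recursive c -> recursive a -> recursive b ->
  recursive (fun v => if c v == 0 then a v else b v).
Proof.
move=> rc ra rb.
have r : recursive (fun v => a v * (1 - c v) + b v * (1 - (1 - c v))).
  apply: (recursive_comp2 recursive_add); apply: (recursive_comp2 recursive_mul) => //.
    apply: (recursive_comp2 recursive_sub) => //; exact: recursive_const.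
  do 2!(apply: (recursive_comp2 recursive_sub); first exact: recursive_const).
  exact: rc.
apply: (recursive_ext _ r) => v.
by case: (c v) => [|m]; rewrite ?muln0 ?muln1 ?addn0.
Qed.

(** * Lists of numbers coded by single numbers *)

Definition hdc x := head 0 (dec x).
Definition tlc x := cod (behead (dec x)).
Definition consc a x := cod (a :: dec x).

Lemma consE a x : consc a x = 2 ^ a * x.*2.+1.
Proof. by rewrite /consc /= -/(cod _) CodeSeq.decodeK. Qed.

Lemma recursive_consc : recursive2 consc.
Proof.
have r : recursive2 (fun a x => 2 ^ a * (x + x).+1).
  apply: (recursive_comp2 recursive_mul).
    by apply: (recursive_comp1 recursive_exp2); apply: rec_proj.
  by apply: recursive_succ; apply: (recursive_comp2 recursive_add); apply: rec_proj.
by apply: (recursive_ext _ r) => v; rewrite consE addnn.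
Qed.

Definition shiftc m x := iter m half x.

Lemma shiftcM m q : shiftc m (2 ^ m * q) = q.
Proof.
elim: m => [|m IH]; first by rewrite mul1n.
by rewrite /shiftc iterSr expnS -mulnA mul2n doubleK.
Qed.

Lemma recursive_shiftc : recursive2 shiftc.
Proof.
apply: (@recursive2_prim _ id (fun v => (tnth v (@Ordinal 3 1 isT))./2)) => //.
- exact: recursive_id.
- by apply: (recursive_comp1 recursive_half); apply: rec_proj.
Qed.

(** A nonempty list has as code the power of 2 with its head as exponent, times an odd number. So
    the head counts the halvings before the first odd value, which presents [hdc] as a
    minimisation. *)
Lemma hdc_min x : x != 0 -> odd (shiftc (hdc x) x) /\ forall j, j < hdc x -> ~~ odd (shiftc j x).
Proof.
rewrite -[x]CodeSeq.decodeK /hdc CodeSeq.codeK; case: (dec x) => //= a s _.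
rewrite -/(cod s); split=> [|j lt_ja]; first by rewrite shiftcM /= odd_double.
rewrite -(subnKC (ltnW lt_ja)) expnD -mulnA shiftcM oddM oddX.
by rewrite /= orbF eqn0Ngt subn_gt0 lt_ja.
Qed.

Lemma recursive_hdc : recursive1 hdc.
Proof.
(* The special value at [x = 0] lets the search stop at once, at the head 0 of the empty list;
   otherwise no odd value would ever appear. *)
pose g (j x : nat) := if x == 0 then 0 else 1 - odd (shiftc j x).
have rg : recursive2 g.
  apply: recursive_if; [exact: rec_proj|exact: recursive_const|].
  apply: (recursive_comp2 recursive_sub); first exact: recursive_const.
  apply: (recursive_comp1 recursive_odd).
  by apply: (recursive_comp2 recursive_shiftc); apply: rec_proj.
apply: (rec_min (f := fun v => hdc (thead v)) rg) => v.
have E j : g (tnth [tuple of j :: v] ord0) (tnth [tuple of j :: v] (@Ordinal 2 1 isT)) = g j (thead v).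
  by rewrite /thead !(tnth_nth 0).
rewrite E; have [v0|nz] := eqVneq (thead v) 0.
  by rewrite /g v0; split=> // j; rewrite /hdc.
have [odd_h min] := hdc_min nz; split; first by rewrite /g (negbTE nz) odd_h.
by move=> j /min /negbTE oj; rewrite E /g (negbTE nz) oj.
Qed.

Lemma recursive_tlc : recursive1 tlc.
Proof.
(* One halving more than the head also removes the odd bit that ends the entry. The empty list is
   harmless, because halving fixes 0. *)
have r : recursive1 (fun x => shiftc (hdc x).+1 x).
  apply: (recursive_comp2 recursive_shiftc); last exact: recursive_id.
  exact/recursive_succ/recursive_hdc.
apply: (recursive_ext _ r) => v.
rewrite -[thead v]CodeSeq.decodeK /hdc /tlc CodeSeq.codeK.
case: (dec _) => [|a s]; first by [].
change ((shiftc a (2 ^ a * (cod s).*2.+1))./2 = cod s).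
by rewrite shiftcM /= uphalf_double.
Qed.

(** * A small programming language whose programs compute recursive functions *)

Inductive prog : Type :=
| Var of nat
| Zro
| Suc of prog
| Cns of prog & prog
| Hd of prog
| Tl of prog
| Rec of prog & prog & prog
| Fold of prog & prog & prog
| Map of prog & prog
| Call of prog & seq prog.

(* In [Rec n z b] the body [b] sees the counter and the accumulator in front  *)
(* of the environment; in [Fold l z b] it sees the list item and the          *)
(* accumulator.                                                               *)
Fixpoint ev (p : prog) (e : seq nat) {struct p} : nat :=
  match p with
  | Var i => nth 0 e i
  | Zro => 0
  | Suc p => (ev p e).+1
  | Cns p q => consc (ev p e) (ev q e)
  | Hd p => hdc (ev p e)
  | Tl p => tlc (ev p e)
  | Rec n z b => iteri (ev n e) (fun m acc => ev b [:: m, acc & e]) (ev z e)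
  | Fold l z b => foldr (fun a acc => ev b [:: a, acc & e]) (ev z e) (dec (ev l e))
  | Map l b => cod [seq ev b (a :: e) | a <- dec (ev l e)]
  | Call f args => ev f [seq ev a e | a <- args]
  end.

Section ProgInd.
Variable P : prog -> Prop.
Hypotheses (PV : forall i, P (Var i)) (PZ : P Zro) (PS : forall p, P p -> P (Suc p))
  (PC : forall p q, P p -> P q -> P (Cns p q)) (PH : forall p, P p -> P (Hd p))
  (PT : forall p, P p -> P (Tl p))
  (PR : forall n z b, P n -> P z -> P b -> P (Rec n z b))
  (PF : forall l z b, P l -> P z -> P b -> P (Fold l z b))
  (PM : forall l b, P l -> P b -> P (Map l b))
  (PA : forall f args, P f -> foldr (fun a Q => P a /\ Q) True args -> P (Call f args)).

(** The automatic principle gives no induction hypothesis for the list of arguments under [Call];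
    the inner [fix] supplies one for each argument. *)
Fixpoint prog_nested_ind p : P p :=
  match p with
  | Var i => PV i
  | Zro => PZ
  | Suc p => PS (prog_nested_ind p)
  | Cns p q => PC (prog_nested_ind p) (prog_nested_ind q)
  | Hd p => PH (prog_nested_ind p)
  | Tl p => PT (prog_nested_ind p)
  | Rec n z b => PR (prog_nested_ind n) (prog_nested_ind z) (prog_nested_ind b)
  | Fold l z b => PF (prog_nested_ind l) (prog_nested_ind z) (prog_nested_ind b)
  | Map l b => PM (prog_nested_ind l) (prog_nested_ind b)
  | Call f args => PA (prog_nested_ind f)
      ((fix all_args s : foldr (fun a Q => P a /\ Q) True s :=
          if s is a :: s' then conj (prog_nested_ind a) (all_args s') else I) args)
  end.
End ProgInd.

Lemma recursive1_iteri (n z : nat -> nat) (b : nat -> nat -> nat -> nat) :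
  recursive1 n -> recursive1 z ->
  recursive (fun v : 3.-tuple nat => b (tnth v (@Ordinal 3 0 isT)) (tnth v (@Ordinal 3 1 isT))
     (tnth v (@Ordinal 3 2 isT))) ->
  recursive1 (fun x => iteri (n x) (fun m acc => b m acc x) (z x)).
Proof.
move=> rn rz rb.
have r : recursive2 (fun m x => iteri m (fun m acc => b m acc x) (z x)).
  by apply: (recursive2_prim rz rb) => // m x; rewrite !(tnth_nth 0).
exact: (recursive_comp2 r rn recursive_id).
Qed.

(** A left fold is an iteration on a coded state that holds the remaining items and the accumulator.
    The right fold is the left fold over the reversed list, and reversal is itself a left fold. *)
Lemma recursive1_foldr (l z : nat -> nat) (b : nat -> nat -> nat -> nat) :
  recursive1 l -> recursive1 z ->
  recursive (fun v : 3.-tuple nat => b (tnth v (@Ordinal 3 0 isT)) (tnth v (@Ordinal 3 1 isT))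
     (tnth v (@Ordinal 3 2 isT))) ->
  recursive1 (fun x => foldr (fun a acc => b a acc x) (z x) (dec (l x))).
Proof.
have rfoldl l' z' b' : recursive1 l' -> recursive1 z' ->
  recursive (fun v : 3.-tuple nat => b' (tnth v (@Ordinal 3 0 isT)) (tnth v (@Ordinal 3 1 isT))
     (tnth v (@Ordinal 3 2 isT))) ->
  recursive1 (fun x => foldl (fun acc a => b' a acc x) (z' x) (dec (l' x))).
  move=> rl rz rb.
  (* the state is the code of the remaining items and of the accumulator *)
  pose st (s : seq nat) acc := consc (cod s) (consc acc 0).
  pose rest t := hdc t; pose accu t := hdc (tlc t).
  pose step (m t x : nat) :=
    if rest t == 0 then t else consc (tlc (rest t)) (consc (b' (hdc (rest t)) (accu t) x) 0).
  have restE s acc : rest (st s acc) = cod s by rewrite /rest /st /hdc CodeSeq.codeK.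
  have accuE s acc : accu (st s acc) = acc.
    by rewrite /accu /st /hdc /tlc !CodeSeq.codeK.
  have step0 m acc x : step m (st [::] acc) x = st [::] acc by rewrite /step restE.
  have stepS m a s acc x : step m (st (a :: s) acc) x = st s (b' a acc x).
    rewrite /step restE accuE /hdc /tlc CodeSeq.codeK /=.
    by rewrite -/(cod _) muln_eq0 -leqn0 leqNgt expn_gt0.
  (* A state without remaining items is a fixed point, so any number of steps that is at least the
     length gives the result. *)
  have run m s acc x : size s <= m ->
      iteri m (fun m t => step m t x) (st s acc) = st [::] (foldl (fun acc a => b' a acc x) acc s).
    have -> : iteri m (fun m t => step m t x) =1 iter m (fun t => step 0 t x).
      by move=> t; elim: m => //= m ->.
    elim: m s acc => [|m IH] [|a s] acc //.
      by move=> _; elim: {IH} m.+1 => //= k ->; rewrite step0.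
    by rewrite ltnS iterSr stepS => /IH.
  have rstep : recursive (fun v : 3.-tuple nat => step (tnth v (@Ordinal 3 0 isT))
      (tnth v (@Ordinal 3 1 isT)) (tnth v (@Ordinal 3 2 isT))).
    have rrest : recursive (fun v : 3.-tuple nat => rest (tnth v (@Ordinal 3 1 isT))).
      by apply: (recursive_comp1 recursive_hdc); apply: rec_proj.
    apply: recursive_if => //; first exact: rec_proj.
    apply: (recursive_comp2 recursive_consc); first exact: (recursive_comp1 recursive_tlc).
    apply: (recursive_comp2 recursive_consc); last exact: recursive_const.
    have := rec_comp (h := fun i : 'I_3 => if val i is 0 then fun v => hdc (rest (tnth v (@Ordinal 3 1 isT)))
       else if val i is 1 then fun v => accu (tnth v (@Ordinal 3 1 isT)) else
       fun v => tnth v (@Ordinal 3 2 isT)) rb.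
    move=> rb'; apply: (recursive_ext _ (rb' _)).
      by move=> v; rewrite !tnth_mktuple.
    case=> [[|[|i]] ?] /=; [exact: (recursive_comp1 recursive_hdc)| |exact: rec_proj].
    by apply: (recursive_comp1 recursive_hdc); apply: (recursive_comp1 recursive_tlc); apply: rec_proj.
  have r0 : recursive1 (fun x => st (dec (l' x)) (z' x)).
    have r : recursive1 (fun x => consc (l' x) (consc (z' x) 0)).
      apply: (recursive_comp2 recursive_consc) => //.
      by apply: (recursive_comp2 recursive_consc) => //; apply: recursive_const.
    by apply: (recursive_ext _ r) => v; rewrite /st CodeSeq.decodeK.
  (* The code [l' x] itself serves as the number of steps, as the length of a list is at most its
     code. *)
  have r : recursive1 (fun x => accu (iteri (l' x) (fun m t => step m t x) (st (dec (l' x)) (z' x)))).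
    apply: (recursive_comp1 recursive_hdc); apply: (recursive_comp1 recursive_tlc).
    exact: (recursive1_iteri rl r0 rstep).
  apply: (recursive_ext _ r) => v; rewrite run ?accuE //.
  suff leq_size s : size s <= cod s by rewrite -[X in _ <= X]CodeSeq.decodeK.
  elim: s => //= a s IH; rewrite -/(cod s).
  apply: leq_trans (_ : (cod s).*2.+1 <= _); last by rewrite leq_pmull ?expn_gt0.
  by rewrite ltnS (leq_trans IH) // -addnn leq_addr.
move=> rl rz rb.
have rrev : recursive1 (fun x => cod (rev (dec (l x)))).
  have rc : recursive (fun v : 3.-tuple nat => consc (tnth v (@Ordinal 3 0 isT)) (tnth v (@Ordinal 3 1 isT))).
    by apply: (recursive_comp2 recursive_consc); apply: rec_proj.
  have := rfoldl l (fun _ => 0) (fun a acc x => consc a acc) rl (@recursive_const 1 0) rc.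
  apply: recursive_ext => v; rewrite /rev; move: (dec _) => s.
  suff E t : foldl (fun acc a => consc a acc) (cod t) s = cod (catrev s t) by exact: (E [::]).
  by elim: s t => [|a s IH] t //=; rewrite /consc CodeSeq.codeK IH.
apply: (recursive_ext _ (rfoldl _ _ _ rrev rz rb)) => v.
by rewrite CodeSeq.codeK foldl_rev.
Qed.

(** The environment travels as one number; binding the two variables of a loop body means consing
    twice onto it. *)
Lemma recursive_body b : recursive1 (fun x => ev b (dec x)) ->
  recursive (fun v : 3.-tuple nat => ev b [:: tnth v (@Ordinal 3 0 isT), tnth v (@Ordinal 3 1 isT)
    & dec (tnth v (@Ordinal 3 2 isT))]).
Proof.
move=> rb; have r : recursive (fun v : 3.-tuple nat => ev b (dec (consc (tnth v (@Ordinal 3 0 isT))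
   (consc (tnth v (@Ordinal 3 1 isT)) (tnth v (@Ordinal 3 2 isT)))))).
  apply: (recursive_comp1 rb); apply: (recursive_comp2 recursive_consc); first exact: rec_proj.
  by apply: (recursive_comp2 recursive_consc); apply: rec_proj.
by apply: (recursive_ext _ r) => v; rewrite /consc !CodeSeq.codeK.
Qed.

Lemma recursive_prog p : recursive1 (fun x => ev p (dec x)).
Proof.
elim/prog_nested_ind: p => /= [i||p IH|p q IHp IHq|p IH|p IH|n z b rn rz rb|l z b rl rz rb|l b rl rb|f args rf IH].
- elim: i => [|i IH].
    by apply: (recursive_ext _ recursive_hdc) => v; rewrite /hdc nth0.
  apply: (recursive_ext _ (recursive_comp1 IH recursive_tlc)) => v.
  by rewrite /tlc CodeSeq.codeK nth_behead.
- exact: recursive_const.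
- exact: recursive_succ.
- exact: (recursive_comp2 recursive_consc).
- exact: (recursive_comp1 recursive_hdc).
- exact: (recursive_comp1 recursive_tlc).
- apply: recursive1_iteri => //; exact: recursive_body.
- apply: recursive1_foldr => //; exact: recursive_body.
- have rbody : recursive (fun v : 3.-tuple nat => consc (ev b (tnth v (@Ordinal 3 0 isT) ::
      dec (tnth v (@Ordinal 3 2 isT)))) (tnth v (@Ordinal 3 1 isT))).
    apply: (recursive_comp2 recursive_consc); last exact: rec_proj.
    have r : recursive (fun v : 3.-tuple nat =>
        ev b (dec (consc (tnth v (@Ordinal 3 0 isT)) (tnth v (@Ordinal 3 2 isT))))).
      by apply: (recursive_comp1 rb); apply: (recursive_comp2 recursive_consc); apply: rec_proj.
    by apply: (recursive_ext _ r) => v; rewrite /consc CodeSeq.codeK.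
  have := recursive1_foldr (z := fun=> 0) (b := fun a acc x => consc (ev b (a :: dec x)) acc) rl (recursive_const 1 0) rbody.
  apply: recursive_ext => v; elim: (dec (ev l _)) => //= a s ->.
  by rewrite /consc CodeSeq.codeK.
- have r : recursive1 (fun x => cod [seq ev a (dec x) | a <- args]).
    elim: args IH => [_|a s IHs [ra rs]] /=; first exact: recursive_const.
    have := recursive_comp2 recursive_consc ra (IHs rs).
    by apply: recursive_ext => v; rewrite /consc CodeSeq.codeK.
  by apply: (recursive_ext _ (recursive_comp1 rf r)) => v; rewrite CodeSeq.codeK.
Qed.

(* Unbounded search for a certificate [k]; [p] then reads off the answer. *)
Lemma recursive_search (test p : prog) :
  (forall c, exists k, ev test [:: k; c] != 0) ->
  exists D : 1.-tuple nat -> nat, recursive D /\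
    forall c, exists2 k, ev test [:: k; c] != 0 & D [tuple c] = ev p [:: k; c].
Proof.
move=> ex; pose f c := ex_minn (ex c).
have rpair q : recursive2 (fun k c => ev q [:: k; c]).
  have r : recursive2 (fun k c => ev q (dec (consc k (consc c 0)))).
    apply: (recursive_comp1 (recursive_prog q)); apply: (recursive_comp2 recursive_consc).
      exact: rec_proj.
    by apply: (recursive_comp2 recursive_consc); [exact: rec_proj|exact: recursive_const].
  by apply: (recursive_ext _ r) => v; rewrite /consc !CodeSeq.codeK.
have rf : recursive1 f.
  pose g k c := 1 - ev test [:: k; c].
  have rg : recursive2 g by apply: (recursive_comp2 recursive_sub); [exact: recursive_const|exact: rpair].
  apply: (rec_min rg) => v.
  have E j : g (tnth [tuple of j :: v] ord0) (tnth [tuple of j :: v] (@Ordinal 2 1 isT)) = g j (thead v).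
    by rewrite /thead !(tnth_nth 0).
  rewrite E /f; case: ex_minnP => k tk min_k; split; first by rewrite /g; case: (ev test _) tk.
  move=> j lt_jk; rewrite E /g; case tj: (ev test _) => [|m] //.
  by have := min_k j; rewrite tj => /(_ isT); rewrite leqNgt lt_jk.
exists (fun v => ev p [:: f (thead v); thead v]); split.
  exact: (recursive_comp2 (rpair p) rf recursive_id).
by move=> c; exists (f c); rewrite /f //; case: ex_minnP.
Qed.

(** * Subgroups generated by sets *)

Local Open Scope group_scope.

Section Generated.
Variable W : groupType.
Implicit Types (T A S : W -> Prop) (x y u v w : W).

Definition gen T x := forall S, is_subgroup S -> (forall t, T t -> S t) -> S x.

Lemma gen_subgroup T : is_subgroup (gen T).
Proof.
split=> [S [S1 _ _] _ //|x y gx gy S sS TS|x gx S sS TS].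
  by case: (sS) => _ SM _; apply: SM; [apply: gx|apply: gy].
by case: (sS) => _ _; apply; apply: gx.
Qed.

Lemma genT T t : T t -> gen T t.
Proof. by move=> Tt S _; apply. Qed.

Lemma gen_min T S x : is_subgroup S -> (forall t, T t -> S t) -> gen T x -> S x.
Proof. by move=> sS TS; apply. Qed.

Lemma gen_mono T S x : (forall t, T t -> S t) -> gen T x -> gen S x.
Proof. by move=> TS; apply: gen_min; [exact: gen_subgroup|move=> t /TS; apply: genT]. Qed.

Lemma subgroup_prod S (s : seq W) : is_subgroup S -> {in s, forall x, S x} -> S (\prod_(x <- s) x).
Proof.
case=> S1 SM _; elim: s => [|x s IH] Ss; first by rewrite big_nil.
rewrite big_cons; apply: SM; first by apply: Ss; rewrite mem_head.
by apply: IH => y ys; apply: Ss; rewrite inE ys orbT.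
Qed.

Lemma subgroupX S x m : is_subgroup S -> S x -> S (x ^+ m).
Proof.
by case=> S1 SM _ Sx; elim: m => [|m IH]; rewrite ?expg0 // expgS; apply: SM.
Qed.

Lemma subgroupMl S x y : is_subgroup S -> S x -> S (x * y) <-> S y.
Proof.
case=> _ SM SV Sx; split=> [Sxy|]; last exact: SM.
by rewrite -(mulKg x y); apply: SM => //; apply: SV.
Qed.

Lemma subgroupMr S x y : is_subgroup S -> S x -> S (y * x) <-> S y.
Proof.
case=> _ SM SV Sx; split=> [Syx|Sy]; last exact: SM.
by rewrite -(mulgK x y); apply: SM => //; apply: SV.
Qed.

Lemma conj_div a x y z : a * x = z * (a * y) -> a * (x * y^-1) * a^-1 = z.
Proof. by move=> E; rewrite !mulgA E !mulgA mulgK mulgK. Qed.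

(** An equivalence is needed: conjugation can map an infinite subgroup properly into itself. *)
Definition normalizes A u := forall x, A (u * x * u^-1) <-> A x.

Lemma normalizesX A u m : normalizes A u -> normalizes A (u ^+ m).
Proof.
move=> nu; elim: m => [|m IH] x; first by rewrite expg0 mul1g invg1 mulg1.
rewrite -(IH x) -(nu (u ^+ m * x * _)) expgS invMg !mulgA.
by split.
Qed.

Lemma normalizesM A u v : normalizes A u -> normalizes A v -> normalizes A (u * v).
Proof. by move=> nu nv x; rewrite -(nv x) -(nu (v * x * _)) invMg !mulgA. Qed.

(* For [u] normalising [A] this is the subgroup generated by [A] and [u]. *)
Definition adjoin A u w := exists p q : nat, A (u ^+ p * w * (u ^+ q)^-1).

Lemma adjoin_subgroup A u : is_subgroup A -> normalizes A u -> is_subgroup (adjoin A u).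
Proof.
move=> sA nu; case: (sA) => A1 AM AV; split.
- by exists 0%N, 0%N; rewrite expg0 invg1 !mulg1.
- move=> x y [p [q Ax]] [p' [q' Ay]]; exists (p' + p), (q + q').
  (* Both factors are conjugated by powers of [u], which keeps them in [A]; these powers commute, so
     those between [x] and [y] cancel. *)
  have -> : u ^+ (p' + p) * (x * y) * (u ^+ (q + q'))^-1 =
     (u ^+ p' * (u ^+ p * x * (u ^+ q)^-1) * (u ^+ p')^-1) *
     (u ^+ q * (u ^+ p' * y * (u ^+ q')^-1) * (u ^+ q)^-1).
    have E : u ^+ q * u ^+ p' = u ^+ p' * u ^+ q by rewrite -!expgnDr addnC.
    rewrite !expgnDr !invMg !mulgA.
    have -> : forall a : W, a * (u ^+ q)^-1 * (u ^+ p')^-1 * u ^+ q * u ^+ p' = a.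
      by move=> a; rewrite -mulgA E !mulgA mulgVK mulgVK.
    by [].
  by apply: AM; apply/(normalizesX _ nu).
- move=> x [p [q Ax]]; exists q, p; rewrite -[X in X * _ * _]invgK -!invMg.
  by apply: AV; rewrite mulgA.
Qed.

Lemma adjoin_sub A u x : A x -> adjoin A u x.
Proof. by exists 0%N, 0%N; rewrite expg0 invg1 mulg1 mul1g. Qed.

Lemma adjoin_gen A u : A 1 -> adjoin A u u.
Proof. by move=> A1; exists 0%N, 1%N; rewrite expg0 expg1 mul1g mulgV. Qed.

(** Modulo [A] the element [v] commutes with [u], hence with all powers of [u]. So conjugating [w]
    by [v] changes the element tested for membership in [A] only by factors from [A] and by a
    conjugation. *)
Lemma adjoin_normalizes A u v : is_subgroup A -> normalizes A u -> normalizes A v ->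
  A (v * u * v^-1 * u^-1) -> normalizes (adjoin A u) v.
Proof.
move=> sA nu nv Avu.
pose c := v * u * v^-1 * u^-1.
have conjX k : A (v * u ^+ k * v^-1 * (u ^+ k)^-1).
  elim: k => [|k IH]; first by rewrite expg0 mulg1 mulgV invg1 mulg1; case: sA.
  have -> : v * u ^+ k.+1 * v^-1 * (u ^+ k.+1)^-1 =
     c * (u * (v * u ^+ k * v^-1 * (u ^+ k)^-1) * u^-1).
    by rewrite expgS invMg /c !mulgA !mulgVK.
  by case: (sA) => _ AM _; apply: AM => //; apply/nu.
have key p q w : A (u ^+ p * (v * w * v^-1) * (u ^+ q)^-1) <-> A (u ^+ p * w * (u ^+ q)^-1).
  rewrite -(nv (u ^+ p * w * _)).
  have -> : v * (u ^+ p * w * (u ^+ q)^-1) * v^-1 =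
    (v * u ^+ p * v^-1 * (u ^+ p)^-1) * (u ^+ p * (v * w * v^-1) * (u ^+ q)^-1)
    * (v * u ^+ q * v^-1 * (u ^+ q)^-1)^-1.
    by rewrite !invMg !invgK !mulgA !mulgVK.
  rewrite (subgroupMr _ sA); last by case: sA => _ _; apply.
  by rewrite (subgroupMl _ sA).
by move=> w; split=> [] [p [q Aw]]; exists p, q; apply/key.
Qed.

Definition adjoins A (us : seq W) := foldl adjoin A us.

Definition powers (us : seq W) (p : nat -> nat) := \prod_(i < size us) nth 1 us i ^+ p i.

Lemma powers_rcons us u p : powers (rcons us u) p = powers us p * u ^+ p (size us).
Proof.
rewrite /powers size_rcons big_ord_recr /= nth_rcons ltnn eqxx; congr (_ * _).
by apply: eq_bigr => i _; rewrite nth_rcons ltn_ord.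
Qed.

Lemma eq_powers us p q : (forall i, i < size us -> p i = q i) -> powers us p = powers us q.
Proof. by move=> pq; apply: eq_bigr => i _; rewrite pq. Qed.

Lemma powers_subgroup S us p : is_subgroup S -> {in us, forall u, S u} -> S (powers us p).
Proof.
move=> sS Sus; case: (sS) => S1 SM _; apply: big_ind => // i _.
by apply: subgroupX => //; apply/Sus/mem_nth.
Qed.

Lemma powers_normalizes A us p : {in us, forall u, normalizes A u} -> normalizes A (powers us p).
Proof.
move=> nus; apply: (big_ind (normalizes A)) => [x|u v|i _]; last by apply: normalizesX; apply: nus; apply: mem_nth.
  by rewrite mul1g invg1 mulg1.
exact: normalizesM.
Qed.

(** Powers are allowed on both sides, so natural exponents suffice: a negative exponent on one side
    is a positive one on the other. *)
Lemma adjoinsP A us w :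
  adjoins A us w <-> exists p q, A (powers us p * w * (powers us q)^-1).
Proof.
rewrite /adjoins; elim/last_ind: us w => [|us u IH] w.
  split=> [Aw|[p [q]]]; last by rewrite /powers !big_ord0 mul1g invg1 mulg1.
  by exists (fun=> 0%N), (fun=> 0%N); rewrite /powers !big_ord0 mul1g invg1 mulg1.
rewrite foldl_rcons; split=> [[a [b /IH [p [q Aw]]]]|[p [q Aw]]].
  exists (fun i => if i < size us then p i else a), (fun i => if i < size us then q i else b).
  rewrite !powers_rcons ltnn invMg !mulgA; move: Aw; rewrite !mulgA.
  have E r c : powers us (fun i => if i < size us then r i else c) = powers us r.
    by apply: eq_powers => i ->.
  by rewrite !E.
exists (p (size us)), (q (size us)); apply/IH; exists p, q.
by move: Aw; rewrite !powers_rcons invMg !mulgA.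
Qed.

(** The hypotheses survive the adjunction of the first generator: the others normalise the larger
    group by [adjoin_normalizes], because their commutators with it lie in [A]. *)
Lemma adjoins_subgroup A us : is_subgroup A -> {in us, forall u, normalizes A u} ->
  {in us &, forall u v, A (u * v * u^-1 * v^-1)} ->
  is_subgroup (adjoins A us).
Proof.
elim: us A => [|u us IH] A //= sA nA cA.
have nu : normalizes A u by apply: nA; rewrite mem_head.
apply: IH; first exact: adjoin_subgroup.
  move=> v vs; have v_us : v \in u :: us by rewrite inE vs orbT.
  by apply: adjoin_normalizes => //; [apply: nA|apply: cA => //; rewrite mem_head].
move=> v w vs ws; apply: adjoin_sub; apply: cA; by rewrite inE ?vs ?ws orbT.
Qed.

Lemma adjoins_sub A us x : A x -> adjoins A us x.
Proof. by elim: us A => //= u us IH A Ax; apply: IH; apply: adjoin_sub. Qed.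

Lemma mem_adjoins A us : A 1 -> {in us, forall u, adjoins A us u}.
Proof.
elim: us A => [|u us IH] A A1 v //; rewrite inE => /predU1P [->|vs] /=.
  by apply: adjoins_sub; apply: adjoin_gen.
by apply: IH => //; apply: adjoin_sub.
Qed.

End Generated.

(** * Leading lamps in wreath products *)

Section WreathBasics.
Variables (G : groupType) (n : nat).
Notation V := 'rV[int]_n.
Notation W := (wreath G n).
Implicit Types (a b c : V) (x y u w : W).

Lemma posM x y : pos (x * y) = (pos x + pos y)%R. Proof. by []. Qed.
Lemma pos1 : pos (1 : W) = 0%R. Proof. by []. Qed.
Lemma posV x : pos x^-1 = (- pos x)%R. Proof. by []. Qed.
Lemma lampM x y a : lamp (x * y) a = lamp x a * lamp y (a - pos x)%R.
Proof. by rewrite /= lampsME shiftE. Qed.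
Lemma lamp1 a : lamp (1 : W) a = 1. Proof. exact: lamps1E. Qed.
Lemma lampV x a : lamp x^-1 a = (lamp x (a + pos x)%R)^-1.
Proof. by rewrite /= shiftE lampsVE opprK. Qed.
Definition simp_wreath := (posM, pos1, posV, lampM, lamp1, lampV).

Lemma posX x m : pos (x ^+ m) = (pos x *+ m)%R.
Proof. by elim: m => [|m IH]; rewrite ?expg0 ?mulr0n // expgS posM IH mulrS. Qed.

Lemma lamp_conj u x a : pos x = 0%R ->
  lamp (u * x * u^-1) a = lamp u a * lamp x (a - pos u)%R * (lamp u a)^-1.
Proof. by move=> px; rewrite !simp_wreath px addr0 subrK. Qed.

Lemma pos_conj u x : pos (u * x * u^-1) = pos x.
Proof. by rewrite !simp_wreath addrAC subrr add0r. Qed.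

(** An element without lamps, so that conjugation by it is a pure translation. It need not belong to
    the subgroup under study, which is why translations have to be justified there. *)
Definition sh a : W := Wreath (lamps1 G n) a.
Definition shc a x := sh a * x * (sh a)^-1.

Lemma lamp_sh a b : lamp (sh a) b = 1. Proof. exact: lamps1E. Qed.
Lemma shD a b : sh (a + b)%R = sh a * sh b.
Proof. by apply: wreath_eq => // c; rewrite lampM !lamp_sh mulg1. Qed.
Lemma shV a : sh (- a)%R = (sh a)^-1.
Proof. by apply: wreath_eq => // c; rewrite lampV !lamp_sh invg1. Qed.
Lemma sh0 : sh 0%R = 1. Proof. by []. Qed.

Lemma lamp_shc a x b : pos x = 0%R -> lamp (shc a x) b = lamp x (b - a)%R.
Proof. by move=> px; rewrite lamp_conj // lamp_sh mul1g invg1 mulg1. Qed.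
Lemma pos_shc a x : pos (shc a x) = pos x. Proof. exact: pos_conj. Qed.
Lemma shcD a b x : shc (a + b)%R x = shc a (shc b x).
Proof. by rewrite /shc shD invMg !mulgA. Qed.
Lemma shc0 x : shc 0%R x = x. Proof. by rewrite /shc sh0 mul1g invg1 mulg1. Qed.
Lemma shcM a x y : shc a (x * y) = shc a x * shc a y.
Proof. by rewrite /shc !mulgA mulgVK. Qed.
Lemma shcV a x : shc a x^-1 = (shc a x)^-1.
Proof. by rewrite /shc !invMg invgK mulgA. Qed.
Lemma shc1 a : shc a 1 = 1.
Proof. by rewrite /shc mulg1 mulgV. Qed.
Lemma shc_prod a I (s : seq I) (F : I -> W) :
  shc a (\prod_(i <- s) F i) = \prod_(i <- s) shc a (F i).
Proof. by elim: s => [|x s IH]; rewrite ?big_nil ?shc1 // !big_cons shcM IH. Qed.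

Lemma supp_fin x b : lamp x b != 1 -> b \in (finsupp (lamp x) : seq V).
Proof. by rewrite mem_finsupp. Qed.

Definition supp_in (D : V -> Prop) x := pos x = 0%R /\ forall b, lamp x b != 1 -> D b.

Lemma supp_in_subgroup D : is_subgroup (supp_in D).
Proof.
split=> [|x y [px Dx] [py Dy]|x [px Dx]]; split=> //.
- by move=> b; rewrite lamp1 eqxx.
- by rewrite posM px py addr0.
- move=> b; rewrite lampM px subr0 => xyb; have [xb|/Dx //] := eqVneq (lamp x b) 1.
  by apply: Dy; rewrite xb mul1g in xyb.
- by rewrite posV px oppr0.
- by move=> b; rewrite lampV px addr0 invg_eq1 => /Dx.
Qed.

Lemma supp_in_mono (D E : V -> Prop) x : (forall b, D b -> E b) -> supp_in D x -> supp_in E x.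
Proof. by move=> DE [px Dx]; split=> // b /Dx /DE. Qed.

(** Conjugation by [u] moves the lamps of [x] by [pos u] and then conjugates each by the lamp of [u]
    at the new site; where [u] has no lamp, only the move is left. *)
Lemma conj_disjoint u x : pos x = 0%R ->
  (forall b, lamp x b != 1 -> lamp u (b + pos u)%R = 1) -> u * x * u^-1 = shc (pos u) x.
Proof.
move=> px dis; apply: wreath_eq => [b|]; last by rewrite pos_conj pos_shc.
rewrite lamp_conj // lamp_shc //.
have [->|/dis] := eqVneq (lamp x (b - pos u)%R) 1; first by rewrite mulg1 mulgV.
by rewrite subrK => ->; rewrite mul1g invg1 mulg1.
Qed.

Lemma commute_disjoint x y : pos x = 0%R -> pos y = 0%R ->
  (forall b, lamp x b != 1 -> lamp y b = 1) -> x * y = y * x.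
Proof.
move=> px py dis; apply: wreath_eq => [b|]; last by rewrite !posM px py.
rewrite !lampM px py subr0; have [->|/dis ->] := eqVneq (lamp x b) 1.
  by rewrite mulg1 mul1g.
by rewrite mulg1 mul1g.
Qed.

Lemma disjoint_or x y : (forall b, lamp x b != 1 -> lamp y b = 1) \/
  exists b, lamp x b != 1 /\ lamp y b != 1.
Proof.
apply: NNPP => no; apply: (no); left=> b xb; apply/eqP/negPn/negP => yb.
by apply: no; right; exists b.
Qed.

Lemma wreath_neq1 x : pos x = 0%R -> x <> 1 -> exists b, lamp x b != 1.
Proof.
move=> px nx; apply: NNPP => none; apply: nx; apply: wreath_eq => // b.
by rewrite lamp1; apply/eqP/negPn/negP => xb; apply: none; exists b.
Qed.

Section Grobner.
Variable le : rel V.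
Hypotheses (le_refl : reflexive le) (le_trans : transitive le)
  (le_total : total le) (le_anti : antisymmetric le)
  (le_wf : forall P : V -> Prop, (exists a, P a) -> exists2 a, P a & forall b, P b -> le a b).

Definition prec b a := ~~ le a b.
Definition upto a := supp_in (fun b => le b a).
Definition below a := supp_in (fun b => prec b a).

Lemma precW b a : prec b a -> le b a.
Proof. by rewrite /prec; case/orP: (le_total a b) => ->. Qed.
Lemma le_prec_trans b a c : le b a -> prec a c -> prec b c.
Proof. by move=> ba; apply: contraNN => cb; apply: le_trans ba. Qed.
Lemma prec_le_trans b a c : prec b a -> le a c -> prec b c.
Proof. by rewrite /prec => + ac; apply: contraNN => cb; apply: le_trans cb. Qed.
Lemma le_eqVprec b a : le b a -> b = a \/ prec b a.
Proof.
move=> ba; rewrite /prec; case ab: (le a b); last by right.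
by left; apply: le_anti; rewrite ba.
Qed.

Lemma upto_mono a b x : le a b -> upto a x -> upto b x.
Proof. by move=> ab; apply: supp_in_mono => c ca; apply: le_trans ab. Qed.
Lemma below_upto a x : below a x -> upto a x.
Proof. by apply: supp_in_mono => b; apply: precW. Qed.
Lemma upto_below a b x : prec a b -> upto a x -> below b x.
Proof. by move=> ab; apply: supp_in_mono => c ca; apply: le_prec_trans ab. Qed.
Lemma below_triv a x : upto a x -> lamp x a = 1 -> below a x.
Proof. 
move=> [px ux] xa; split=> // b xb; have [ba|//] := le_eqVprec (ux _ xb).
by rewrite ba xa eqxx in xb.
Qed.

Lemma max_list (s : seq V) : s <> [::] -> exists2 a, a \in s & {in s, forall b, le b a}.
Proof.
elim: s => // a [|b s] IH _; first by exists a; rewrite ?mem_head // => c /[!inE]/eqP ->.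
have [//|m ms max_m] := IH; case/orP: (le_total a m) => am.
  exists m; first by rewrite inE ms orbT.
  by move=> c; rewrite inE => /predU1P [->|/max_m].
exists a; first exact: mem_head.
move=> c; rewrite inE => /predU1P [->|/max_m cm]; first exact: le_refl.
exact: le_trans am.
Qed.

Lemma lead x : pos x = 0%R -> x <> 1 -> exists2 a, lamp x a != 1 & upto a x.
Proof.
move=> px /(wreath_neq1 px) [b xb].
have [|a] := @max_list (finsupp (lamp x)); first by move=> s0; have := supp_fin xb; rewrite s0.
by rewrite mem_finsupp => xa max_a; exists a => //; split=> // c /supp_fin /max_a.
Qed.

Lemma exists_upto x : pos x = 0%R -> exists a, upto a x.
Proof.
move=> px; have [->|nx] := classic (x = 1).
  by exists 0%R; case: (supp_in_subgroup (fun b => le b 0%R)).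
by have [a _] := lead px nx; exists a.
Qed.

Section Criterion.
Variable T : W -> Prop.
Hypotheses (T1 : T 1) (T0 : forall t, T t -> pos t = 0%R).
Let S a := gen (fun t => T t /\ below a t).
Hypothesis critb : forall a t t', T t -> T t' -> upto a t -> upto a t' ->
  exists t'' s, [/\ T t'', upto a t'', S a s & t' = t * t'' * s].
Hypothesis critc : forall a t s, T t -> upto a t -> T s -> below a s ->
  S a (t^-1 * s * t).

Let X a x := exists t s, [/\ T t, upto a t, S a s & x = t * s].

Let S_conj a t s : T t -> upto a t -> S a s -> S a (t^-1 * s * t).
Proof.
move=> Tt ut; have [S1 SM SV] : is_subgroup (S a) by exact: gen_subgroup.
have sS' : is_subgroup (fun s => S a (t^-1 * s * t)).
  split=> [|x y Sx Sy|x Sx]; first by rewrite mulg1 mulVg.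
    have -> : t^-1 * (x * y) * t = (t^-1 * x * t) * (t^-1 * y * t) by rewrite !mulgA mulgK.
    exact: SM.
  by have := SV _ Sx; rewrite !invMg invgK mulgA.
by apply: (gen_min sS') => r [Tr br]; apply: critc.
Qed.

Let X_subgroup a : is_subgroup (X a).
Proof.
have [S1 SM SV] : is_subgroup (S a) by exact: gen_subgroup.
have div x y : X a x -> X a y -> X a (x^-1 * y).
  move=> [t [s [Tt ut Ss ->]]] [t' [s' [Tt' ut' Ss' ->]]].
  have [t'' [r [Tt'' ut'' Sr ->]]] := critb Tt Tt' ut ut'.
  exists t'', (t''^-1 * s^-1 * t'' * (r * s')); split=> //.
    by apply: (SM); [apply: S_conj => //; apply: SV|apply: SM].
  by rewrite invMg !mulgA mulgVK mulgV mul1g.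
have X1 : X a 1.
  by exists 1, 1; split=> //; [case: (supp_in_subgroup (fun b => le b a))|rewrite mulg1].
have XV x : X a x -> X a x^-1 by move=> Xx; rewrite -(mulg1 x^-1); apply: div.
by split=> // x y Xx Xy; rewrite -(invgK x); apply: div => //; apply: XV.
Qed.

(** By [critb] and [critc] the products of one member of [T] supported up to [a] with an element of
    [S a] form a group [X a]. It therefore contains every product of members of [T] supported up to
    [a], and the lamp of such a product at [a] is that of a single member of [T]. *)
Theorem grobner_lead x : gen T x -> x <> 1 ->
  exists a t, [/\ lamp x a != 1, upto a x, T t, upto a t & lamp t a = lamp x a].
Proof.
move=> gx nx.
pose U a := gen (fun t => T t /\ upto a t).
have U_mono a b y : le a b -> U a y -> U b y.
  by move=> ab; apply: gen_mono => t [Tt /(upto_mono ab)].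
have U_upto a y : U a y -> upto a y.
  by apply: (gen_min (S := upto a)) => [|t []//]; exact: supp_in_subgroup.
have exU : exists a, U a x.
  apply: (gen_min (S := fun y => exists a, U a y) _ _ gx) => [|t Tt]; last first.
    by have [a ut] := exists_upto (T0 Tt); exists a; apply: genT.
  split=> [|y z [a Ua] [b Ub]|y [a Ua]].
  - by exists 0%R; case: (gen_subgroup (fun t => T t /\ upto 0%R t)).
  - case/orP: (le_total a b) => ab; [exists b|exists a].
      by case: (gen_subgroup (fun t => T t /\ upto b t)) => _ + _; apply=> //; apply: U_mono ab _.
    by case: (gen_subgroup (fun t => T t /\ upto a t)) => _ + _; apply=> //; apply: U_mono ab _.
  - by exists a; case: (gen_subgroup (fun t => T t /\ upto a t)) => _ _; apply.
(* Among all ways to write [x] with generators from [T], choose one whose bound [a] on their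
   supports is least. If the lamp of [x] at [a] were trivial, the bound could be lowered. *)
have [a Ua min_a] := le_wf exU.
have [t [s [Tt ut Ss xE]]] : X a x.
  apply: (gen_min (X_subgroup a) _ Ua) => t [Tt ut]; exists t, 1; split; rewrite ?mulg1 //.
  by case: (gen_subgroup (fun t => T t /\ below a t)).
have bs : below a s by apply: (gen_min (S := below a) _ _ Ss) => [|r []//]; exact: supp_in_subgroup.
have sa : lamp s a = 1.
  by apply/eqP/negPn/negP => /(proj2 bs); rewrite /prec le_refl.
have xa : lamp x a = lamp t a by rewrite xE lampM (T0 Tt) subr0 sa mulg1.
have [ta|ta] := eqVneq (lamp t a) 1; last by exists a, t; rewrite xa; split=> //; exact: U_upto.
have Sx : S a x.
  have [_ SM _] := gen_subgroup (fun t => T t /\ below a t).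
  by rewrite xE; apply: SM => //; apply: genT; split=> //; apply: below_triv.
(* Each nontrivial generator of [S a] has a leading position before [a]. An element of [S a]
   involves finitely many of them, and the largest of these positions is a smaller bound. *)
suff [//|[b lt_ba Ub]] : x = 1 \/ exists2 b, prec b a & U b x.
  by have := min_a _ Ub; rewrite (negbTE lt_ba).
apply: (gen_min (S := fun y => y = 1 \/ exists2 b, prec b a & U b y) _ _ Sx) => [|r [Tr br]]; last first.
  have [->|nr] := classic (r = 1); [by left|right].
  by have [b rb ur] := lead (T0 Tr) nr; exists b; [apply: (proj2 br)|apply: genT].
split=> [|y z [->|[b ltb Ub]]|y [->|[b ltb Ub]]]; first by left.
- by rewrite mul1g.
- case=> [->|[c ltc Uc]]; first by rewrite mulg1; right; exists b.
  right; case/orP: (le_total b c) => bc; [exists c|exists b] => //.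
    by case: (gen_subgroup (fun t => T t /\ upto c t)) => _ + _; apply=> //; apply: U_mono bc _.
  by case: (gen_subgroup (fun t => T t /\ upto b t)) => _ + _; apply=> //; apply: U_mono bc _.
- by left; rewrite invg1.
- by right; exists b => //; case: (gen_subgroup (fun t => T t /\ upto b t)) => _ _; apply.
Qed.

End Criterion.

(* Conversely, if leading terms of [S] are leading terms of [T] then every     *)
(* element of [S] is a product of elements of [T] with decreasing leads.       *)
Section Reduction.
Variables (T S : W -> Prop).
Hypotheses (T1 : T 1) (sS : is_subgroup S) (TS : forall t, T t -> S t)
  (S0 : forall x, S x -> pos x = 0%R)
  (leadT : forall x a, S x -> lamp x a != 1 -> upto a x ->
     exists t, [/\ T t, upto a t & lamp t a = lamp x a]).

Lemma reduce x a : S x -> upto a x -> exists t s,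
  [/\ T t, upto a t, forall r, r \in s -> T r /\ below a r & x = t * \prod_(r <- s) r].
Proof.
have upto1 b : upto b 1 by case: (supp_in_subgroup (fun c => le c b)).
suff H b : forall x, S x -> upto b x -> exists t s,
  [/\ T t, upto b t, forall r, r \in s -> T r /\ below b r & x = t * \prod_(r <- s) r] by exact: H.
apply: NNPP => no; have := @le_wf (fun b => ~ forall x, S x -> upto b x -> exists t s,
  [/\ T t, upto b t, forall r, r \in s -> T r /\ below b r & x = t * \prod_(r <- s) r]).
case=> [|{no}a' no min_a]; first by exists b.
apply: no => {}x Sx ux.
have [t [Tt ut tx]] : exists t, [/\ T t, upto a' t & lamp t a' = lamp x a'].
  have [xa|xa] := eqVneq (lamp x a') 1; last exact: leadT.
  by exists 1; split; rewrite // xa lamp1.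
have bx : below a' (t^-1 * x).
  apply: below_triv.
    by case: (supp_in_subgroup (fun c => le c a')) => _ uM uV; apply: uM => //; apply: uV.
  by rewrite !simp_wreath (S0 (TS Tt)) oppr0 !addr0 ?subr0 tx mulVg.
have [x1|nx] := classic (t^-1 * x = 1).
  exists t, [::]; split=> //; rewrite big_nil mulg1.
  by rewrite -[x](mulKg t^-1) invgK x1 mulg1.
have Sx' : S (t^-1 * x) by case: (sS) => _ SM SV; apply: SM => //; apply: SV; apply: TS.
have [c xc uc] := lead (S0 Sx') nx.
have ltc : prec c a' by apply: (proj2 bx).
have [t' [s [Tt' ut' Hs E]]] : exists t' s, [/\ T t', upto c t',
   forall r, r \in s -> T r /\ below c r & t^-1 * x = t' * \prod_(r <- s) r].
  apply: NNPP => no; have := min_a c; rewrite (negbTE ltc) => /(_ _) H.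
  by suff: False by []; apply/notF/H => /(_ _ Sx' uc).
exists t, (t' :: s); split=> // [r|]; last by rewrite big_cons -E mulVKg.
rewrite inE => /predU1P [->|/Hs [Tr br]]; first by split=> //; apply: upto_below ut'.
by split=> //; apply: upto_below (below_upto br).
Qed.
End Reduction.
End Grobner.
End WreathBasics.

(** * Subgroups at infinity *)

Section Twist.
Variables (G : groupType) (n : nat).
Notation V := 'rV[int]_n.
Notation W := (wreath G n).
Implicit Types (a b c : V) (x y u w : W).
Variables (phi : V -> int) (t : W).
Hypothesis phiD : forall a b, phi (a + b)%R = (phi a + phi b)%R.

Lemma phi0 : phi 0%R = 0%R.
Proof. by have := phiD 0%R 0%R; rewrite addr0 -[X in X = _]addr0 => /addrI. Qed.
Lemma phiN a : phi (- a)%R = (- phi a)%R.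
Proof. by apply/eqP; rewrite -addr_eq0 -phiD addNr phi0. Qed.
Lemma phiMn a m : phi (a *+ m)%R = (phi a *+ m)%R.
Proof. by elim: m => [|m IH]; rewrite ?mulr0n ?phi0 // !mulrS phiD IH. Qed.

Lemma phi_bound w : exists C : nat, forall a, lamp w a != 1 -> (`|phi a| <= C%:Z)%R.
Proof.
exists (\sum_(a <- (finsupp (lamp w) : seq V)) `|phi a|)%N => a /supp_fin.
elim: (finsupp (lamp w) : seq V) => // b s IH; rewrite inE big_cons => /predU1P [->|/IH]; lia.
Qed.

(** All lamps of [y] lie strictly ahead of those of [t] in the direction [phi], so conjugation by
    [t] cannot disturb them. *)
Definition far y := pos y = 0%R /\
  forall a b, lamp y a != 1 -> lamp t b != 1 -> (phi b < phi a)%R.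

(** The alternative [t = 1] serves subgroups whose elements all have position 0, for which there is
    no direction to move in. *)
Definition drifting := (0 < phi (pos t))%R \/ t = 1.

Lemma drifting_ge0 : drifting -> (0 <= phi (pos t))%R.
Proof. by case=> [|->]; [lia|rewrite pos1 phi0]. Qed.

Lemma lamp_conjX m x a : pos x = 0%R ->
  (lamp (t ^+ m * x * (t ^+ m)^-1) a != 1) = (lamp x (a - pos t *+ m)%R != 1).
Proof.
by move=> px; rewrite lamp_conj // posX divg_eq1 -[X in _ == X]mulg1 (inj_eq (@mulgI _ _)).
Qed.

(** A drift that is not negative keeps the translates of [y] ahead of the lamps of [t], so
    [conj_disjoint] applies at each step. *)
Lemma far_pure y m : drifting -> far y ->
  t ^+ m * y * (t ^+ m)^-1 = shc (pos t *+ m)%R y.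
Proof.
move=> /drifting_ge0 t_ge0 [py fy]; elim: m => [|m IH].
  by rewrite expg0 mulr0n shc0 mul1g invg1 mulg1.
have -> : t ^+ m.+1 * y * (t ^+ m.+1)^-1 = t * (t ^+ m * y * (t ^+ m)^-1) * t^-1.
  by rewrite expgS invMg !mulgA.
rewrite IH mulrS shcD conj_disjoint ?pos_shc // => b.
rewrite lamp_shc // => /fy yb; apply/eqP/negPn/negP => /yb.
by rewrite !phiD phiN phiMn; nia.
Qed.

Lemma escape x C : pos x = 0%R -> (0 < phi (pos t))%R ->
  exists N, forall m, N <= m -> forall a, lamp (t ^+ m * x * (t ^+ m)^-1) a != 1 -> (C < phi a)%R.
Proof.
move=> px t_gt0; have [D HD] := phi_bound x.
exists (D + `|C|%N).+1 => m le_m a; rewrite lamp_conjX // => /HD.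
by rewrite phiD phiN phiMn; nia.
Qed.

Lemma eventually_far x : drifting -> pos x = 0%R ->
  exists N, forall m, N <= m -> far (t ^+ m * x * (t ^+ m)^-1).
Proof.
case=> [t_gt0|t1] px; last first.
  by exists 0%N => m _; split=> [|a b _]; rewrite ?pos_conj // t1 lamp1 eqxx.
have [C HC] := phi_bound t; have [N HN] := escape (C%:Z)%R px t_gt0.
exists N => m /HN H; split=> [|a b /H Ha /HC]; rewrite ?pos_conj //; lia.
Qed.

Section Untwist.
Variables (S : W -> Prop) (Lat : V -> Prop).
Hypotheses (sS : is_subgroup S) (S0 : forall x, S x -> pos x = 0%R)
  (LatN : forall a, Lat a -> Lat (- a)%R)
  (S_shc : forall a x, Lat a -> S x -> S (shc a x)) (tLat : Lat (pos t)).

(** [S] records configurations as they look far out, where translation is harmless; conjugation by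
    powers of [t] transports them back to their true, distorted form near the origin. *)
Definition untwist x := pos x = 0%R /\
  exists N, forall m, N <= m -> S (t ^+ m * x * (t ^+ m)^-1).

Lemma untwist_subgroup : is_subgroup untwist.
Proof.
case: (sS) => S1 SM SV; split.
- by split=> //; exists 0%N => m _; rewrite mulg1 mulgV.
- move=> x y [px [N HN]] [py [M HM]]; split; first by rewrite posM px py addr0.
  exists (maxn N M) => m; rewrite geq_max => /andP [/HN Sx /HM Sy].
  by have := SM _ _ Sx Sy; rewrite !mulgA mulgVK.
- move=> x [px [N HN]]; split; first by rewrite posV px oppr0.
  by exists N => m /HN /SV; rewrite !invMg invgK mulgA.
Qed.

Lemma untwist_t : normalizes untwist t.
Proof.
move=> x; rewrite /untwist pos_conj.
have E m : t ^+ m * (t * x * t^-1) * (t ^+ m)^-1 = t ^+ m.+1 * x * (t ^+ m.+1)^-1.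
  by rewrite expgSr invMg !mulgA.
split=> [] [px [N HN]]; split=> //.
  by exists N.+1 => [] [//|m] /HN; rewrite E.
by exists N => m le_m; rewrite E; apply: HN; apply: leqW.
Qed.

Lemma shcS a x : Lat a -> S (shc a x) <-> S x.
Proof.
move=> La; split=> [|Sx]; last exact: S_shc.
by move=> /(S_shc (LatN La)); rewrite -shcD addNr shc0.
Qed.

Lemma far_untwist y : drifting -> far y -> untwist y <-> S y.
Proof.
move=> pt fy; have St m : S (t ^+ m * y * (t ^+ m)^-1) <-> S y.
  rewrite (far_pure _ pt fy); elim: m => [|m IH]; first by rewrite mulr0n shc0.
  by rewrite mulrS shcD shcS.
split=> [[_ [N HN]]|Sy]; first by apply/(St N); apply: HN.
by split; [exact: S0|exists 0%N => m _; apply/St].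
Qed.

(** After conjugation by a high power of [t], the element [x] lies where [u] acts by translation,
    and [S] is invariant under that. The same power turns [u] into [k * u], with [k] a product of
    conjugates of the given commutator, so [k] lies in [untwist]. *)
Lemma untwist_normalizes u : (0 < phi (pos t))%R -> Lat (pos u) ->
  untwist (t * u * t^-1 * u^-1) -> normalizes untwist u.
Proof.
move=> t_gt0 Lu Utu x.
have pt : drifting by left.
suff H : pos x = 0%R -> untwist (u * x * u^-1) <-> untwist x.
  split=> Ux; apply/H => //; case: Ux => //.
  by rewrite pos_conj.
move=> px.
have [sU1 sUM sUV] := untwist_subgroup.
have Uk m : untwist (t ^+ m * u * (t ^+ m)^-1 * u^-1).
  elim: m => [|m IH]; first by rewrite expg0 mul1g invg1 mulg1 mulgV.
  have -> : t ^+ m.+1 * u * (t ^+ m.+1)^-1 * u^-1 =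
    (t * (t ^+ m * u * (t ^+ m)^-1 * u^-1) * t^-1) * (t * u * t^-1 * u^-1).
    by rewrite expgS invMg !mulgA !mulgVK.
  by apply: sUM => //; apply/untwist_t.
have [Ct HCt] := phi_bound t; have [Cu HCu] := phi_bound u.
(* The bound puts the lamps of [y] ahead of those of [t] and of [u], even after a translation by
   [pos u]. *)
have [N HN] := escape (Ct%:Z + Cu%:Z + `|phi (pos u)|)%R px t_gt0.
pose y := t ^+ N * x * (t ^+ N)^-1.
have py : pos y = 0%R by rewrite pos_conj.
have Hy a : lamp y a != 1 -> (Ct%:Z + Cu%:Z + `|phi (pos u)| < phi a)%R by apply: HN.
have fy : far y by split=> // a b /Hy + /HCt; lia.
have fuy : far (shc (pos u) y).
  split=> [|a b]; rewrite ?pos_shc // lamp_shc // => /Hy + /HCt.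
  by rewrite phiD phiN; lia.
have yE : u * y * u^-1 = shc (pos u) y.
  apply: conj_disjoint => // b /Hy yb; apply/eqP/negPn/negP => /HCu.
  by rewrite phiD; lia.
have normX z : untwist (t ^+ N * z * (t ^+ N)^-1) <-> untwist z.
  exact: (normalizesX N untwist_t).
rewrite -(normX (u * _ * _)) -(normX x) -/y.
pose k := t ^+ N * u * (t ^+ N)^-1 * u^-1.
have -> : t ^+ N * (u * x * u^-1) * (t ^+ N)^-1 = k * (u * y * u^-1) * k^-1.
  by rewrite /k /y !invMg !invgK !mulgA !mulgVK.
have Ukn : untwist k by apply: Uk.
rewrite (subgroupMr _ untwist_subgroup (sUV _ Ukn)) (subgroupMl _ untwist_subgroup Ukn).
rewrite yE !far_untwist //.
exact: shcS.
Qed.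
End Untwist.

(* The part of a subgroup [H] that is visible far out in the direction of [t]. *)
Section Infinity.
Variable H : W -> Prop.
Hypotheses (sH : is_subgroup H) (Ht : H t) (pt : drifting).

Definition at_infinity x := pos x = 0%R /\
  exists N, forall m, N <= m -> H (shc (pos t *+ m)%R x).

Lemma at_infinity_subgroup : is_subgroup at_infinity.
Proof.
case: (sH) => H1 HM HV; split.
- by split=> //; exists 0%N => m _; rewrite shc1.
- move=> x y [px [N HN]] [py [M HM']]; split; first by rewrite posM px py addr0.
  exists (maxn N M) => m; rewrite geq_max => /andP [/HN Hx /HM' Hy].
  by rewrite shcM; apply: HM.
- move=> x [px [N HN]]; split; first by rewrite posV px oppr0.
  by exists N => m /HN /HV; rewrite shcV.
Qed.

(** Far enough out the lamps of [x] avoid those of [u]. There the translation by [pos u] coincides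
    with conjugation by [u], which preserves [H]. *)
Lemma at_infinity_shc u x : (0 < phi (pos t))%R -> H u ->
  at_infinity x -> at_infinity (shc (pos u) x).
Proof.
move=> t_gt0 Hu [px [N HN]]; split; first by rewrite pos_shc.
have [Cu HCu] := phi_bound u; have [Cx HCx] := phi_bound x.
exists (maxn N (Cu + Cx + `|phi (pos u)|%N).+1) => m; rewrite geq_max => /andP [/HN Hx le_m].
rewrite -shcD addrC shcD -conj_disjoint ?pos_shc //.
  by case: (sH) => _ HM HV; apply: (HM) => //; [apply: HM|apply: HV].
move=> b; rewrite lamp_shc // => /HCx; rewrite phiD phiN phiMn => xb.
by apply/eqP/negPn/negP => /HCu; rewrite phiD; nia.
Qed.

(** Once conjugation by powers of [t] has made [x] far, further conjugation is translation, so lying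
    in [H] and lying in it at infinity agree. As [t] is in [H], these conjugations do not affect
    membership in [H]. *)
Lemma untwist_infinity x : untwist at_infinity x <-> pos x = 0%R /\ H x.
Proof.
case: (sH) => _ HM HV.
have Htm m : H (t ^+ m) by apply: subgroupX.
have Hconj m y : H (t ^+ m * y * (t ^+ m)^-1) <-> H y.
  by rewrite subgroupMr ?subgroupMl //; apply: HV.
split=> [[px [N HN]]|[px Hx]]; split=> //.
  have [M HM'] := eventually_far pt px; pose y := t ^+ maxn N M * x * (t ^+ maxn N M)^-1.
  have [_ [k Hk]] : at_infinity y by apply: HN; apply: leq_maxl.
  have fy : far y by apply: HM'; apply: leq_maxr.
  by have := Hk k (leqnn k); rewrite -far_pure // => /Hconj /Hconj.
have [M HM'] := eventually_far pt px; exists M => m /HM' fm; split; first exact: (proj1 fm).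
by exists 0%N => k _; rewrite -far_pure //; apply/Hconj/Hconj.
Qed.
End Infinity.
End Twist.

(** * A finite criterion for leading lamps *)

Local Close Scope group_scope.
Local Open Scope ring_scope.

Lemma int_codeE (z : int) : (int_code z)%:Z = if 0 <= z then z *+ 2 else - (z *+ 2) - 1.
Proof. by case: z => m /=; lia. Qed.

Lemma int_code_inj : injective int_code.
Proof. by move=> y z /(congr1 Posz); rewrite !int_codeE; do 2!case: ifP; lia. Qed.

(* Adding [s] moves [p] away from the origin; [0] counts as positive. *)
Definition outward (p s : int) := (0 <= p) && (0 <= s) || (p < 0) && (s <= 0).

(** [int_code] lists the integers as 0, -1, 1, -2, 2 and so on. The integers before [p] form an
    interval around 0 bounded by [p] and its opposite; when [p] moves outward by [s], the interval
    grows enough to contain [q + s]. *)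
Lemma int_code_outward p q s : outward p s ->
  (int_code q < int_code p)%N -> (int_code (q + s) < int_code (p + s))%N.
Proof.
rewrite /outward -!ltz_nat !int_codeE.
by do 4!case: ifP; lia.
Qed.

(** * A lexicographic well-order on integer vectors *)

Section Lex.

Fixpoint lexle m (k1 k2 : nat -> nat) : bool :=
  if m is m'.+1 then (k1 m' < k2 m')%N || (k1 m' == k2 m') && lexle m' k1 k2 else true.

Lemma lexle_refl m k : lexle m k k.
Proof. by elim: m => //= m ->; rewrite eqxx orbT. Qed.

Lemma lexle_total m k1 k2 : lexle m k1 k2 || lexle m k2 k1.
Proof.
elim: m => //= m; case: (ltngtP (k1 m) (k2 m)) => //=.
Qed.

Lemma lexle_trans m k2 k1 k3 : lexle m k1 k2 -> lexle m k2 k3 -> lexle m k1 k3.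
Proof.
elim: m => //= m IH /orP [l12|/andP [/eqP -> le12]] /orP [l23|/andP [/eqP <- le23]].
- by rewrite (ltn_trans l12 l23).
- by rewrite l12.
- by rewrite l23.
- by rewrite eqxx IH ?orbT.
Qed.

Lemma lexle_anti m k1 k2 : lexle m k1 k2 -> lexle m k2 k1 -> forall i, (i < m)%N -> k1 i = k2 i.
Proof.
elim: m => //= m IH; case: (ltngtP (k1 m) (k2 m)) => //= E le12 le21 i.
by rewrite ltnS leq_eqVlt => /predU1P [-> //|]; apply: IH.
Qed.

Lemma lexle_wf (T : Type) (key : T -> nat -> nat) m (P : T -> Prop) : (exists a, P a) ->
  exists2 a, P a & forall b, P b -> lexle m (key a) (key b).
Proof.
elim: m P => [|m IH] P exP; first by case: exP => a Pa; exists a.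
have [v [a [Pa va]] min_v] : exists2 v, exists a, P a /\ key a m = v &
    forall b, P b -> (v <= key b m)%N.
  apply: NNPP => no; case: exP => a Pa.
  suff H k : forall b, P b -> (k < key b m)%N by have := H (key a m) a Pa; rewrite ltnn.
  elim: k => [|k IHk] b Pb.
    rewrite lt0n; apply/negP => /eqP kb; apply: no; exists 0%N => //; by exists b.
  rewrite ltn_neqAle IHk // andbT; apply/negP => /eqP kb; apply: no; exists k.+1 => //.
  by exists b.
have [|b [Pb vb] min_b] := IH (fun a => P a /\ key a m = v); first by exists a.
exists b => //= c Pc; rewrite vb; have := min_v c Pc; rewrite leq_eqVlt.
by case/predU1P => [vc|->//]; rewrite vc eqxx min_b ?orbT.
Qed.
End Lex.

Section Coordinates.
Variable n : nat.
Notation V := 'rV[int]_n.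
Implicit Types a b z : V.

Definition co (v : V) (i : nat) : int := if @insub nat (fun i => i < n)%N 'I_n i is Some j then v ord0 j else 0.

Lemma co_ord v (i : 'I_n) : co v i = v ord0 i.
Proof. by rewrite /co valK. Qed.
Lemma co_row (f : 'I_n -> int) (i : 'I_n) : co (\row_j f j) i = f i.
Proof. by rewrite co_ord mxE. Qed.
Lemma co_ge v i : (n <= i)%N -> co v i = 0.
Proof. by move=> le_ni; rewrite /co insubN // -leqNgt. Qed.
Lemma coD a b i : co (a + b) i = co a i + co b i.
Proof. by rewrite /co; case: insub => [j|]; rewrite ?mxE ?addr0. Qed.
Lemma coN a i : co (- a) i = - co a i.
Proof. by rewrite /co; case: insub => [j|]; rewrite ?mxE ?oppr0. Qed.
Lemma co_inj a b : (forall i, (i < n)%N -> co a i = co b i) -> a = b.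
Proof. by move=> H; apply/rowP => j; rewrite -!co_ord H. Qed.
End Coordinates.

Section Order.
Variable n : nat.
Notation V := 'rV[int]_n.
Implicit Types a b : V.
Variable R : 'M[int]_n.

Definition cr a i := co (a *m R) i.
Definition key a i := int_code (cr a i).
(** For positive [n] no translation-invariant total order on Z^n is a well-order. This one is a
    well-order for injective [R] and respects only translations away from the origin, in the
    coordinates given by [R]. The last coordinate weighs most. *)
Definition ple : rel V := fun a b => lexle n (key a) (key b).

Lemma crD a b i : cr (a + b) i = cr a i + cr b i. Proof. by rewrite /cr mulmxDl coD. Qed.
Lemma crN a i : cr (- a) i = - cr a i. Proof. by rewrite /cr mulNmx coN. Qed.

Lemma ple_refl : reflexive ple. Proof. by move=> a; apply: lexle_refl. Qed.
Lemma ple_trans : transitive ple. Proof. by move=> b a c; apply: lexle_trans. Qed.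
Lemma ple_total : total ple. Proof. by move=> a b; apply: lexle_total. Qed.
Lemma ple_wf (P : V -> Prop) : (exists a, P a) -> exists2 a, P a & forall b, P b -> ple a b.
Proof. exact: lexle_wf. Qed.

Lemma ple_outward l a b : (forall i, (i < n)%N -> outward (cr a i) (cr l i)) ->
  ple b a -> ple (b + l) (a + l).
Proof.
move=> out; rewrite /ple; suff H m : (m <= n)%N -> lexle m (key b) (key a) ->
  lexle m (key (b + l)) (key (a + l)) by apply: H.
elim: m => //= m IH lt_mn.
have outm := out _ lt_mn.
case/orP => [lt_ba|/andP [/eqP/int_code_inj E leba]].
  by rewrite /key !crD int_code_outward.
by rewrite /key !crD E eqxx IH ?orbT // ltnW.
Qed.

Hypothesis R_inj : forall a, a *m R = 0 -> a = 0.

Lemma cr_inj a b : (forall i, (i < n)%N -> cr a i = cr b i) -> a = b.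
Proof.
move=> E; apply/eqP; rewrite -subr_eq0; apply/eqP/R_inj; rewrite mulmxBl.
by apply/eqP; rewrite subr_eq0; apply/eqP/co_inj.
Qed.

Lemma ple_anti : antisymmetric ple.
Proof.
move=> a b /andP [ab ba]; apply: cr_inj => i lt_in; apply: int_code_inj.
exact: lexle_anti ab ba _ lt_in.
Qed.

Lemma prec_outward l a b : (forall i, (i < n)%N -> outward (cr a i) (cr l i)) ->
  prec ple b a -> prec ple (b + l) (a + l).
Proof.
move=> out lt_ba; apply/negP => le_ab.
have E : a + l = b + l.
  by apply: ple_anti; rewrite le_ab ple_outward // (precW ple_total).
by move: lt_ba; rewrite (addIr _ E) /prec ple_refl.
Qed.

(** * Letters, words and the criterion on finitely many pairs *)

Section Letters.
Variables (G : groupType) (A : 'M[int]_n) (d : nat -> nat).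
Notation W := (wreath G n).
Hypothesis AR : forall z i, cr (z *m A) i = (d i)%:Z * co z i.

Definition Lat a := exists z, a = z *m A.

Lemma Lat0 : Lat 0. Proof. by exists 0; rewrite mul0mx. Qed.
Lemma LatN a : Lat a -> Lat (- a).
Proof. by case=> z ->; exists (- z); rewrite mulNmx. Qed.
Lemma eq_Lat y z : (forall i, (i < n)%N -> d i != 0%N -> co y i = co z i) -> y *m A = z *m A.
Proof.
move=> E; apply: cr_inj => i lt_in; rewrite !AR; have [->|/E ->//] := eqVneq (d i) 0%N.
by rewrite !mul0r.
Qed.

Variable Bs : seq W.
Hypothesis Bs0 : forall j, pos (nth 1%g Bs j) = 0.

(** An index past the end of [Bs] gives the trivial letter; it is used on purpose to have 1 among
    the letters. *)
Definition letter z j : W := shc (z *m A) (nth 1%g Bs j).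
Lemma letter_default z j : (size Bs <= j)%N -> letter z j = shc (z *m A) 1%g.
Proof. by move=> le_j; rewrite /letter nth_default. Qed.
Definition word (s : seq (V * nat)) : W := (\prod_(p <- s) letter p.1 p.2)%g.
Definition is_letter (x : W) := exists z j, x = letter z j.

Lemma pos_letter z j : pos (letter z j) = 0.
Proof. by rewrite pos_shc Bs0. Qed.

Lemma eq_letter y z j : (forall i, (i < n)%N -> d i != 0%N -> co y i = co z i) ->
  letter y j = letter z j.
Proof. by move=> /eq_Lat E; rewrite /letter E. Qed.

Lemma is_letter1 : is_letter 1%g.
Proof. by exists 0, (size Bs); rewrite /letter nth_default ?shc1. Qed.

Lemma letterD y z j : letter (y + z) j = shc (y *m A) (letter z j).
Proof. by rewrite /letter mulmxDl shcD. Qed.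

Lemma lamp_letter z j a : lamp (letter z j) a = lamp (nth 1%g Bs j) (a - z *m A).
Proof. by rewrite lamp_shc. Qed.

Lemma shc_word z s : shc (z *m A) (word s) = word [seq (z + p.1, p.2) | p <- s].
Proof.
by rewrite /word shc_prod big_map; apply: eq_bigr => p _; rewrite letterD.
Qed.

Lemma letters_shc l x : Lat l -> is_letter x -> is_letter (shc l x).
Proof. by case=> z -> [y [j ->]]; exists (z + y), j; rewrite letterD. Qed.

Lemma gen_letters_shc l x : Lat l -> gen is_letter x -> gen is_letter (shc l x).
Proof.
move=> Ll; apply: (gen_min (S := fun x => gen is_letter (shc l x))) => [|t Tt].
  have [S1 SM SV] := gen_subgroup is_letter.
  split=> [|y z|y]; [by rewrite shc1|by rewrite shcM; apply: SM|by rewrite shcV; apply: SV].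
by apply: genT; apply: letters_shc.
Qed.

(** Supports are compared with the lamps of given elements instead of one fixed position. Such a
    condition moves along with translations and yields the bounds for every position [a] at once. *)
Definition dominated (r : rel V) (D : V -> Prop) (x : W) :=
  forall b, lamp x b != 1%g -> exists2 a, D a & r b a.

Definition supp2 (t t' : W) a := lamp t a != 1%g \/ lamp t' a != 1%g.

(* These play the role of the vanishing S-polynomials in Buchberger's criterion; *)
(* [crit_conj] accounts for the lamp group not being abelian.                  *)
Definition crit_quot (t t' : W) := exists z j s,
  [/\ t' = (t * letter z j * word s)%g, dominated ple (supp2 t t') (letter z j)
    & forall p, p \in s -> dominated (prec ple) (supp2 t t') (letter p.1 p.2)].

Definition crit_conj (t r : W) := exists s,
  (r * t = t * word s)%g /\
  forall p, p \in s -> dominated ple (fun a => lamp r a != 1%g) (letter p.1 p.2).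

Lemma dominated_shift (r : rel V) (D E : V -> Prop) z y j :
  (forall a b, D a -> r b a -> r (b + z *m A) (a + z *m A)) ->
  (forall a, D a -> E (a + z *m A)) ->
  dominated r D (letter y j) -> dominated r E (letter (z + y) j).
Proof.
move=> out DE dom b; rewrite letterD lamp_shc ?pos_letter // => /dom [a Da ra].
by exists (a + z *m A); [apply: DE|rewrite -[b](subrK (z *m A)); apply: out].
Qed.

Lemma crit_quot_shift z t t' : pos t = 0 -> pos t' = 0 ->
  (forall a, supp2 t t' a -> forall i, (i < n)%N -> outward (cr a i) (cr (z *m A) i)) ->
  crit_quot t t' -> crit_quot (shc (z *m A) t) (shc (z *m A) t').
Proof.
move=> pt pt' out [y [j [s [tE dom doms]]]].
have suppE a : supp2 t t' a -> supp2 (shc (z *m A) t) (shc (z *m A) t') (a + z *m A).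
  by rewrite /supp2 !lamp_shc // addrK.
exists (z + y), j, [seq (z + p.1, p.2) | p <- s]; split.
- by rewrite letterD -shc_word -!shcM -tE.
- by apply: (dominated_shift _ suppE dom) => a b /out; apply: ple_outward.
- move=> _ /mapP [p ps ->]; apply: (dominated_shift _ suppE (doms _ ps)) => a b /out.
  exact: prec_outward.
Qed.

Lemma crit_conj_shift z t r : pos t = 0 -> pos r = 0 ->
  (forall a, lamp r a != 1%g -> forall i, (i < n)%N -> outward (cr a i) (cr (z *m A) i)) ->
  crit_conj t r -> crit_conj (shc (z *m A) t) (shc (z *m A) r).
Proof.
move=> pt pr out [s [rE doms]].
exists [seq (z + p.1, p.2) | p <- s]; split; first by rewrite -shc_word -!shcM rE.
move=> _ /mapP [p ps ->]; apply: (dominated_shift _ _ (doms _ ps)) => [a b /out|a].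
  exact: ple_outward.
by rewrite lamp_shc // addrK.
Qed.

Variable M : nat.
Hypothesis Bs_bound : forall j a, lamp (nth 1%g Bs j) a != 1%g ->
  forall i, (i < n)%N -> `|cr a i| <= M%:Z.

Lemma letter_bound z j a : lamp (letter z j) a != 1%g ->
  forall i, (i < n)%N -> `|cr a i - (d i)%:Z * co z i| <= M%:Z.
Proof.
rewrite lamp_letter => /Bs_bound H i /H; by rewrite crD crN AR.
Qed.

Definition box (c : nat) (z : V) := forall i, (i < n)%N -> `|co z i| <= c%:Z.

Section FiniteCheck.
Variable c : nat.
Hypotheses (cM : (5 * M + 1 <= c)%N)
  (check : forall z1 z2 j1 j2, box c z1 -> box c z2 ->
     crit_quot (letter z1 j1) (letter z2 j2) /\ crit_conj (letter z1 j1) (letter z2 j2)).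

(* Any pair of nearby letters is an outward shift of a pair in the box. *)
Lemma check_near z1 z2 j1 j2 :
  (forall i, (i < n)%N -> `|(d i)%:Z * (co z1 i - co z2 i)| <= (2 * M)%:Z) ->
  crit_quot (letter z1 j1) (letter z2 j2) /\ crit_conj (letter z1 j1) (letter z2 j2).
Proof.
(* Clipping to [C] keeps both vectors within [C + 2 * M], which is [5 * M + 1]. Where a coordinate
   was clipped, lamps of the two letters deviate from its [d i]-fold by at most [2 * M + M]; as this
   is less than [C], they are strictly on the side of the shift, as [outward] demands on the
   negative side. Coordinates with [d i = 0] do not move a letter and are set to 0. *)
move=> near; pose C : int := (3 * M + 1)%:Z.
pose clip (z : int) := if C < z then C else if z < - C then - C else z.
pose y1 : V := \row_i (if d i == 0%N then 0 else clip (co z1 i)).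
pose y2 : V := \row_i (if d i == 0%N then 0 else clip (co z1 i) + (co z2 i - co z1 i)).
have y1E i : (i < n)%N -> co y1 i = if d i == 0%N then 0 else clip (co z1 i).
  by move=> lt_in; rewrite (co_row _ (Ordinal lt_in)).
have y2E i : (i < n)%N -> co y2 i = if d i == 0%N then 0 else clip (co z1 i) + (co z2 i - co z1 i).
  by move=> lt_in; rewrite (co_row _ (Ordinal lt_in)).
have near1 i : (i < n)%N -> d i != 0%N -> `|co z1 i - co z2 i| <= (2 * M)%:Z.
  by move=> /near; rewrite normrM; nia.
pose l := z1 - y1.
have E1 : letter z1 j1 = shc (l *m A) (letter y1 j1) by rewrite -letterD subrK.
have E2 : letter z2 j2 = shc (l *m A) (letter y2 j2).
  rewrite -letterD; apply: eq_letter => i lt_in di.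
  by rewrite coD /l coD coN y1E // y2E // (negbTE di); lia.
have b1 : box c y1 by move=> i lt_in; rewrite y1E // /clip /C; do 3?case: ifP; lia.
have b2 : box c y2.
  move=> i lt_in; rewrite y2E //; case: ifP => [|/negbT /(near1 _ lt_in)]; first by lia.
  by rewrite /clip /C; do 3?case: ifP; lia.
have [cq cc] := check j1 j2 b1 b2.
have lE i : (i < n)%N -> cr (l *m A) i = (d i)%:Z * (co z1 i - co y1 i).
  by move=> _; rewrite AR coD coN.
have out a z j : (forall i, (i < n)%N -> d i != 0%N -> `|co z i - co y1 i| <= (2 * M)%:Z /\
      `|(d i)%:Z * (co z i - co y1 i)| <= (2 * M)%:Z) ->
    lamp (letter z j) a != 1%g -> forall i, (i < n)%N -> outward (cr a i) (cr (l *m A) i).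
  move=> Hz /letter_bound Ha i lt_in; rewrite lE // y1E //.
  have := Ha i lt_in; have := Hz i lt_in; rewrite y1E //.
  case: eqP => [->|/eqP di /(_ isT)]; first by rewrite /outward; lia.
  have d1 : 1 <= (d i)%:Z by lia.
  rewrite /clip; case: ifP => [Cz|_]; last case: ifP => [zC|_].
  - move=> [_ H1] H2; apply/orP; left; apply/andP; split; last by nia.
    have : C <= (d i)%:Z * C by rewrite ler_peMl //; lia.
    by move: H1 H2; rewrite mulrBr /C; lia.
  - move=> [_ H1] H2; apply/orP; right; apply/andP; split; last by nia.
    have : C <= (d i)%:Z * C by rewrite ler_peMl //; lia.
    by move: H1 H2; rewrite mulrBr mulrN /C; lia.
  - by move=> _ _; rewrite subrr mulr0 /outward lexx andbT; lia.
have n1 i : (i < n)%N -> d i != 0%N -> `|co y1 i - co y1 i| <= (2 * M)%:Z /\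
      `|(d i)%:Z * (co y1 i - co y1 i)| <= (2 * M)%:Z by rewrite subrr mulr0; lia.
have n2 i : (i < n)%N -> d i != 0%N -> `|co y2 i - co y1 i| <= (2 * M)%:Z /\
      `|(d i)%:Z * (co y2 i - co y1 i)| <= (2 * M)%:Z.
  move=> lt_in di; have := near i lt_in; have := near1 i lt_in di.
  rewrite y2E // y1E // (negbTE di) => H1 H2.
  have -> : clip (co z1 i) + (co z2 i - co z1 i) - clip (co z1 i) = - (co z1 i - co z2 i) by lia.
  by rewrite mulrN !normrN.
rewrite E1 E2; split.
  by apply: crit_quot_shift => //; rewrite ?pos_letter // => a [] /out; apply.
by apply: crit_conj_shift => //; rewrite ?pos_letter // => a /out; apply.
Qed.

Lemma check_refl z j1 j2 :
  crit_quot (letter z j1) (letter z j2) /\ crit_conj (letter z j1) (letter z j2).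
Proof. by apply: check_near => i _; rewrite subrr mulr0 normr0. Qed.

Lemma overlap_near z1 z2 j1 j2 a : lamp (letter z1 j1) a != 1%g -> lamp (letter z2 j2) a != 1%g ->
  forall i, (i < n)%N -> `|(d i)%:Z * (co z1 i - co z2 i)| <= (2 * M)%:Z.
Proof.
move=> /letter_bound H1 /letter_bound H2 i lt_in.
by have := H1 i lt_in; have := H2 i lt_in; rewrite mulrBr; lia.
Qed.

Let S a := gen (fun t => is_letter t /\ below ple a t).

Lemma word_below a s : (forall p, p \in s -> below ple a (letter p.1 p.2)) -> S a (word s).
Proof.
move=> bs; have := @subgroup_prod _ _ [seq letter p.1 p.2 | p <- s] (gen_subgroup (fun t => is_letter t /\ below ple a t)).
rewrite big_map; apply=> _ /mapP [p ps ->]; apply: genT; split; last exact: bs.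
by exists p.1, p.2.
Qed.

Lemma dominated_below a (r : rel V) D z j : (forall b c, D c -> r b c -> prec ple b a) ->
  dominated r D (letter z j) -> below ple a (letter z j).
Proof.
by move=> H dom; split; [exact: pos_letter|move=> b /dom [c' Dc]; apply: H].
Qed.

(** Overlapping letters are near each other, so [check_near] supplies the identities for
    [grobner_lead]. Disjoint letters commute and the conjugation identity is trivial for them; their
    quotient needs at most an inverse. *)
Theorem letters_lead x : gen is_letter x -> x <> 1%g -> exists a z j,
  [/\ lamp x a != 1%g, upto ple a x, upto ple a (letter z j) & lamp (letter z j) a = lamp x a].
Proof.
move=> gx nx.
have [|||] := grobner_lead ple_refl ple_trans ple_total ple_anti ple_wf is_letter1 _ _ _ gx nx.
- by move=> _ [z [j ->]]; apply: pos_letter.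
- move=> a _ _ [z1 [j1 ->]] [z2 [j2 ->]] u1 u2.
  have supp_le b : supp2 (letter z1 j1) (letter z2 j2) b -> ple b a.
    by case; [apply: (proj2 u1)|apply: (proj2 u2)].
  have [dis|[b [b1 b2]]] := disjoint_or (letter z1 j1) (letter z2 j2).
    have comm : (letter z1 j1 * letter z2 j2 = letter z2 j2 * letter z1 j1)%g.
      by apply: commute_disjoint; rewrite ?pos_letter.
    have [l1a|l1a] := eqVneq (lamp (letter z1 j1) a) 1%g.
      exists (letter z2 j2), (letter z1 j1)^-1%g; split=> //; first by exists z2, j2.
        have [_ _ SV] := gen_subgroup (fun t => is_letter t /\ below ple a t).
        apply: SV; apply: genT; split; first by exists z1, j1.
        exact: (below_triv ple_anti).
      by rewrite comm mulgK.
    (* The criterion is applied to the pair of [letter z1 j1] and the trivial letter at index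
       [size Bs]: it writes the inverse of [letter z1 j1] as a letter times a word of lower
       letters. *)
    have [[z [j [s [E dom doms]]]] _] := check_refl z1 j1 (size Bs).
    have l1 : letter z1 (size Bs) = 1%g by rewrite /letter nth_default // shc1.
    have supp_le' b : supp2 (letter z1 j1) (letter z1 (size Bs)) b -> ple b a.
      by rewrite /supp2 l1 lamp1 eqxx => -[/(proj2 u1)|].
    exists (letter z j), (word s * letter z2 j2)%g; split; first by exists z, j.
    - by split; [exact: pos_letter|move=> b /dom [c' /supp_le' ca bc]; apply: ple_trans ca].
    - have [_ SM _] := gen_subgroup (fun t => is_letter t /\ below ple a t).
      apply: SM.
        apply: word_below => p /doms; apply: dominated_below => b c' /supp_le' ca bc.
        exact: (prec_le_trans ple_trans bc ca).
      apply: genT; split; first by exists z2, j2.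
      by apply: (below_triv ple_anti) => //; apply: dis.
    - by rewrite (mulgA (letter z1 j1 * letter z j)%g) -E l1 mul1g.
  have [[z [j [s [E dom doms]]]] _] := check_near j1 j2 (overlap_near b1 b2).
  exists (letter z j), (word s); split=> //; first by exists z, j.
    by split; [exact: pos_letter|move=> e /dom [c' /supp_le ca bc]; apply: ple_trans ca].
  apply: word_below => p /doms; apply: dominated_below => e c' /supp_le ca bc.
  exact: (prec_le_trans ple_trans bc ca).
- move=> a _ _ [z1 [j1 ->]] u1 [z2 [j2 ->]] b2.
  have [dis|[b [l1b l2b]]] := disjoint_or (letter z1 j1) (letter z2 j2).
    have comm : (letter z1 j1 * letter z2 j2 = letter z2 j2 * letter z1 j1)%g.
      by apply: commute_disjoint; rewrite ?pos_letter.
    rewrite -mulgA -comm mulKg; apply: genT; split=> //; by exists z2, j2.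
  have [_ [s [E doms]]] := check_near j1 j2 (overlap_near l1b l2b).
  rewrite -mulgA E mulKg; apply: word_below => p /doms; apply: dominated_below => e c' l2c ec.
  exact: (le_prec_trans ple_trans ec (proj2 b2 _ l2c)).
- move=> a [_ [xa ux [z [j ->]] ul E]]; by exists a, z, j.
Qed.

(** A letter with a lamp at [a] has a translation vector in the box of radius [C], up to coordinates
    that do not matter, so finitely many letters can compete for the leading lamp of [y]. *)
Lemma irreducible_sound y a (C : nat) : pos y = 0 -> lamp y a != 1%g -> upto ple a y ->
  (forall i, (i < n)%N -> `|cr a i| + M%:Z <= C%:Z) ->
  (forall z j, box C z -> ~ (upto ple a (letter z j) /\ lamp (letter z j) a = lamp y a)) ->
  ~ gen is_letter y.
Proof.
move=> py ya uy bC irr gy.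
have ny : y <> 1%g by move=> y1; rewrite y1 lamp1 eqxx in ya.
have [a' [z [j [ya' uy' ul E]]]] := letters_lead gy ny.
have aE : a' = a by apply: ple_anti; rewrite (proj2 uy _ ya') (proj2 uy' _ ya).
rewrite {a'}aE in ya' uy' ul E.
pose z' : V := \row_i (if d i == 0%N then 0 else co z i).
have z'E i : (i < n)%N -> co z' i = if d i == 0%N then 0 else co z i.
  by move=> lt_in; rewrite (co_row _ (Ordinal lt_in)).
have zE : letter z j = letter z' j.
  by apply: eq_letter => i lt_in di; rewrite z'E // (negbTE di).
apply: (irr z' j); rewrite -?zE //.
have /letter_bound lb : lamp (letter z j) a != 1%g by rewrite E.
move=> i lt_in; rewrite z'E //; case: ifP => [|/negbT di]; first by lia.
have := lb i lt_in; have := bC i lt_in.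
have : `|co z i| <= `|(d i)%:Z * co z i| by rewrite normrM; nia.
by lia.
Qed.
End FiniteCheck.
End Letters.
End Order.

(** * Existence of finite letter sets *)

Section FiniteBasis.
Variables (T : eqType) (Q : T -> Prop).
Implicit Types (r : T -> T -> Prop) (k : T -> nat).

(** The conclusion of Dickson's lemma for subsets of [Q], in the form of a property that can be
    built up one coordinate at a time. *)
Definition finite_basis r := forall U : T -> Prop, (forall u, U u -> Q u) ->
  exists F : seq T, (forall f, f \in F -> U f) /\ forall u, U u -> exists2 f, f \in F & r f u.

Lemma finite_basis_slices r k N (U : T -> Prop) : finite_basis r -> (forall u, U u -> Q u) ->
  exists F : seq T, (forall f, f \in F -> U f) /\
    forall u, U u -> (k u < N)%N -> exists2 f, f \in F & k f = k u /\ r f u.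
Proof.
move=> fb UQ; elim: N => [|N [F [FU HF]]]; first by exists [::].
have [|F' [FU' HF']] := fb (fun u => U u /\ k u = N); first by move=> u [/UQ].
exists (F ++ F'); split=> [f|u Uu].
  by rewrite mem_cat => /orP [/FU|/FU' []].
rewrite ltnS leq_eqVlt => /predU1P [ku|/(HF _ Uu) [f fF Hf]]; last by exists f; rewrite // mem_cat fF.
have [f fF rf] := HF' _ (conj Uu ku); exists f; first by rewrite mem_cat fF orbT.
by have [_ ->] := FU' _ fF.
Qed.

Lemma finite_basis_eq r k N : (forall u, Q u -> (k u < N)%N) -> finite_basis r ->
  finite_basis (fun u v => k u = k v /\ r u v).
Proof.
move=> kN fb U UQ; have [F [FU HF]] := finite_basis_slices k N fb UQ.
by exists F; split=> // u Uu; apply: HF => //; apply/kN/UQ.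
Qed.

(** A basis for [r] alone already covers the elements whose [k] is at least the largest [k] in it.
    Below this value only finitely many slices of constant [k] remain, and each has its own
    basis. *)
Lemma finite_basis_leq r k : finite_basis r -> finite_basis (fun u v => (k u <= k v)%N /\ r u v).
Proof.
move=> fb U UQ; have [F [FU HF]] := fb U UQ.
have [F' [FU' HF']] := finite_basis_slices k (\max_(f <- F) k f) fb UQ.
exists (F ++ F'); split=> [f|u Uu]; first by rewrite mem_cat => /orP [/FU|/FU'].
have [lt_u|le_u] := ltnP (k u) (\max_(f <- F) k f).
  have [f fF [kf rf]] := HF' _ Uu lt_u; exists f; first by rewrite mem_cat fF orbT.
  by rewrite kf.
have [f fF rf] := HF _ Uu; exists f; first by rewrite mem_cat fF.
by split=> //; apply: leq_trans le_u; apply: leq_bigmax_seq.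
Qed.
End FiniteBasis.

Lemma seq_choice (T : eqType) (U : Type) (P : T -> U -> Prop) (s : seq T) :
  (forall x, x \in s -> exists y, P x y) ->
  exists r : seq U, [/\ size r = size s, forall x, x \in s -> List.Exists (P x) r &
    forall y, List.In y r -> exists2 x, x \in s & P x y].
Proof.
elim: s => [_|x s IH ex]; first by exists [::].
have [|r [sr Er Ar]] := IH; first by move=> z zs; apply: ex; rewrite inE zs orbT.
have [|y Pxy] := ex x; first exact: mem_head.
exists (y :: r); split=> /=; first by rewrite sr.
  move=> z; rewrite inE => /predU1P [->|/Er]; [exact: List.Exists_cons_hd|exact: List.Exists_cons_tl].
by move=> z [<-|/Ar [w ws Pw]]; [exists x; rewrite ?mem_head|exists w; rewrite ?inE ?ws ?orbT].
Qed.

(** * Letters that attain all leading lamps satisfy the criterion *)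

Section LettersComplete.
Variables (n : nat) (R : 'M[int]_n).
Notation V := 'rV[int]_n.
Hypothesis R_inj : forall a : V, a *m R = 0 -> a = 0.
Variables (G : groupType) (A : 'M[int]_n) (d : nat -> nat).
Notation W := (wreath G n).
Hypothesis AR : forall z i, cr R (z *m A) i = (d i)%:Z * co z i.
Notation ple := (ple R).

Section Complete.
Variables (Bs : seq W) (S : W -> Prop).
Hypotheses (Bs0 : forall j, pos (nth 1%g Bs j) = 0)
  (sS : is_subgroup S) (S0 : forall x, S x -> pos x = 0)
  (lS : forall z j, S (letter A Bs z j))
  (leadS : forall x a, S x -> lamp x a != 1%g -> upto ple a x ->
     exists z j, upto ple a (letter A Bs z j) /\ lamp (letter A Bs z j) a = lamp x a).
Notation letter := (letter A Bs).
Notation word := (word A Bs).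

Let letters_seq (s : seq W) (P : W -> Prop) : (forall r, r \in s -> is_letter A Bs r /\ P r) ->
  exists s' : seq (V * nat), (\prod_(r <- s) r)%g = word s' /\
    forall p, p \in s' -> P (letter p.1 p.2).
Proof.
elim: s => [_|r s IH Ps]; first by exists [::]; rewrite /word !big_nil.
have [|s' [E Ps']] := IH; first by move=> x xs; apply: Ps; rewrite inE xs orbT.
have [[z [j rE]] Pr] := Ps r (mem_head _ _); exists ((z, j) :: s').
rewrite big_cons /word big_cons -/(word s') E rE; split=> // p.
by rewrite inE => /predU1P [->|/Ps' //]; rewrite /= -rE.
Qed.

Lemma letters_reduce x a : S x -> upto ple a x -> exists z j s,
  [/\ x = (letter z j * word s)%g, upto ple a (letter z j)
    & forall p, p \in s -> below ple a (letter p.1 p.2)].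
Proof.
move=> Sx ux; have [|x' b Sx' xb ux'|t [s [[z [j ->]] ut /letters_seq [s' [E bs]] ->]]] := 
  reduce (@ple_refl _ R) (@ple_trans _ R) (@ple_total _ R) (ple_anti R_inj) (@ple_wf _ R) (is_letter1 A Bs) sS _ S0 _ Sx ux.
- by move=> _ [z [j ->]].
- have [z [j [ul E]]] := leadS Sx' xb ux'; exists (letter z j); split=> //; by exists z, j.
- by exists z, j, s'; rewrite E.
Qed.

Lemma letters_word x : S x -> exists s, x = word s.
Proof.
move=> Sx; have [a ux] := exists_upto (@ple_refl _ R) (@ple_trans _ R) (@ple_total _ R) (S0 Sx).
have [z [j [s [-> _ _]]]] := letters_reduce Sx ux; exists ((z, j) :: s).
by rewrite /word big_cons.
Qed.

Let dom_upto a D (x : W) : upto ple a x -> D a -> dominated ple D x.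
Proof. by move=> [_ ux] Da b /ux ba; exists a. Qed.
Let dom_below a D (x : W) : below ple a x -> D a -> dominated (prec ple) D x.
Proof. by move=> [_ ux] Da b /ux ba; exists a. Qed.

Let dominated1 (r : rel V) D z j : letter z j = 1%g -> dominated r D (letter z j).
Proof. by move=> -> b; rewrite lamp1 eqxx. Qed.
Let letter1 : letter 0 (size Bs) = 1%g.
Proof. by rewrite /letter nth_default // shc1. Qed.

(** The quotient lies in [S] and is supported up to the largest lamp [a] of the two letters. Its
    reduction by letters gives the identity, with [a] dominating everything. *)
Lemma complete_crit_quot z1 z2 j1 j2 : crit_quot R A Bs (letter z1 j1) (letter z2 j2).
Proof.
set t := letter z1 j1; set t' := letter z2 j2.
have [S1 SM SV] := sS.
have St : S t by apply: lS.
have St' : S t' by apply: lS.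
have [[a Da max_a]|none] : (exists2 a, supp2 t t' a & forall b, supp2 t t' b -> ple b a) \/
    (forall b, ~ supp2 t t' b).
- pose s := [seq b <- (finsupp (lamp t) : seq V) ++ (finsupp (lamp t') : seq V) | true].
  have sE b : b \in s <-> supp2 t t' b.
    by rewrite /s filter_predT mem_cat !mem_finsupp /supp2; split=> [/orP|/orP].
  have [s0|/eqP ns] := eqVneq s [::]; [right=> b /sE|left]; first by rewrite s0.
  have [a /sE Da max_a] := max_list (@ple_refl _ R) (@ple_trans _ R) (@ple_total _ R) ns.
  by exists a => // b /sE /max_a.
- have Sx : S (t^-1 * t')%g by apply: (SM) => //; apply: SV.
  have ux : upto ple a (t^-1 * t')%g.
    have [_ uM uV] := supp_in_subgroup G (fun b => ple b a).
    apply: uM; [apply: uV|]; split; rewrite ?pos_letter // => b tb; apply: max_a; by [left|right].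
  have [z [j [s [E ul bs]]]] := letters_reduce Sx ux.
  exists z, j, s; split; first by rewrite -mulgA -E mulKVg.
    exact: dom_upto ul Da.
  by move=> p /bs /dom_below; apply.
- have triv x : pos x = 0 -> (forall b, lamp x b != 1%g -> supp2 t t' b) -> x = 1%g.
    by move=> px sx; apply: wreath_eq => // b; rewrite lamp1; apply/eqP/negPn/negP => /sx/none.
  have t1 : t = 1%g by apply: triv; [exact: pos_letter|left].
  have t1' : t' = 1%g by apply: triv; [exact: pos_letter|right].
  exists 0, (size Bs), [::]; split=> //; last by apply: dominated1.
  by rewrite t1 t1' letter1 /word big_nil !mulg1.
Qed.

(** Conjugation by an element of position 0 creates no new lamps, so the conjugate of [r] reduces by
    letters up to the leading position of [r]. *)
Lemma complete_crit_conj z1 z2 j1 j2 : crit_conj R A Bs (letter z1 j1) (letter z2 j2).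
Proof.
set t := letter z1 j1; set r := letter z2 j2.
have [S1 SM SV] := sS.
have St : S t by apply: lS.
have Sr : S r by apply: lS.
have [r1|nr] := classic (r = 1%g).
  by exists [::]; rewrite r1 /word big_nil mul1g mulg1.
have [a ra ur] := lead (@ple_refl _ R) (@ple_trans _ R) (@ple_total _ R) (pos_letter A Bs0 z2 j2) nr.
have Sx : S (t^-1 * r * t)%g by apply: (SM) => //; apply: (SM) => //; apply: SV.
have ux : upto ple a (t^-1 * r * t)%g.
  have {2}-> : t = (t^-1)^-1%g by rewrite invgK.
  split=> [|b]; first by rewrite pos_conj pos_letter.
  rewrite lamp_conj ?pos_letter // posV pos_letter // oppr0 subr0 => xb; apply: (proj2 ur).
  by apply: contraNneq xb => ->; rewrite mulg1 mulgV.
have [z [j [s [E ul bs]]]] := letters_reduce Sx ux.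
exists ((z, j) :: s); split; first by rewrite /word big_cons -/(word s) -E !mulgA mulgV mul1g.
move=> p; rewrite inE => /predU1P [->|/bs /(below_upto (@ple_total _ R)) up].
  exact: dom_upto ul ra.
exact: dom_upto up ra.
Qed.

(** The remainder [y0] is chosen in the coset of [y] with the least bound on its support. A letter
    with the same leading lamp could be divided off and would lower that bound. *)
Lemma complete_irreducible y : pos y = 0 -> ~ S y -> exists s y0 a,
  [/\ y = (word s * y0)%g, pos y0 = 0, lamp y0 a != 1%g, upto ple a y0 &
    forall z j, ~ (upto ple a (letter z j) /\ lamp (letter z j) a = lamp y0 a)].
Proof.
move=> py nSy; have [S1 SM SV] := sS.
have [|a [y0 [uy Sy0]] min_a] := @ple_wf _ R (fun a => exists y0, upto ple a y0 /\ S (y * y0^-1)%g).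
  have [a ua] := exists_upto (@ple_refl _ R) (@ple_trans _ R) (@ple_total _ R) py.
  by exists a, y; rewrite mulgV.
have nontriv y1 : S (y * y1^-1)%g -> y1 <> 1%g.
  by move=> Sy1 y11; apply: nSy; rewrite y11 invg1 mulg1 in Sy1.
have py0 : pos y0 = 0 by case: uy.
have [b y0b uyb] := lead (@ple_refl _ R) (@ple_trans _ R) (@ple_total _ R) py0 (nontriv _ Sy0).
have ba : b = a.
  by apply: (ple_anti R_inj); rewrite (proj2 uy) // min_a //; exists y0.
rewrite {b}ba in y0b uyb.
have [s sE] := letters_word Sy0.
exists s, y0, a; split=> //; first by rewrite -sE mulgVK.
move=> z j [ul E]; pose y1 := ((letter z j)^-1 * y0)%g.
have Sy1 : S (y * y1^-1)%g by rewrite /y1 invMg invgK mulgA; apply: SM.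
have py1 : pos y1 = 0 by rewrite posM posV pos_letter // py0 oppr0 addr0.
have [b y1b uy1] := lead (@ple_refl _ R) (@ple_trans _ R) (@ple_total _ R) py1 (nontriv _ Sy1).
have : below ple a y1.
  apply: (below_triv (ple_anti R_inj)); last first.
    by rewrite lampM lampV posV !pos_letter // oppr0 addr0 subr0 E mulVg.
  have [_ uM uV] := supp_in_subgroup G (fun b => ple b a).
  by apply: uM => //; apply: uV.
by case=> _ /(_ _ y1b); rewrite /prec min_a //; exists y1.
Qed.
End Complete.
End LettersComplete.

(** * Finitely many letters by Dickson's lemma *)

Section Dickson.
Variables (n : nat) (R : 'M[int]_n).
Notation V := 'rV[int]_n.
Hypothesis R_inj : forall a : V, a *m R = 0 -> a = 0.
Variables (G : finGroupType) (A : 'M[int]_n) (d : nat -> nat).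
Notation W := (wreath G n).
Hypothesis AR : forall z i, cr R (z *m A) i = (d i)%:Z * co z i.
Notation ple := (ple R).

(* [a] is obtained from [b] by moving away from the origin along the lattice. *)
Definition beyond m (b a : V) := forall i, (i < m)%N ->
  [/\ (0 <= cr R b i) = (0 <= cr R a i), (cr R b i = cr R a i %[mod d i])%Z
    & (`|cr R b i| <= `|cr R a i|)%N].

(** Each coordinate contributes its sign and its residue, with finitely many values, and its
    absolute value, compared by [finite_basis_leq]. For [d i = 0] the residue is the coordinate
    itself, and the bound [D] keeps its values finite in number. *)
Lemma finite_basis_beyond D m : (m <= n)%N ->
  finite_basis (fun a => forall i, (i < n)%N -> d i = 0%N -> (`|cr R a i| <= D)%N) (beyond m).
Proof.
elim: m => [_ U UQ|m IH lt_mn].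
  have [[u Uu]|no] := classic (exists u, U u).
    by exists [:: u]; split=> [f /[!inE]/eqP -> //|v _]; exists u; rewrite ?mem_head.
  by exists [::]; split=> // u Uu; case: no; exists u.
pose Q (a : V) := forall i, (i < n)%N -> d i = 0%N -> (`|cr R a i| <= D)%N.
pose k1 (a : V) : nat := 0 <= cr R a m.
pose k2 (a : V) : nat := int_code (cr R a m %% d m)%Z.
pose k3 (a : V) : nat := `|cr R a m|%N.
have fb := finite_basis_leq k3 (IH (ltnW lt_mn)).
have fb2 : finite_basis Q (fun u v => k2 u = k2 v /\ (k3 u <= k3 v)%N /\ beyond m u v).
  apply: (finite_basis_eq (N := (2 * (D + d m)).+2)) => // u Qu.
  rewrite -ltz_nat /k2 int_codeE.
  have [d0|d_gt0] := posnP (d m); last first.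
    have := modz_ge0 (cr R u m) (negbT (gtn_eqF d_gt0) : (d m)%:Z != 0).
    have := ltz_pmod (cr R u m) (d_gt0 : 0 < (d m)%:Z).
    case: ifP; lia.
  by have := Qu m lt_mn d0; rewrite d0 modz0; case: ifP; lia.
have fb1 : finite_basis Q (fun u v => k1 u = k1 v /\ k2 u = k2 v /\ (k3 u <= k3 v)%N /\ beyond m u v).
  by apply: (finite_basis_eq (N := 2)) => // u _; rewrite /k1; case: (0 <= _).
move=> U UQ; have [F [FU HF]] := fb1 U UQ.
exists F; split=> // u /HF [f fF [E1 [E2 [E3 E4]]]]; exists f => // i.
rewrite ltnS leq_eqVlt => /predU1P [->|/E4//]; split=> //.
  by move: E1; rewrite /k1; do 2!case: (0 <= _).
exact: int_code_inj.
Qed.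

Lemma beyond_lattice b a : beyond n b a -> exists z, a = b + z *m A /\
  forall i, (i < n)%N -> outward (cr R b i) (cr R (z *m A) i).
Proof.
move=> ba; pose z : V := \row_i ((cr R a i - cr R b i) %/ d i)%Z.
have zE i : (i < n)%N -> cr R (z *m A) i = cr R a i - cr R b i.
  move=> lt_in; rewrite AR (co_row _ (Ordinal lt_in)) mulrC /=; apply/divzK.
  by rewrite -eqz_mod_dvd; apply/eqP; case: (ba i lt_in).
exists z; split.
  by apply: (cr_inj R_inj) => i lt_in; rewrite crD zE // addrC subrK.
move=> i lt_in; rewrite zE // /outward; case: (ba i lt_in); lia.
Qed.

(** For every group element [g], the positions where [g] occurs as a leading lamp in [S] have a
    finite basis under [beyond]. One element of [S] per basis position suffices, since an outward
    lattice translation carries its leading lamp to the others. Finiteness of the lamp group then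
    allows all [g] to be collected in one list. *)
Theorem finite_letters (S : W -> Prop) D : is_subgroup S -> (forall x, S x -> pos x = 0) ->
  (forall x a, S x -> lamp x a != 1%g -> forall i, (i < n)%N -> d i = 0%N -> (`|cr R a i| <= D)%N) ->
  exists Bs : seq W, (forall b, b \in Bs -> S b) /\
    forall x a, S x -> lamp x a != 1%g -> upto ple a x ->
     exists z j, upto ple a (letter A Bs z j) /\ lamp (letter A Bs z j) a = lamp x a.
Proof.
move=> sS S0 SD.
pose good (g : G) (Bs : seq W) := (forall b, b \in Bs -> S b) /\ 
   forall x a, S x -> lamp x a = g -> g != 1%g -> upto ple a x ->
   exists z j, upto ple a (letter A Bs z j) /\ lamp (letter A Bs z j) a = lamp x a.
have letter_cat z j (B1 B2 : seq W) : exists j', letter A (B1 ++ B2) z j' = letter A B2 z j.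
  by exists (size B1 + j)%N; rewrite /letter nth_cat ltnNge leq_addr /= addKn.
have exg g : exists Bs, good g Bs.
  have [->|ng] := eqVneq g 1%g; first by exists [::]; split=> // x a _ _; rewrite eqxx.
  pose U a := exists x, [/\ S x, upto ple a x & lamp x a = g].
  have [|F [FU HF]] := finite_basis_beyond (D := D) (leqnn n) (U := U).
    by move=> u [x [Sx _ xu]]; apply: (SD x) => //; rewrite xu.
  have [r [_ Hr1 Hr2]] := seq_choice FU.
  exists r; split.
    move=> b br; have [|f _ [//]] := Hr2 b.
    by elim: (r) br => //= c r' IH; rewrite inE => /predU1P [->|/IH]; [left|right].
  move=> x a Sx xa _ ux; have [|f fF fa] := HF a; first by exists x.
  have [j [_ ub fb]] : exists j, [/\ S (nth 1%g r j), upto ple f (nth 1%g r j) & lamp (nth 1%g r j) f = g].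
    elim: {Hr1 Hr2} r (Hr1 f fF) => [/List.Exists_nil //|b r IH] /List.Exists_cons [Hb|/IH [j Hj]].
      by exists 0%N.
    by exists j.+1.
  have [z [aE out]] := beyond_lattice fa.
  exists z, j; rewrite /letter; split; last by rewrite lamp_shc ?(proj1 ub) // aE addrK fb -aE xa.
  split=> [|c]; first by rewrite pos_shc (proj1 ub).
  rewrite lamp_shc ?(proj1 ub) // => /(proj2 ub) /(ple_outward out).
  by rewrite subrK aE.
suff [Bs [BS HB]] : exists Bs : seq W, (forall b, b \in Bs -> S b) /\
   forall x a, S x -> lamp x a \in enum G -> lamp x a != 1%g -> upto ple a x ->
   exists z j, upto ple a (letter A Bs z j) /\ lamp (letter A Bs z j) a = lamp x a.
  by exists Bs; split=> // x a Sx xa; apply: HB => //; rewrite mem_enum.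
elim: (enum G) => [|g s [Bs [BS HB]]]; first by exists [::].
have [B [BS' HB']] := exg g.
exists (B ++ Bs); split=> [b|x a Sx].
  by rewrite mem_cat => /orP [/BS'|/BS].
rewrite inE => /predU1P [xg|xs] nx ux; last first.
  by have [z [j Hj]] := HB _ _ Sx xs nx ux; have [j' E] := letter_cat z j B Bs; exists z, j'; rewrite E.
have [|z [j [ul E]]] := HB' _ _ Sx xg _ ux; first by rewrite -xg.
have lt_jB : (j < size B)%N.
  rewrite ltnNge; apply/negP => le_Bj; move: nx; rewrite -E /letter nth_default // shc1 lamp1.
  by rewrite eqxx.
by exists z, j; rewrite /letter nth_cat lt_jB.
Qed.
End Dickson.

(** * Certificates of non-membership *)

Section Positions.
Variables (G : groupType) (n : nat).
Notation V := 'rV[int]_n.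
Notation W := (wreath G n).

Definition posmx (us : seq W) : 'M[int]_n := \matrix_(i, j) pos (nth 1%g us i) ord0 j.

Lemma mul_posmx (us : seq W) z : z *m posmx us = \sum_(i < n) z ord0 i *: pos (nth 1%g us i).
Proof.
apply/rowP => j; rewrite mxE summxE; apply: eq_bigr => i _; by rewrite !mxE.
Qed.

Lemma pos_powers (us : seq W) p : size us = n ->
  pos (powers us p) = (\row_i (p i)%:Z) *m posmx us.
Proof.
move=> sz; rewrite mul_posmx /powers sz.
have posE I (s : seq I) (F : I -> W) : pos (\prod_(i <- s) F i)%g = \sum_(i <- s) pos (F i).
  by elim: s => [|i s IH]; rewrite ?big_nil // !big_cons posM IH.
rewrite posE; apply: eq_bigr => i _; rewrite posX mxE.
by rewrite -natz scaler_nat.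
Qed.

Lemma cr0 (R : 'M[int]_n) i : cr R 0 i = 0.
Proof. by rewrite /cr mul0mx /co; case: insub => // j; rewrite mxE. Qed.

Lemma cr_sum (R : 'M[int]_n) I (s : seq I) (F : I -> V) i :
  cr R (\sum_(k <- s) F k) i = \sum_(k <- s) cr R (F k) i.
Proof.
by elim: s => [|k s IH]; rewrite ?big_nil ?cr0 // !big_cons crD IH.
Qed.

Lemma crZ (R : 'M[int]_n) c (v : V) i : cr R (c *: v) i = c * cr R v i.
Proof. by rewrite /cr -scalemxAl /co; case: insub => [j|]; rewrite ?mxE ?mulr0. Qed.

Lemma cr_posmx (R : 'M[int]_n) (us : seq W) (d : nat -> nat) :
  (forall i j, (i < n)%N -> (j < n)%N -> cr R (pos (nth 1%g us i)) j = if i == j then (d i)%:Z else 0) ->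
  forall z i, cr R (z *m posmx us) i = (d i)%:Z * co z i.
Proof.
move=> uR z i; have [lt_in|le_ni] := ltnP i n; last by rewrite co_ge // /cr co_ge // mulr0.
rewrite mul_posmx cr_sum (bigD1 (Ordinal lt_in)) //= big1 ?addr0 => [|k ne_ki].
  by rewrite crZ uR // eqxx mulrC -(co_ord z (Ordinal lt_in)).
rewrite crZ uR // ifN ?mulr0 //; apply: contraNneq ne_ki => ki; exact/eqP/val_inj.
Qed.

Lemma pos_scale (H : W -> Prop) v c : is_subgroup H -> (exists2 w, H w & pos w = v) ->
  exists2 w, H w & pos w = c *: v.
Proof.
move=> sH [w Hw pw]; have HX m : H (w ^+ m)%g by apply: subgroupX.
case: (intP c) => [|m|m].
- by exists 1%g; [case: sH|rewrite scale0r].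
- by exists (w ^+ m.+1)%g => //; rewrite posX pw -natz scaler_nat.
- exists ((w ^+ m.+1)^-1)%g; first by case: sH => _ _; apply.
  by rewrite posV posX pw scaleNr -natz scaler_nat.
Qed.

Lemma pos_sum (H : W -> Prop) I (s : seq I) (F : I -> V) : is_subgroup H ->
  (forall i, exists2 w, H w & pos w = F i) -> exists2 w, H w & pos w = \sum_(i <- s) F i.
Proof.
move=> [H1 HM _] HF; elim: s => [|i s [w Hw pw]]; first by exists 1%g; rewrite ?big_nil.
have [u Hu pu] := HF i; exists (u * w)%g; first exact: HM.
by rewrite big_cons posM pu pw.
Qed.

(** The Smith normal form of the matrix of generator positions gives coordinates [R] in which the
    lattice is diagonal. Integer combinations of positions of elements of [H] are again such
    positions, so the new basis is realised in [H]. *)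
Lemma lattice_basis (H : W -> Prop) (hs : seq W) : is_subgroup H -> (forall w, w \in hs -> H w) ->
  (forall w, H w -> in_generated hs w) ->
  exists R : 'M[int]_n, exists (d : nat -> nat) (us : seq W),
   [/\ R \in unitmx, size us = n,
     forall i j, (i < n)%N -> (j < n)%N ->
       cr R (pos (nth 1%g us i)) j = if i == j then (d i)%:Z else 0,
     forall i, (i < n)%N -> H (nth 1%g us i) /\ (d i = 0%N -> nth 1%g us i = 1%g)
   & forall w, H w -> exists z, pos w = z *m posmx us].
Proof.
(* The [n] extra zero rows ensure that there is a row for each of the [n] diagonal entries, however
   few generators there are. *)
move=> sH Hhs genH; pose k := (size hs + n)%N.
have lt_k (i : 'I_n) : (i < k)%N by rewrite ltn_addl.
pose wd (i : 'I_n) : 'I_k := Ordinal (lt_k i).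
pose P : 'M[int]_(k, n) := \matrix_(i, j) pos (nth 1%g hs i) ord0 j.
have Hnth i : H (nth 1%g hs i).
  have [lt_i|le_i] := ltnP i (size hs); first by apply: Hhs; apply: mem_nth.
  by rewrite nth_default //; case: sH.
(* the rows of [P] are the positions of the generators, padded with zeros *)
have [L uL [R0 uR0 [d _ PE]]] := int_Smith_normal_form P.
pose D : 'M[int]_(k, n) := \matrix_(i, j) (d`_i *+ (i == j :> nat)).
have PR : P *m invmx R0 = L *m D by rewrite PE -/D mulmxK.
have rowP_E i : row i P = pos (nth 1%g hs i).
  by apply/rowP => j; rewrite !mxE.
have LDE i (j : 'I_n) : (L *m D) i j = L i (wd j) * d`_j.
  rewrite mxE (bigD1 (wd j)) //= mxE eqxx mulr1n big1 ?addr0 // => l ne_l.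
  by rewrite mxE (_ : (l == j :> nat) = false) ?mulr0n ?mulr0 //; apply: contraNF ne_l => /eqP lj; apply/eqP/val_inj.
pose R := invmx R0.
have uR : R \in unitmx by rewrite unitmx_inv.
have Hpos (i : 'I_n) : exists2 w, H w & forall j, (j < n)%N -> cr R (pos w) j = if i == j :> nat then d`_i else 0.
  have [w Hw pw] : exists2 w, H w & pos w = \sum_(l < k) (invmx L) (wd i) l *: pos (nth 1%g hs l).
    by apply: pos_sum => // l; apply: pos_scale => //; exists (nth 1%g hs l).
  exists w => // j lt_jn; have -> : pos w = row (wd i) (invmx L *m P).
    by rewrite pw row_mul mulmx_sum_row; apply: eq_bigr => l _; rewrite mxE rowP_E.
  rewrite /cr -row_mul -mulmxA -/R PR mulKmx //.
  by rewrite (co_ord _ (Ordinal lt_jn)) !mxE /=; case: eqP.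
(* Inverting the element when the diagonal entry is negative makes all entries natural numbers. For
   a zero entry the element 1 is taken, so that it plays no part in products of powers. *)
have Hu (i : 'I_n) : exists w, [/\ H w, forall j, (j < n)%N -> cr R (pos w) j = if i == j :> nat then (absz d`_i)%:Z else 0
    & absz d`_i = 0%N -> w = 1%g].
  have [w Hw wR] := Hpos i; have [H1 HM HV] := sH.
  have [d0|nd] := eqVneq d`_i 0.
    by exists 1%g; split=> // j lt_jn; rewrite d0 if_same pos1 cr0.
  have [d_gt0|d_le0] := ltP 0 d`_i.
    exists w; split=> //; last by lia.
    by move=> j lt_jn; rewrite wR //; case: ifP; lia.
  exists (w^-1)%g; split; [exact: HV| |by lia].
  by move=> j lt_jn; rewrite posV crN wR //; case: ifP; lia.
pose dn (i : nat) := absz d`_i.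
have [us [sz_us Hus]] : exists us : seq W, size us = n /\ forall i : 'I_n,
   [/\ H (nth 1%g us i), forall j, (j < n)%N -> cr R (pos (nth 1%g us i)) j = if i == j :> nat then (dn i)%:Z else 0
    & dn i = 0%N -> nth 1%g us i = 1%g].
  have [f Hf] : exists f : {ffun 'I_n -> W}, forall i, [/\ H (f i), forall j, (j < n)%N -> cr R (pos (f i)) j = if i == j :> nat then (dn i)%:Z else 0
    & dn i = 0%N -> f i = 1%g].
    have [f Hf] := fin_all_exists Hu.
    by exists [ffun i => f i] => i; rewrite ffunE.
  exists [seq f i | i <- enum 'I_n]; split; first by rewrite size_map size_enum_ord.
  by move=> i; rewrite (nth_map i) ?size_enum_ord // nth_ord_enum.
have usR i j : (i < n)%N -> (j < n)%N -> cr R (pos (nth 1%g us i)) j = if i == j then (dn i)%:Z else 0.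
  by move=> lt_in lt_jn; case: (Hus (Ordinal lt_in)) => _ ->.
exists R, dn, us; split=> //.
  by move=> i lt_in; case: (Hus (Ordinal lt_in)).
move=> w /genH Hw; apply: (Hw (fun w => exists z, pos w = z *m posmx us)) => [|{w Hw}w].
  split; first by exists 0; rewrite mul0mx.
    by move=> x y [z pz] [z' pz']; exists (z + z'); rewrite posM pz pz' mulmxDl.
  by move=> x [z pz]; exists (- z); rewrite posV pz mulNmx.
move=> /(nthP 1%g) [i lt_i <-].
have lt_ik : (i < k)%N by rewrite ltn_addr.
have R_inj (a : V) : a *m R = 0 -> a = 0 by move=> /(canRL (mulmxK uR)); rewrite mul0mx.
(* The signs undo the passage from the Smith entries to their absolute values. *)
exists (\row_j (L (Ordinal lt_ik) (wd j) * Num.sg d`_j)).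
apply: (cr_inj R_inj) => j lt_jn; rewrite (cr_posmx usR) (co_row _ (Ordinal lt_jn)).
rewrite -(rowP_E (Ordinal lt_ik)) /cr -row_mul PR (co_ord _ (Ordinal lt_jn)).
rewrite [LHS]mxE LDE mulrCA; congr (_ * _); rewrite /dn /= -[LHS]mulr1.
by rewrite {1}[d`_j]numEsg mulr1 mulrC abszE.
Qed.
End Positions.

(** * Separating data and their soundness *)

Section Certificate.
Variables (G : groupType) (n : nat).
Notation V := 'rV[int]_n.
Notation W := (wreath G n).
Variables (R : 'M[int]_n) (d : nat -> nat) (us : seq W) (i0 : nat) (Bs : seq W) (c : nat).
Notation A := (posmx us).
Notation t := (nth 1%g us i0).
Notation phi := (fun a => cr R a i0).
Notation letter := (letter A Bs).
Notation word := (word A Bs).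
Notation S := (gen (is_letter A Bs)).

(* Certifies that [untwist phi t S (X * Y^-1)]. *)
Definition twist_equal (X Y : W) := exists (N : nat) s,
  (t ^+ N * X)%g = (word s * (t ^+ N * Y))%g /\ far phi t (word s).

Definition outside_lattice (h : W) := exists2 i, (i < n)%N &
  (d i = 0%N /\ cr R (pos h) i <> 0) \/
  exists q r, [/\ cr R (pos h) i = (d i)%:Z * q + r%:Z, (0 < r)%N & (r < d i)%N].

Definition irreducible (y : W) := exists (a : V) (C : nat),
  [/\ pos y = 0, lamp y a != 1%g, upto (ple R) a y,
      forall i, (i < n)%N -> `|cr R a i| + c%:Z <= C%:Z
    & forall z j, box C z -> ~ (upto (ple R) a (letter z j) /\ lamp (letter z j) a = lamp y a)].

(** Here the conjugate of [X * Y^-1] by a power of [t] is far and equals a product of letters times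
    an irreducible remainder, so [X * Y^-1] is not in [untwist]. *)
Definition not_twist_equal (X Y : W) := exists (N : nat) s y,
  [/\ (t ^+ N * X)%g = (word s * y * (t ^+ N * Y))%g, far phi t (word s * y)%g & irreducible y].

(** The five components concern coordinates and the direction [t], letters that pass the finite
    check, commutators of [us], the given generators, and the exclusion of [h]. The third makes the
    described set a group, the fourth puts the generators into it, and the fifth keeps [h] out. *)
Definition separating (hs : seq W) (h : W) :=
  [/\ [/\ R \in unitmx,
         size us = n,
         forall i j, (i < n)%N -> (j < n)%N -> cr R (pos (nth 1%g us i)) j = if i == j then (d i)%:Z else 0,
         forall i, (i < n)%N -> d i = 0%N -> nth 1%g us i = 1%g
       & ((i0 < n) && (0 < d i0))%N \/ (forall i, (i < n)%N -> d i = 0%N) /\ t = 1%g],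
      [/\ (0 < c)%N, forall j, pos (nth 1%g Bs j) = 0,
         forall j a, lamp (nth 1%g Bs j) a != 1%g -> forall i, (i < n)%N -> `|cr R a i| *+ 5 + 1 <= c%:Z
       & forall z1 z2 j1 j2, box c z1 -> box c z2 ->
         crit_quot R A Bs (letter z1 j1) (letter z2 j2) /\ crit_conj R A Bs (letter z1 j1) (letter z2 j2)],
      forall i j, (i < n)%N -> (j < n)%N ->
        twist_equal (nth 1%g us i * nth 1%g us j)%g (nth 1%g us j * nth 1%g us i)%g,
      forall g, g \in hs -> exists p q, twist_equal (powers us p * g)%g (powers us q)
    & outside_lattice h \/ exists p q, not_twist_equal (powers us p * h)%g (powers us q)].

Lemma phiD_cr i a b : cr R (a + b) i = cr R a i + cr R b i. Proof. exact: crD. Qed.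

Section Soundness.
Variables (hs : seq W) (h : W).
Hypothesis sep : separating hs h.

Let R_inj : forall a : V, a *m R = 0 -> a = 0.
Proof. by case: sep => [[uR _ _ _ _]] _ _ _ _ a /(canRL (mulmxK uR)); rewrite mul0mx. Qed.
Let sz : size us = n. Proof. by case: sep => [[]]. Qed.
Let usR : forall i j, (i < n)%N -> (j < n)%N ->
  cr R (pos (nth 1%g us i)) j = if i == j then (d i)%:Z else 0.
Proof. by case: sep => [[]]. Qed.
Let AR := cr_posmx usR.
Let us1 : forall i, (i < n)%N -> d i = 0%N -> nth 1%g us i = 1%g. Proof. by case: sep => [[]]. Qed.
Let Bs0 : forall j, pos (nth 1%g Bs j) = 0. Proof. by case: sep => _ []. Qed.

Let t_cases : ((i0 < n) && (0 < d i0))%N \/ t = 1%g.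
Proof. by case: sep => [[_ _ _ _ [|[]]]]; [left|right]. Qed.

Let tdrift : drifting phi t.
Proof.
by case: t_cases => [/andP [lt_i0 d0]|t1]; [left; rewrite usR // eqxx; lia|right].
Qed.

Let phiD : forall a b, phi (a + b) = phi a + phi b. Proof. exact: phiD_cr. Qed.

Let Lat_pos i : Lat A (pos (nth 1%g us i)).
Proof.
have [lt_in|le_ni] := ltnP i n; last by rewrite nth_default ?sz //; apply: Lat0.
exists (delta_mx 0 (Ordinal lt_in)); rewrite -rowE; apply/rowP => j.
by rewrite !mxE.
Qed.

Let S0 x : S x -> pos x = 0.
Proof.
apply: (gen_min (S := fun x => pos x = 0)) => [|_ [z [j ->]]]; last exact: pos_letter.
by split=> // [x' y|x'] px => [py|]; rewrite ?posM ?posV px ?py ?addr0 ?oppr0.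
Qed.

Let sS : is_subgroup S. Proof. exact: gen_subgroup. Qed.
Let S_shc a x : Lat A a -> S x -> S (shc a x). Proof. exact: gen_letters_shc. Qed.

Notation K := (untwist t S).
Let sK : is_subgroup K. Proof. exact: untwist_subgroup. Qed.

Let word_S s : S (word s).
Proof.
rewrite /word -(big_map (fun p => letter p.1 p.2) xpredT id).
apply: subgroup_prod => // _ /mapP [p _ ->]; apply: genT; by exists p.1, p.2.
Qed.

Let far_K y : far phi t y -> K y <-> S y.
Proof. by move=> fy; apply: (far_untwist phiD S0 (@LatN _ _) S_shc (Lat_pos i0)). Qed.

Let conj_tX N x : K ((t ^+ N * x * (t ^+ N)^-1)%g) <-> K x.
Proof. exact: (normalizesX N (untwist_t t S)). Qed.

Let twist_equal_K X Y : twist_equal X Y -> K (X * Y^-1)%g.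
Proof.
move=> [N [s [E fs]]]; apply/(conj_tX N); have -> : (t ^+ N * (X * Y^-1) * (t ^+ N)^-1 = word s)%g.
  exact: conj_div.
exact/far_K.
Qed.

Let comm_us : {in us &, forall u v, K (u * v * u^-1 * v^-1)%g}.
Proof.
move=> u v /(nthP 1%g) [i lt_i <-] /(nthP 1%g) [j lt_j <-]; rewrite sz in lt_i lt_j.
have /(_ _ _ lt_i lt_j) /twist_equal_K : forall i j, (i < n)%N -> (j < n)%N ->
   twist_equal (nth 1%g us i * nth 1%g us j)%g (nth 1%g us j * nth 1%g us i)%g by case: sep.
by rewrite invMg !mulgA.
Qed.

Let norm1 : normalizes K 1%g. Proof. by move=> x; rewrite mul1g invg1 mulg1. Qed.

Let norm_us : {in us, forall u, normalizes K u}.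
Proof.
move=> u u_us; case: t_cases => [/andP [lt_i0 d0]|t1].
  apply: (untwist_normalizes phiD sS S0 (@LatN _ _) S_shc (Lat_pos i0)).
  - by rewrite usR // eqxx; lia.
  - by case/(nthP 1%g): u_us => i _ <-.
  - by apply: comm_us => //; apply: mem_nth; rewrite sz.
have [alld|t_ne] : (forall i, (i < n)%N -> d i = 0%N) \/ ((i0 < n) && (0 < d i0))%N.
    by case: sep => [[_ _ _ _ [|[]]]]; [right|left].
  by case/(nthP 1%g): u_us => i; rewrite sz => lt_i <-; rewrite (us1 lt_i (alld _ lt_i)).
case/andP: t_ne => lt_i0 d0; have := usR lt_i0 lt_i0; rewrite t1 eqxx pos1.
by rewrite cr0; lia.
Qed.

Notation H := (adjoins K us).
Let sH : is_subgroup H. Proof. exact: adjoins_subgroup. Qed.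

Let cr_powers p i : (i < n)%N -> cr R (pos (powers us p)) i = (d i)%:Z * (p i)%:Z.
Proof. by move=> lt_in; rewrite pos_powers // AR (co_row _ (Ordinal lt_in)). Qed.

Let H_cr w : H w -> exists p q, K (powers us p * w * (powers us q)^-1)%g /\
  forall i, (i < n)%N -> cr R (pos w) i = (d i)%:Z * ((q i)%:Z - (p i)%:Z).
Proof.
move=> /adjoinsP [p [q Kw]]; exists p, q; split=> // i lt_in.
case: (Kw) => pw _; have : cr R (pos (powers us p * w * (powers us q)^-1)%g) i = 0.
  by rewrite pw cr0.
by rewrite !posM posV !crD crN !cr_powers // mulrBr; lia.
Qed.

(** Position 0 forces equal exponents on both sides wherever [d i] is nonzero, and the other
    elements of [us] are 1. So the two products of powers agree, and they normalise [K]. *)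
Let H_lamp w : H w -> pos w = 0 -> K w.
Proof.
move=> /H_cr [p [q [Kw cw]]] pw.
have E : powers us q = powers us p.
  apply: eq_bigr => i _; have lt_in : (i < n)%N by have := ltn_ord i; rewrite {2}sz.
  have [d0|d_ne] := eqVneq (d i) 0%N; first by rewrite us1 // !expg1n.
  have := cw i lt_in; rewrite pw cr0 => /esym/eqP.
  by rewrite mulf_eq0 subr_eq0 => /orP [|/eqP [->] //]; lia.
by rewrite E in Kw; apply/(powers_normalizes p norm_us).
Qed.

(** [adjoins K us] is a group with the generators in it. If it contained [h], then either the
    position of [h] would be in the lattice, against [outside_lattice], or the irreducible remainder
    would be a product of letters. *)
Lemma separating_sound : ~ in_generated hs h.
Proof.
move=> gen_h; have Hh : H h.
  apply: gen_h => // g g_hs; apply/adjoinsP.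
  have [p [q /twist_equal_K Kg]] : exists p q, twist_equal (powers us p * g)%g (powers us q).
    by case: sep => _ _ _ + _; apply.
  by exists p, q.
have [|[p [q [N [s [y [E fy [a [C [py ya uy bC irr]]]]]]]]]] : outside_lattice h \/
    exists p q, not_twist_equal (powers us p * h)%g (powers us q) by case: sep.
  have [p [q [_ ch]]] := H_cr Hh.
  move=> [i lt_in [[d0 nz]|[k [r [kE r_gt0 r_lt]]]]]; first by case: nz; rewrite ch // d0 mul0r.
  rewrite ch // in kE.
  have : (d i)%:Z * ((q i)%:Z - (p i)%:Z - k) = r%:Z by rewrite mulrBr kE addrC addKr.
  move: (_ - k) => m mE; have [m_le0|m_gt0] := lerP m 0; nia.
have Hus r : H (powers us r) by apply: powers_subgroup => //; apply: mem_adjoins; case: sK.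
pose g := (powers us p * h * (powers us q)^-1)%g.
have gE : (t ^+ N * g * (t ^+ N)^-1 = word s * y)%g.
  exact: conj_div.
have pg : pos g = 0.
  by rewrite -(pos_conj (t ^+ N)%g) gE posM py addr0 S0.
have Hg : H g.
  by have [_ HM HV] := sH; apply: (HM); [apply: HM|apply: HV].
have : S (word s * y)%g by apply/(far_K fy); rewrite -gE; apply/conj_tX; apply: H_lamp.
move/(subgroupMl y sS (word_S s)).
have [c_gt0 _ Bs_bound check] : [/\ (0 < c)%N, forall j, pos (nth 1%g Bs j) = 0,
   forall j a, lamp (nth 1%g Bs j) a != 1%g -> forall i, (i < n)%N -> `|cr R a i| *+ 5 + 1 <= c%:Z
   & forall z1 z2 j1 j2, box c z1 -> box c z2 ->
   crit_quot R A Bs (letter z1 j1) (letter z2 j2) /\ crit_conj R A Bs (letter z1 j1) (letter z2 j2)].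
  by case: sep.
(* This [M] is the largest number with [5 * M + 1] at most [c]; the certificate bounds five times
   each lamp coordinate plus 1 by [c]. *)
apply: (irreducible_sound R_inj AR Bs0 (M := (c.-1 %/ 5)%N) _ _ check py ya uy _ irr).
- by move=> j b jb i lt_in; have := Bs_bound j b jb i lt_in; lia.
- by lia.
- by move=> i lt_in; have := bC i lt_in; lia.
Qed.
End Soundness.
End Certificate.

Lemma in_generated_subgroup (W : groupType) (hs : seq W) : is_subgroup (in_generated hs).
Proof. exact: gen_subgroup. Qed.

(** * Every non-member has a certificate *)

Section Completeness.
Variables (G : finGroupType) (n : nat).
Notation V := 'rV[int]_n.
Notation W := (wreath G n).

Lemma cr_bound (R : 'M[int]_n) (ws : seq W) : exists C : nat, forall w, w \in ws ->
  forall a, lamp w a != 1%g -> forall i, (i < n)%N -> `|cr R a i| <= C%:Z.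
Proof.
pose Cw (w : W) := (\max_(a <- (finsupp (lamp w) : seq V)) \max_(i < n) absz (cr R a i))%N.
exists (\max_(w <- ws) Cw w)%N => w w_ws a /supp_fin wa i lt_in.
rewrite -abszE lez_nat; apply: leq_trans (_ : Cw w <= _)%N; last exact: leq_bigmax_seq.
apply: leq_trans (leq_bigmax_seq _ wa isT).
exact: (leq_bigmax (Ordinal lt_in)).
Qed.

(** Take for [S] the subgroup at infinity of the generated group itself. Then all identities
    demanded by a certificate are reductions of true memberships in [S], and [h] leaves a nontrivial
    remainder or has a position outside the lattice. *)
Theorem separating_complete (hs : seq W) (h : W) : ~ in_generated hs h ->
  exists R d us i0 Bs c, separating R d us i0 Bs c hs h.
Proof.
move=> nHh; pose H : W -> Prop := in_generated hs.
have sH : is_subgroup H by exact: in_generated_subgroup.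
have Hhs w : w \in hs -> H w by move=> w_hs S _; apply.
have [H1 HM HV] := sH.
have [R [d [us [uR sz usR Hus HL]]]] := lattice_basis sH Hhs (fun w => id).
have R_inj (a : V) : a *m R = 0 -> a = 0 by move=> /(canRL (mulmxK uR)); rewrite mul0mx.
have AR := cr_posmx usR; pose A := posmx us.
have [i0 Hi0] : exists i0, ((i0 < n) && (0 < d i0))%N \/ (forall i, (i < n)%N -> d i = 0%N) /\ nth 1%g us i0 = 1%g.
  have [[i Hi]|no] := classic (exists i, (i < n) && (0 < d i))%N; first by exists i; left.
  exists n; right; split; last by rewrite nth_default ?sz //.
  by move=> i lt_in; apply/eqP; rewrite eqn0Ngt; apply/negP => di; apply: no; exists i; rewrite lt_in.
pose t := nth 1%g us i0; pose phi a := cr R a i0.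
have Hu i : H (nth 1%g us i).
  have [lt_in|le_ni] := ltnP i n; first by case: (Hus i lt_in).
  by rewrite nth_default ?sz //.
have Ht : H t by apply: Hu.
have phiD a b : phi (a + b) = phi a + phi b by apply: crD.
have t_pos : (i0 < n)%N -> (0 < d i0)%N -> 0 < phi (pos t).
  by move=> lt_in di; rewrite /phi /t usR // eqxx; lia.
have t_drift : drifting phi t.
  by case: Hi0 => [/andP [lt_in di]|[_ t1]]; [left; apply: t_pos|right].
pose S := at_infinity t H.
have sS : is_subgroup S by apply: at_infinity_subgroup.
have S0 x : S x -> pos x = 0 by case.
have Hlat z : exists2 w, H w & pos w = z *m A.
  rewrite mul_posmx; apply: pos_sum => // i; apply: pos_scale => //.
  by exists (nth 1%g us i).
have S_shc a x : Lat A a -> S x -> S (shc a x).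
  move=> [z ->]; case: Hi0 => [/andP [lt_in di]|[d0 _]].
    have [w Hw <-] := Hlat z; apply: (at_infinity_shc phiD) => //; exact: t_pos.
  rewrite /A mul_posmx big1 ?shc0 // => i _.
  by have [_ ->] := Hus i (ltn_ord i); rewrite ?d0 // pos1 scaler0.
have tLat : Lat A (pos t) by have [z] := HL _ Ht; exists z.
(* In a coordinate with [d i = 0] every element of [H] has position 0, so multiplication never moves
   lamps in it. They stay within the bound valid for the generators, and pushing along [pos t] does
   not change it. *)
have [D HD] : exists D : nat, forall x a, S x -> lamp x a != 1%g -> forall i, (i < n)%N ->
    d i = 0%N -> (`|cr R a i| <= D)%N.
  have pos_H w i : H w -> (i < n)%N -> d i = 0%N -> cr R (pos w) i = 0.
    by move=> /HL [z ->] _ d0; rewrite AR d0 mul0r.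
  have [D HD] := cr_bound R hs; exists D => x a [px [N HN]] xa i lt_in di.
  have {HN} Hx := HN N (leqnn N); pose w := shc (pos t *+ N) x.
  have wa : lamp w (a + pos t *+ N) != 1%g by rewrite lamp_shc // addrK.
  have cra : cr R a i = cr R (a + pos t *+ N) i.
    by rewrite crD -[pos t *+ N]scaler_nat crZ pos_H // mulr0 addr0.
  rewrite cra -lez_nat abszE.
  have : H w /\ forall a, lamp w a != 1%g -> `|cr R a i| <= D%:Z; last by case=> _; apply.
  apply: (Hx (fun w => H w /\ forall a, lamp w a != 1%g -> `|cr R a i| <= D%:Z)); last first.
    by move=> g g_hs; split=> [|b /HD]; [exact: Hhs|apply].
  split=> [|y y' [Hy Dy] [Hy' Dy']|y [Hy Dy]].
  - by split=> // b; rewrite lamp1 eqxx.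
  - split=> [|b]; first exact: HM.
    rewrite lampM; have [yb|/Dy//] := eqVneq (lamp y b) 1%g.
    by rewrite yb mul1g => /Dy'; rewrite crD crN pos_H // oppr0 addr0.
  - split=> [|b]; first exact: HV.
    by rewrite lampV invg_eq1 => /Dy; rewrite crD pos_H // addr0.
have [Bs [BS leadS]] := finite_letters R_inj AR sS S0 HD.
have SB j : S (nth 1%g Bs j).
  have [lt_j|le_j] := ltnP j (size Bs); first by apply: BS; apply: mem_nth.
  by rewrite nth_default //; case: sS.
have Bs0 j : pos (nth 1%g Bs j) = 0 by apply: S0.
have lS z j : S (letter A Bs z j) by apply: S_shc => //; exists z.
have [C HC] := cr_bound R Bs.
pose c := (C * 5 + 1)%N.
have far_equal X Y : pos (X * Y^-1)%g = 0 -> H (X * Y^-1)%g -> twist_equal R us i0 Bs X Y.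
  move=> pXY HXY; have [|_ [N HN]] := (untwist_infinity phiD sH Ht t_drift (X * Y^-1)%g).2 => //.
  have [M HM'] := eventually_far phiD t_drift pXY.
  have [s sE] := letters_word R_inj sS S0 lS leadS (HN (maxn N M) (leq_maxl _ _)).
  exists (maxn N M), s; rewrite -sE; split; last exact/HM'/leq_maxr.
  by rewrite !mulgA !mulgVK.
(* Negative coordinates of [z] are compensated by powers on the left and the others by powers on the
   right, so that natural exponents are enough. *)
have balance w z : pos w = z *m A -> exists p q, pos (powers us p * w * (powers us q)^-1)%g = 0.
  pose p i := if co z i < 0 then absz (co z i) else 0%N.
  pose q i := if co z i < 0 then 0%N else absz (co z i).
  move=> pw; exists p, q; apply: (cr_inj R_inj) => i lt_in; rewrite !posM posV !crD crN cr0.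
  rewrite !pos_powers // pw !AR !(co_row _ (Ordinal lt_in)) /= -mulrDr -mulrBr.
  have -> : (p i)%:Z + co z i - (q i)%:Z = 0 by rewrite /p /q; case: ifP; lia.
  exact: mulr0.
have Hpow p : H (powers us p).
  by apply: powers_subgroup => // u /(nthP 1%g) [i _ <-].
exists R, d, us, i0, Bs, c; split.
- split=> //; first by move=> i lt_in; case: (Hus i lt_in).
- split=> [||j a ja i lt_in|z1 z2 j1 j2 _ _].
  + by rewrite /c addn1.
  + exact: Bs0.
  + have lt_j : (j < size Bs)%N.
      by rewrite ltnNge; apply: contra ja => le_j; rewrite nth_default // lamp1.
    by have := HC _ (mem_nth 1%g lt_j) a ja i lt_in; rewrite /c; lia.
  + by split; [apply: (complete_crit_quot R_inj Bs0 sS S0 lS leadS)|apply: (complete_crit_conj R_inj Bs0 sS S0 lS leadS)].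
- move=> i j lt_in lt_jn; apply: far_equal.
    by rewrite posM posV !posM [pos _ + pos _]addrC subrr.
  by apply: (HM); [apply: HM|apply: HV; apply: HM].
- move=> g /Hhs Hg; have [z pg] := HL _ Hg; have [p [q pE]] := balance _ _ pg.
  exists p, q; apply: far_equal => //.
  by apply: (HM); [apply: HM|apply: HV].
have [[z ph]|no] := classic (exists z, pos h = z *m A).
  right; have [p [q pE]] := balance _ _ ph; exists p, q.
  set X := (powers us p * h)%g in pE *; set Y := powers us q in pE *.
  have nH : ~ H (X * Y^-1)%g.
    move=> HXY; apply: nHh; rewrite -/H.
    have : H X by rewrite -(mulgVK Y X); apply: (HM) => //; apply: Hpow.
    by move/(subgroupMl h sH (Hpow p)).
  have [N HN] := eventually_far phiD t_drift pE.
  pose y := (t ^+ N * (X * Y^-1) * (t ^+ N)^-1)%g.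
  have fy : far phi t y by apply: HN.
  have nSy : ~ S y.
    move=> Sy; have Uy : untwist t S y by apply/(far_untwist phiD S0 (@LatN _ A) S_shc tLat t_drift fy).
    have Ux := (normalizesX N (untwist_t t S) (X * Y^-1)%g).1 Uy.
    by case: ((untwist_infinity phiD sH Ht t_drift _).1 Ux).
  have py : pos y = 0 by case: fy.
  have [s [y0 [a [yE py0 y0a uy irr]]]] := complete_irreducible R_inj Bs0 sS S0 lS leadS py nSy.
  exists N, s, y0; rewrite -yE; split=> //; first by rewrite /y !mulgA !mulgVK.
  have [Ca HCa] := cr_bound R [:: y0].
  exists a, (Ca + c)%N; split=> //.
    by move=> i lt_in; have := HCa y0 (mem_head _ _) a y0a i lt_in; lia.
left; apply: NNPP => nout; apply: no.
exists (\row_i (cr R (pos h) i %/ d i)%Z); apply: (cr_inj R_inj) => i lt_in.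
rewrite AR (co_row _ (Ordinal lt_in)) /=; have [d0|d_gt0] := posnP (d i).
  rewrite d0 mul0r; apply: NNPP => nz; apply: nout; exists i => //; by left.
have dE := divz_eq (cr R (pos h) i) (d i).
have r_lt := ltz_pmod (cr R (pos h) i) (d_gt0 : 0 < (d i)%:Z).
have r_ge0 : 0 <= (cr R (pos h) i %% d i)%Z by apply: modz_ge0; lia.
have [r0|nr] := eqVneq (cr R (pos h) i %% d i)%Z 0; first by rewrite mulrC {1}dE r0 addr0.
case: nout; exists i => //; right.
exists (cr R (pos h) i %/ d i)%Z, (absz (cr R (pos h) i %% d i)%Z); split; [|lia|lia].
by rewrite gez0_abs // mulrC.
Qed.
End Completeness.

(** * Programs on codes *)

Local Close Scope ring_scope.
Definition nthc x i := nth 0 (dec x) i.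
Lemma nthc_cod s i : nthc (cod s) i = nth 0 s i. Proof. by rewrite /nthc CodeSeq.codeK. Qed.

Definition tr p e := ev p e != 0.
#[local] Arguments ev : simpl never.
#[local] Arguments CodeSeq.code : simpl never.
#[local] Arguments CodeSeq.decode : simpl never.

Lemma evV i e : ev (Var i) e = nth 0 e i. Proof. by []. Qed.
Lemma evZ e : ev Zro e = 0. Proof. by []. Qed.
Lemma evS p e : ev (Suc p) e = (ev p e).+1. Proof. by []. Qed.
Lemma evH p e : ev (Hd p) e = nthc (ev p e) 0. Proof. by rewrite /nthc nth0. Qed.
Lemma evC p q e : ev (Cns p q) e = cod (ev p e :: dec (ev q e)). Proof. by []. Qed.
Lemma evT p e : ev (Tl p) e = cod (behead (dec (ev p e))). Proof. by []. Qed.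
Lemma evR n z b e :
  ev (Rec n z b) e = iteri (ev n e) (fun m acc => ev b [:: m, acc & e]) (ev z e).
Proof. by []. Qed.
Lemma evF l z b e :
  ev (Fold l z b) e = foldr (fun a acc => ev b [:: a, acc & e]) (ev z e) (dec (ev l e)).
Proof. by []. Qed.
Lemma evM l b e : ev (Map l b) e = cod [seq ev b (a :: e) | a <- dec (ev l e)].
Proof. by []. Qed.
Lemma evA f args e : ev (Call f args) e = ev f [seq ev a e | a <- args].
Proof. by []. Qed.
Definition evE := (evA, evV, evZ, evS, evH, evC, evT, evR, evF, evM).

Definition Cst m := iter m Suc Zro.
Lemma ev_Cst m e : ev (Cst m) e = m. Proof. by elim: m => //= m IH; rewrite evS IH. Qed.

(** [Call] evaluates its body in a fresh environment. The loop body sees two more variables in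
    front, so [Var 3] is the branch [a] there, while the start value [Var 2] is [b]; one or more
    iterations return [a]. *)
Definition If c a b := Call (Rec (Var 0) (Var 2) (Var 3)) [:: c; a; b].
Lemma ev_If c a b e : ev (If c a b) e = if tr c e then ev a e else ev b e.
Proof. by rewrite /If !evE /= /tr; case: (ev c e). Qed.

Lemma tr_Cst m e : tr (Cst m) e = (m != 0). Proof. by rewrite /tr ev_Cst. Qed.
Lemma tr_Zro e : tr Zro e = false. Proof. by []. Qed.

Definition Not a := If a Zro (Cst 1).
Definition And a b := If a (If b (Cst 1) Zro) Zro.
Definition Or a b := If a (Cst 1) (If b (Cst 1) Zro).
Lemma tr_If c a b e : tr (If c a b) e = if tr c e then tr a e else tr b e.
Proof. by rewrite {1}/tr ev_If; case: ifP. Qed.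
Lemma ev_Not a e : ev (Not a) e = ~~ tr a e. Proof. by rewrite ev_If ev_Cst evZ; case: tr. Qed.
Lemma tr_Not a e : tr (Not a) e = ~~ tr a e. Proof. by rewrite {1}/tr ev_Not; case: tr. Qed.
Lemma tr_And a b e : tr (And a b) e = tr a e && tr b e.
Proof. by rewrite !tr_If !tr_Cst tr_Zro; case: (tr a e); case: (tr b e). Qed.
Lemma tr_Or a b e : tr (Or a b) e = tr a e || tr b e.
Proof. by rewrite !tr_If !tr_Cst tr_Zro; case: (tr a e); case: (tr b e). Qed.

Definition Add a b := Call (Rec (Var 0) (Var 1) (Suc (Var 1))) [:: a; b].
Lemma ev_Add a b e : ev (Add a b) e = ev a e + ev b e.
Proof. by rewrite /Add !evE /=; elim: (ev a e) => //= m; rewrite !evE /= => ->. Qed.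

Definition Mul a b := Call (Rec (Var 0) Zro (Add (Var 1) (Var 3))) [:: a; b].
Lemma ev_Mul a b e : ev (Mul a b) e = ev a e * ev b e.
Proof.
rewrite /Mul !evE /=; elim: (ev a e) => //= m; rewrite ev_Add !evE /= => ->.
by rewrite mulSn addnC.
Qed.

Definition Pred a := Call (Rec (Var 0) Zro (Var 0)) [:: a].
Lemma ev_Pred a e : ev (Pred a) e = (ev a e).-1.
Proof. by rewrite /Pred !evE /=; case: (ev a e). Qed.

Definition Sub a b := Call (Rec (Var 1) (Var 0) (Pred (Var 1))) [:: a; b].
Lemma ev_Sub a b e : ev (Sub a b) e = ev a e - ev b e.
Proof.
rewrite /Sub !evE /=; elim: (ev b e) => [|m] /=; first by rewrite subn0.
by rewrite ev_Pred !evE /= => ->; rewrite subnS.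
Qed.

Definition Leq a b := Not (Sub a b).
Lemma tr_Leq a b e : tr (Leq a b) e = (ev a e <= ev b e).
Proof. by rewrite tr_Not /tr ev_Sub negbK. Qed.
Definition Ltn a b := Leq (Suc a) b.
Lemma tr_Ltn a b e : tr (Ltn a b) e = (ev a e < ev b e).
Proof. by rewrite tr_Leq evS. Qed.
Definition Eqn a b := And (Leq a b) (Leq b a).
Lemma tr_Eqn a b e : tr (Eqn a b) e = (ev a e == ev b e).
Proof. by rewrite tr_And !tr_Leq eqn_leq. Qed.

Definition Odd a := Call (Rec (Var 0) Zro (Not (Var 1))) [:: a].
Lemma ev_Odd a e : ev (Odd a) e = odd (ev a e).
Proof.
rewrite /Odd !evE /=; elim: (ev a e) => //= m; rewrite ev_Not /tr !evE /= => ->.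
by case: (odd m).
Qed.

Definition Half a := Call (Rec (Var 0) Zro (Add (Odd (Var 0)) (Var 1))) [:: a].
Lemma ev_Half a e : ev (Half a) e = (ev a e)./2.
Proof.
rewrite /Half !evE /=; elim: (ev a e) => //= m; rewrite ev_Add ev_Odd !evE /= => ->.
by rewrite uphalf_half.
Qed.

Definition Nth l i := Call (Hd (Rec (Var 1) (Var 0) (Tl (Var 1)))) [:: l; i].
Lemma ev_Nth l i e : ev (Nth l i) e = nthc (ev l e) (ev i e).
Proof.
rewrite /Nth !evE /=.
suff -> : iteri (ev i e) (fun m acc => ev (Tl (Var 1)) [:: m, acc & [:: ev l e; ev i e]]) (ev l e) =
   cod (drop (ev i e) (dec (ev l e))) by rewrite nthc_cod nth_drop addn0.
elim: (ev i e) {2}(ev i e) => [|m IH] k /=; first by rewrite drop0 CodeSeq.decodeK.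
by rewrite IH !evE /= CodeSeq.codeK -drop1 drop_drop.
Qed.

Definition Iota a := Call (Rec (Var 0) Zro (Cns (Sub (Pred (Var 2)) (Var 0)) (Var 1))) [:: a].
Lemma ev_Iota a e : ev (Iota a) e = cod (iota 0 (ev a e)).
Proof.
rewrite /Iota !evE /=; move: (ev a e) => n.
suff H m : m <= n -> iteri m (fun m acc => ev (Cns (Sub (Pred (Var 2)) (Var 0)) (Var 1)) [:: m; acc; n]) 0 =
   cod (iota (n - m) m) by rewrite H // subnn.
elim: m => //= m IH lt_mn; rewrite IH ?(ltnW lt_mn) // evC ev_Sub ev_Pred !evE /= CodeSeq.codeK.
congr (cod (_ :: _)); first by lia.
by congr iota; lia.
Qed.

Definition Size l := Call (Fold (Var 0) Zro (Suc (Var 1))) [:: l].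
Lemma ev_Size l e : ev (Size l) e = size (dec (ev l e)).
Proof. by rewrite /Size !evE /=; elim: (dec _) => //= a s; rewrite evE => ->. Qed.

Definition Cat l m := Call (Fold (Var 0) (Var 1) (Cns (Var 0) (Var 1))) [:: l; m].
Lemma ev_Cat l m e : ev (Cat l m) e = cod (dec (ev l e) ++ dec (ev m e)).
Proof.
rewrite /Cat !evE /=; elim: (dec (ev l e)) => [|a s]; first by rewrite /= CodeSeq.decodeK.
by rewrite /= => ->; rewrite !evE /= CodeSeq.codeK.
Qed.

Definition Flat l := Call (Fold (Var 0) Zro (Cat (Var 0) (Var 1))) [:: l].
Lemma ev_Flat l e : ev (Flat l) e = cod (flatten [seq dec x | x <- dec (ev l e)]).
Proof.
rewrite /Flat !evE /=; elim: (dec (ev l e)) => //= a s ->.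
by rewrite ev_Cat !evE /= CodeSeq.codeK.
Qed.

Definition Nseq m x := Call (Rec (Var 0) Zro (Cns (Var 3) (Var 1))) [:: m; x].
Lemma ev_Nseq m x e : ev (Nseq m x) e = cod (nseq (ev m e) (ev x e)).
Proof.
rewrite /Nseq !evE /=; elim: (ev m e) => //= k ->.
by rewrite !evE /= CodeSeq.codeK.
Qed.

Definition Lst ps := foldr Cns Zro ps.
Lemma ev_Lst ps e : ev (Lst ps) e = cod [seq ev p e | p <- ps].
Proof. by elim: ps => //= p ps IH; rewrite evC IH CodeSeq.codeK. Qed.

Definition All l f := Call (Fold (Var 0) (Cst 1) (And (Var 0) (Var 1))) [:: Map l f].
Definition Has l f := Call (Fold (Var 0) Zro (Or (Var 0) (Var 1))) [:: Map l f].
Lemma tr_All l f e : tr (All l f) e = all (fun a => tr f (a :: e)) (dec (ev l e)).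
Proof.
rewrite /tr /All !evE /= CodeSeq.codeK; elim: (dec (ev l e)) => //= a s.
by rewrite -!/(tr _ _) tr_And /tr !evE /= => ->.
Qed.
Lemma tr_Has l f e : tr (Has l f) e = has (fun a => tr f (a :: e)) (dec (ev l e)).
Proof.
rewrite /tr /Has !evE /= CodeSeq.codeK; elim: (dec (ev l e)) => //= a s.
by rewrite -!/(tr _ _) tr_Or /tr !evE /= => ->.
Qed.

(** * Integers, vectors and matrices as codes *)

Section Arithmetic.
#[local] Opaque Cst If Not And Or Add Mul Pred Sub Leq Ltn Eqn Odd Half Nth Iota Size Cat Flat Nseq
  Lst All Has.

Local Open Scope ring_scope.

Definition zd (c : nat) : int := if odd c then Negz c./2 else Posz c./2.
Lemma int_codeK : cancel int_code zd.
Proof. by case=> m; rewrite /zd /= odd_double /= ?uphalf_double ?doubleK. Qed.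
Lemma zdK : cancel zd int_code.
Proof.
move=> c; rewrite /zd; case: ifP => oc /=; rewrite -[RHS](odd_double_half c) oc //.
Qed.
Lemma zd_inj : injective zd. Proof. exact: can_inj zdK. Qed.
(** Positive and negative parts, by which integer arithmetic becomes natural arithmetic on
    differences. *)
Definition Zp z := If (Odd z) Zro (Half z).
Definition Zn z := If (Odd z) (Suc (Half z)) Zro.
Lemma ev_ZpZn z e : zd (ev z e) = (ev (Zp z) e)%:Z - (ev (Zn z) e)%:Z.
Proof.
rewrite !ev_If evS ev_Half /tr ev_Odd evZ /zd; case: (odd _) => /=; last by rewrite subr0.
by rewrite NegzE sub0r.
Qed.
Lemma ev_abs z e : (ev (Zp z) e + ev (Zn z) e)%N = absz (zd (ev z e)).
Proof.
by rewrite !ev_If evS ev_Half /tr ev_Odd evZ /zd; case: (odd _) => /=; rewrite ?addn0.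
Qed.

Definition Zmk p q := Call (If (Leq (Var 1) (Var 0)) (Mul (Cst 2) (Sub (Var 0) (Var 1)))
  (Pred (Mul (Cst 2) (Sub (Var 1) (Var 0))))) [:: p; q].
Lemma ev_Zmk p q e : ev (Zmk p q) e = int_code ((ev p e)%:Z - (ev q e)%:Z).
Proof.
rewrite /Zmk evA ev_If tr_Leq ev_Pred !ev_Mul !ev_Sub !ev_Cst !evV /=.
apply/eqP; rewrite -eqz_nat int_codeE subr_ge0 lez_nat; case: leqP => h; apply/eqP; lia.
Qed.

Definition Zadd a b := Zmk (Add (Zp a) (Zp b)) (Add (Zn a) (Zn b)).
Lemma ev_Zadd a b e : ev (Zadd a b) e = int_code (zd (ev a e) + zd (ev b e)).
Proof. by rewrite ev_Zmk !ev_Add !ev_ZpZn; congr int_code; lia. Qed.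
Definition Zopp a := Zmk (Zn a) (Zp a).
Lemma ev_Zopp a e : ev (Zopp a) e = int_code (- zd (ev a e)).
Proof. by rewrite ev_Zmk ev_ZpZn; congr int_code; lia. Qed.
Definition Zmul a b := Zmk (Add (Mul (Zp a) (Zp b)) (Mul (Zn a) (Zn b)))
  (Add (Mul (Zp a) (Zn b)) (Mul (Zn a) (Zp b))).
Lemma ev_Zmul a b e : ev (Zmul a b) e = int_code (zd (ev a e) * zd (ev b e)).
Proof.
rewrite ev_Zmk !ev_Add !ev_Mul !ev_ZpZn; congr int_code.
by rewrite !PoszD !PoszM; ring.
Qed.
Definition Znat a := Mul (Cst 2) a.
Lemma zd_Znat a e : zd (ev (Znat a) e) = (ev a e)%:Z.
Proof. by rewrite ev_Mul ev_Cst mul2n /zd odd_double doubleK. Qed.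
Definition Zlt a b := Ltn (Add (Zp a) (Zn b)) (Add (Zp b) (Zn a)).
Lemma tr_Zlt a b e : tr (Zlt a b) e = (zd (ev a e) < zd (ev b e)).
Proof. by rewrite tr_Ltn !ev_Add !ev_ZpZn; lia. Qed.
Definition Zabs a := Add (Zp a) (Zn a).
Lemma ev_Zabs a e : ev (Zabs a) e = absz (zd (ev a e)).
Proof. by rewrite ev_Add ev_abs. Qed.
Definition Zsum l := Call (Fold (Var 0) Zro (Zadd (Var 0) (Var 1))) [:: l].
Lemma zd_Zsum l e : zd (ev (Zsum l) e) = \sum_(c <- dec (ev l e)) zd c.
Proof.
rewrite /Zsum !evE /=; elim: (dec (ev l e)) => [|a s]; first by rewrite big_nil.
by rewrite big_cons /= ev_Zadd !evE /= int_codeK => ->.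
Qed.

#[local] Opaque Zp Zn Zmk Zadd Zopp Zmul Znat Zlt Zabs Zsum.

Section Vectors.
Variable n : nat.
Definition vd (c : nat) : 'rV[int]_n := \row_i zd (nthc c i).
Definition md (c : nat) : 'M[int]_n := \matrix_(i, j) zd (nthc (nthc c i) j).

Lemma co_vd c i : (i < n)%N -> co (vd c) i = zd (nthc c i).
Proof. by move=> lt_in; rewrite (co_row _ (Ordinal lt_in)). Qed.

Definition vcode (v : 'rV[int]_n) := cod [seq int_code (co v i) | i <- iota 0 n].
Lemma vcodeK : cancel vcode vd.
Proof.
move=> v; apply: co_inj => i lt_in.
by rewrite co_vd // nthc_cod (nth_map 0%N) ?size_iota // nth_iota // int_codeK.
Qed.

Lemma md_row c i : row i (md c) = vd (nthc c i).
Proof. by apply/rowP => j; rewrite !mxE. Qed.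

Definition mcode (M : 'M[int]_n) := cod [seq vcode (row i M) | i <- enum 'I_n].
Lemma mcodeK : cancel mcode md.
Proof.
move=> M; apply/row_matrixP => i; rewrite md_row nthc_cod (nth_map i) ?size_enum_ord //.
by rewrite nth_ord_enum vcodeK.
Qed.

Lemma vd0 : vd 0 = 0. Proof. by apply/rowP => j; rewrite !mxE /nthc nth_nil. Qed.
End Vectors.

Lemma nthc_tab f n i : (i < n)%N -> nthc (cod [seq f j | j <- iota 0 n]) i = f i.
Proof. by move=> lt_in; rewrite nthc_cod (nth_map 0%N) ?size_iota // nth_iota. Qed.

Lemma big_iota_ord n (F : nat -> int) : \sum_(i <- iota 0 n) F i = \sum_(i < n) F i.
Proof. by rewrite -(big_mkord xpredT F) /index_iota subn0. Qed.

Definition Vadd n x y :=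
  Call (Map (Iota (Var 0)) (Zadd (Nth (Var 2) (Var 0)) (Nth (Var 3) (Var 0)))) [:: n; x; y].
Lemma vd_Vadd m n x y e : ev n e = m ->
  vd m (ev (Vadd n x y) e) = vd m (ev x e) + vd m (ev y e).
Proof.
move=> <-; apply/rowP => i; rewrite !mxE /Vadd evA /= evM ev_Iota evV CodeSeq.codeK nthc_tab //.
by rewrite ev_Zadd !ev_Nth !evV /= int_codeK.
Qed.

Definition Vopp n x := Call (Map (Iota (Var 0)) (Zopp (Nth (Var 2) (Var 0)))) [:: n; x].
Lemma vd_Vopp m n x e : ev n e = m -> vd m (ev (Vopp n x) e) = - vd m (ev x e).
Proof.
move=> <-; apply/rowP => i; rewrite !mxE /Vopp evA /= evM ev_Iota evV CodeSeq.codeK nthc_tab //.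
by rewrite ev_Zopp !ev_Nth !evV /= int_codeK.
Qed.

Definition Vm n v M := Call (Map (Iota (Var 0)) (Zsum (Map (Iota (Var 1))
   (Zmul (Nth (Var 3) (Var 0)) (Nth (Nth (Var 4) (Var 0)) (Var 1)))))) [:: n; v; M].
Lemma vd_Vm m n v M e : ev n e = m ->
  vd m (ev (Vm n v M) e) = vd m (ev v e) *m md m (ev M e).
Proof.
move=> <-; apply/rowP => i; rewrite !mxE /Vm evA /= evM ev_Iota evV CodeSeq.codeK nthc_tab //.
rewrite zd_Zsum evM ev_Iota evV /= !CodeSeq.codeK big_map big_iota_ord.
by apply: eq_bigr => j _; rewrite !mxE ev_Zmul !ev_Nth !evV /= int_codeK.
Qed.

Definition Veq n x y :=
  Call (All (Iota (Var 0)) (Eqn (Nth (Var 2) (Var 0)) (Nth (Var 3) (Var 0)))) [:: n; x; y].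
Lemma tr_Veq m n x y e : ev n e = m ->
  tr (Veq n x y) e = (vd m (ev x e) == vd m (ev y e)).
Proof.
move=> em; rewrite /Veq /tr evA -/(tr _ _) tr_All ev_Iota CodeSeq.codeK /=.
apply/allP/eqP => [H|E i].
  apply/rowP => i; rewrite !mxE; congr zd; apply/eqP.
  have : (i : nat) \in iota 0 (ev n e) by rewrite em mem_iota add0n ltn_ord.
  by move/H; rewrite tr_Eqn !ev_Nth !evV.
rewrite evV /= em mem_iota => /andP [_ lt_im]; rewrite tr_Eqn !ev_Nth !evV /=; apply/eqP/zd_inj.
by rewrite -!(@co_vd m) // E.
Qed.
End Arithmetic.

#[local] Arguments Lst : simpl never.
#[local] Arguments Cst : simpl never.
#[local] Arguments vd : simpl never.
Local Notation codeK := CodeSeq.codeK.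
Local Notation decodeK := CodeSeq.decodeK.
Local Open Scope ring_scope.

(** * Programs on elements of wreath products *)

(* Contexts are codes of [:: n; multiplication table; index of 1]. *)
Definition Cn cx := Nth cx Zro.
Definition Ctb cx := Nth cx (Cst 1).
Definition Ce cx := Nth cx (Cst 2).
(** An index outside the table is read as the identity, in accordance with the default value in
    [gd], so that every number denotes a group element. *)
Definition Gnorm cx g := If (Ltn g (Size (Ctb cx))) g (Ce cx).
Definition Gmul cx a b := Nth (Nth (Ctb cx) a) b.
Definition Look cx l b := Call (Fold (Var 1) (Ce (Var 0))
   (If (Veq (Cn (Var 2)) (Nth (Var 0) Zro) (Var 4))
       (Gmul (Var 2) (Gnorm (Var 2) (Nth (Var 0) (Cst 1))) (Var 1))
       (Var 1))) [:: cx; l; b].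
Definition Epos x := Nth x (Cst 1).
Definition Lval cx x b := Look cx (Nth x Zro) b.
Definition Emul n x y := Call (Lst
   [:: Cat (Nth (Var 1) Zro) (Map (Nth (Var 2) Zro)
        (Lst [:: Vadd (Var 1) (Nth (Var 0) Zro) (Epos (Var 2)); Nth (Var 0) (Cst 1)]));
      Vadd (Var 0) (Epos (Var 1)) (Epos (Var 2))]) [:: n; x; y].
Definition Eprod n w := Call (Fold (Var 1) Zro (Emul (Var 2) (Var 0) (Var 1))) [:: n; w].
Definition Esh v := Lst [:: Zro; v].
Definition Epow n x m := Eprod n (Nseq m x).
Definition Epows n us p :=
  Call (Eprod (Var 0) (Flat (Map (Iota (Var 0)) (Nseq (Nth (Var 3) (Var 0)) (Nth (Var 2) (Var 0))))))
    [:: n; us; p].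
(** Entries at the same position may cancel in the product, so each listed position is evaluated
    before it is accepted. *)
Definition Supp cx x := Call (Flat (Map (Nth (Var 1) Zro)
   (If (Eqn (Lval (Var 1) (Var 2) (Nth (Var 0) Zro)) (Ce (Var 1))) Zro (Lst [:: Nth (Var 0) Zro]))))
   [:: cx; x].
Definition Eeq cx x y := Call (And (Veq (Cn (Var 0)) (Epos (Var 1)) (Epos (Var 2)))
   (All (Cat (Supp (Var 0) (Var 1)) (Supp (Var 0) (Var 2)))
      (Eqn (Lval (Var 1) (Var 2) (Var 0)) (Lval (Var 1) (Var 3) (Var 0))))) [:: cx; x; y].
Definition Ple n R b a := Call (Rec (Var 0) (Cst 1)
   (Or (Ltn (Nth (Var 3) (Var 0)) (Nth (Var 4) (Var 0)))
       (And (Eqn (Nth (Var 3) (Var 0)) (Nth (Var 4) (Var 0))) (Var 1)))) [:: n; Vm n b R; Vm n a R].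
(** An integer has absolute value at most [c] exactly when its code is at most [2 * c]; this is the
    range of each entry. *)
Definition Box n c := Call (Rec (Var 0) (Lst [:: Zro])
   (Flat (Map (Var 1) (Map (Iota (Suc (Mul (Cst 2) (Var 4)))) (Cns (Var 0) (Var 1)))))) [:: n; c].

Definition table_ok (gT : finGroupType) (r : seq gT) (tb : nat) :=
  size (dec tb) = size r /\ forall i j, (i < size r)%N -> (j < size r)%N ->
    nthc (nthc tb i) j = index (nth 1%g r i * nth 1%g r j)%g r.

Section Elements.
Variables (gT : finGroupType) (r : seq gT) (n tb : nat).
Hypotheses (r_enum : enumerates r) (tbP : table_ok r tb).
Notation V := 'rV[int]_n.
Notation W := (wreath gT n).
Notation vd := (vd n).

Definition single (a : V) (g : gT) : W := Wreath [fsfun b in [fset a]%fset => g] 0.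
Lemma lamp_single a g b : lamp (single a g) b = if b == a then g else 1%g.
Proof. by rewrite fsfunE in_fset1. Qed.

Lemma pos_single a g : pos (single a g) = 0. Proof. by []. Qed.

Lemma shc_single a b g : shc a (single b g) = single (b + a) g.
Proof.
apply: wreath_eq => [c|]; last exact: pos_shc.
by rewrite lamp_shc // !lamp_single subr_eq.
Qed.

Definition gd (c : nat) : gT := nth 1%g r c.
Definition alamp (l : seq nat) : W := (\prod_(p <- l) single (vd (nthc p 0)) (gd (nthc p 1)))%g.
(** Every number denotes an element: positions may be repeated, and their values multiply in the
    order of the list. This laxity lets products be computed by concatenation and certificates
    contain arbitrary numbers. *)
Definition elt (c : nat) : W := (alamp (dec (nthc c 0)) * sh gT (vd (nthc c 1)))%g.

Lemma pos_alamp l : pos (alamp l) = 0.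
Proof.
by rewrite /alamp; elim: l => [|p l IH]; rewrite ?big_nil // big_cons posM IH pos_single addr0.
Qed.

Lemma lamp_alamp_cons p l a : lamp (alamp (p :: l)) a =
  ((if vd (nthc p 0) == a then gd (nthc p 1) else 1) * lamp (alamp l) a)%g.
Proof. by rewrite /alamp big_cons lampM pos_single subr0 lamp_single eq_sym. Qed.

Lemma pos_elt c : pos (elt c) = vd (nthc c 1).
Proof. by rewrite posM pos_alamp add0r. Qed.
Lemma lamp_elt c a : lamp (elt c) a = lamp (alamp (dec (nthc c 0))) a.
Proof. by rewrite lampM lamp_sh mulg1. Qed.

Lemma alamp_supp l a : lamp (alamp l) a != 1%g -> exists2 p, p \in l & vd (nthc p 0) = a.
Proof.
elim: l => [|p l IH]; first by rewrite /alamp big_nil lamp1 eqxx.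
rewrite lamp_alamp_cons; case: (vd _ =P a) => [pa _|_]; first by exists p; rewrite ?mem_head.
by rewrite mul1g => /IH [q ql qa]; exists q; rewrite // inE ql orbT.
Qed.

Lemma alamp_cat l m : alamp (l ++ m) = (alamp l * alamp m)%g.
Proof. by rewrite /alamp big_cat. Qed.

Lemma elt0 : elt 0 = 1%g.
Proof. by rewrite /elt /nthc /= /alamp big_nil mul1g vd0. Qed.

Let sz_r : forall g, (index g r < size r)%N. Proof. by move=> g; rewrite index_mem; case: r_enum. Qed.
Let gd_index g : gd (index g r) = g. Proof. by rewrite /gd nth_index //; case: r_enum. Qed.
Let index_inj : injective (fun g => index g r).
Proof. by move=> g h /(congr1 gd); rewrite !gd_index. Qed.

Lemma elt_listing (w : W) (s : seq V) : perm_eq s (finsupp (lamp w)) ->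
  elt (cod [:: cod [seq cod [:: vcode a; index (lamp w a) r] | a <- s]; vcode (pos w)]) = w.
Proof.
move=> sw; pose p a := cod [:: vcode a; index (lamp w a) r]; rewrite -/p.
apply: wreath_eq => [a|]; last by rewrite pos_elt !nthc_cod /= vcodeK.
rewrite lamp_elt !nthc_cod /= codeK.
have : uniq s by rewrite (perm_uniq sw) fset_uniq.
have [wa|wa] := boolP (a \in s); last first.
  rewrite (perm_mem sw) in wa; rewrite [RHS](fsfun_dflt wa) => _.
  apply/eqP/negPn/negP => /alamp_supp [_ /mapP [b wb ->]].
  by rewrite /p nthc_cod /= vcodeK => ba; rewrite -(perm_mem sw) -ba wb in wa.
elim: s {sw} wa => // b s IH; rewrite inE /= => sa /andP [bs us].
rewrite lamp_alamp_cons /p !nthc_cod /= vcodeK gd_index.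
have [<-|nba] := eqVneq b a; last first.
  by rewrite mul1g IH //; case/predU1P: sa => // ab; rewrite ab eqxx in nba.
rewrite (_ : lamp (alamp _) b = 1%g) ?mulg1 //.
apply/eqP/negPn/negP => /alamp_supp [_ /mapP [b' b's ->]].
by rewrite nthc_cod /= vcodeK => b'b; rewrite -b'b b's in bs.
Qed.

Lemma elt_onto (w : W) : exists c, elt c = w.
Proof. by eexists; apply: elt_listing (perm_refl _). Qed.

Definition context (C : nat) := [/\ nthc C 0 = n, nthc C 1 = tb & nthc C 2 = index 1%g r].

Lemma ev_Cn cx e : context (ev cx e) -> ev (Cn cx) e = n.
Proof. by case=> cn _ _; rewrite ev_Nth. Qed.
Lemma ev_Ce cx e : context (ev cx e) -> ev (Ce cx) e = index 1%g r.
Proof. by case=> _ _ ce; rewrite ev_Nth ev_Cst. Qed.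

Lemma ev_Gnorm cx g e : context (ev cx e) -> ev (Gnorm cx g) e = index (gd (ev g e)) r.
Proof.
move=> C; rewrite ev_If tr_Ltn ev_Size ev_Nth ev_Cst ev_Ce //.
case: (C) => _ -> _; case: (tbP) => -> _.
case: ltnP => [lt|ge]; last by rewrite /gd nth_default.
by rewrite /gd index_uniq //; case: r_enum.
Qed.

Lemma ev_Gmul cx a b e x y : context (ev cx e) -> ev a e = index x r -> ev b e = index y r ->
  ev (Gmul cx a b) e = index (x * y)%g r.
Proof.
move=> [_ ct _] ea eb; rewrite !ev_Nth ev_Cst ct ea eb; case: (tbP) => _ -> //.
by rewrite -!/(gd _) !gd_index.
Qed.

Lemma ev_Look cx l b e : context (ev cx e) ->
  ev (Look cx l b) e = index (lamp (alamp (dec (ev l e))) (vd (ev b e))) r.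
Proof.
move=> C; rewrite /Look evA /= evF ev_Ce ?evV //=.
elim: (dec (ev l e)) => [|p s IH] /=; first by rewrite /alamp big_nil lamp1.
rewrite IH ev_If (@tr_Veq n); last exact: ev_Cn.
rewrite ev_Nth !evV evZ /= lamp_alamp_cons.
case: eqP => _; last by rewrite mul1g.
by apply: ev_Gmul; rewrite ?ev_Gnorm ?ev_Nth ?ev_Cst ?evV.
Qed.

Lemma ev_Lval cx x b e : context (ev cx e) ->
  ev (Lval cx x b) e = index (lamp (elt (ev x e)) (vd (ev b e))) r.
Proof. by move=> C; rewrite ev_Look // ev_Nth lamp_elt. Qed.

Lemma alamp_shift f b l : (forall c, vd (nthc (f c) 0) = vd (nthc c 0) + b /\ nthc (f c) 1 = nthc c 1) ->
  alamp (map f l) = shc b (alamp l).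
Proof.
move=> fE; rewrite /alamp shc_prod big_map; apply: eq_bigr => c _.
by case: (fE c) => -> ->; rewrite shc_single.
Qed.

Lemma elt_Emul nn x y e : ev nn e = n -> elt (ev (Emul nn x y) e) = (elt (ev x e) * elt (ev y e))%g.
Proof.
move=> en; rewrite /Emul evA /= ev_Lst /= ev_Cat evM.
rewrite {1}/elt !nthc_cod /= !codeK !ev_Nth !evV evZ /=.
rewrite vd_Vadd ?evV // !ev_Nth ev_Cst !evV /= -!pos_elt alamp_cat.
rewrite (alamp_shift (b := pos (elt (ev x e)))) => [|a].
  by rewrite !pos_elt shD /shc /elt !mulgA mulgVK.
by rewrite ev_Lst !nthc_cod /= vd_Vadd ?evV // !ev_Nth ev_Cst !evV evZ /= pos_alamp add0r.
Qed.

Lemma elt_Eprod nn w e : ev nn e = n ->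
  elt (ev (Eprod nn w) e) = (\prod_(c <- dec (ev w e)) elt c)%g.
Proof.
move=> en; rewrite /Eprod evA /= evF !evV /=.
elim: (dec (ev w e)) => [|c s IH] /=; first by rewrite big_nil elt0.
by rewrite big_cons elt_Emul ?evV //= IH.
Qed.

Lemma elt_Esh v e : elt (ev (Esh v) e) = sh gT (vd (ev v e)).
Proof. by rewrite /Esh ev_Lst /= /elt !nthc_cod /= /nthc /alamp big_nil mul1g. Qed.

Lemma elt_Epow nn x m e : ev nn e = n -> elt (ev (Epow nn x m) e) = (elt (ev x e) ^+ ev m e)%g.
Proof.
move=> en; rewrite elt_Eprod // ev_Nseq codeK.
by elim: (ev m e) => [|k IH]; rewrite ?big_nil // big_cons IH expgS.
Qed.

Lemma elt_nth us i : elt (nthc us i) = nth 1%g [seq elt u | u <- dec us] i.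
Proof.
have [lt_i|le_i] := ltnP i (size (dec us)); first by rewrite (nth_map 0%N).
by rewrite /nthc !nth_default ?size_map ?elt0.
Qed.

Lemma elt_Epows nn us p e : ev nn e = n -> size (dec (ev us e)) = n ->
  elt (ev (Epows nn us p) e) = powers [seq elt u | u <- dec (ev us e)] (nthc (ev p e)).
Proof.
move=> en sz; rewrite /Epows evA /= elt_Eprod ?evV // ev_Flat evM ev_Iota !evV /= en !codeK.
rewrite /powers size_map sz -(big_mkord xpredT (fun i => nth 1%g [seq elt u | u <- dec (ev us e)] i ^+ nthc (ev p e) i)%g).
rewrite /index_iota subn0; elim: (iota 0 n) => [|i s IH]; first by rewrite !big_nil.
rewrite big_cons /= big_cat /= IH; congr (_ * _)%g.
rewrite ev_Nseq codeK !ev_Nth !evV /= -elt_nth.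
by elim: (nthc (ev p e) i) => [|k IHk]; rewrite ?big_nil // big_cons IHk expgS.
Qed.

Lemma SuppP cx x e a : context (ev cx e) ->
  lamp (elt (ev x e)) a != 1%g <-> exists2 c, c \in dec (ev (Supp cx x) e) & vd c = a.
Proof.
move=> C; rewrite /Supp evA /= ev_Flat evM codeK ev_Nth !evV evZ /= codeK.
set f := fun p : nat => ev _ _.
have fE p : dec (f p) = if lamp (elt (ev x e)) (vd (nthc p 0)) == 1%g then [::] else [:: nthc p 0].
  rewrite /f ev_If tr_Eqn ev_Lval; last by [].
  rewrite ev_Ce; last by [].
  rewrite ev_Nth !evV evZ /=.
  by rewrite (inj_eq index_inj); case: ifP => // _; rewrite ev_Lst codeK /= ev_Nth !evV evZ.
split=> [xa|[c /flattenP [s /mapP [_ /mapP [p px ->] ->]]]].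
  have [p pl pa] : exists2 p, p \in dec (nthc (ev x e) 0) & vd (nthc p 0) = a.
    by apply: alamp_supp; rewrite -lamp_elt.
  exists (nthc p 0) => //; apply/flattenP; exists (dec (f p)).
    by apply/mapP; exists (f p) => //; apply/mapP; exists p.
  by rewrite fE pa (negbTE xa) mem_head.
by rewrite fE; case: ifPn => // xp; rewrite inE => /eqP -> <-.
Qed.

Lemma all_Supp cx x e (P : pred nat) (Q : V -> Prop) : context (ev cx e) ->
  (forall c, P c <-> Q (vd c)) ->
  all P (dec (ev (Supp cx x) e)) <-> forall a, lamp (elt (ev x e)) a != 1%g -> Q a.
Proof.
move=> C PQ; split=> [/allP H a /(SuppP _ _ C) [c cs <-]|H]; first by apply/PQ/H.
by apply/allP => c cs; apply/PQ/H/(SuppP _ _ C); exists c.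
Qed.

Lemma has_Supp cx x e (P : pred nat) (Q : V -> Prop) : context (ev cx e) ->
  (forall c, P c <-> Q (vd c)) ->
  has P (dec (ev (Supp cx x) e)) <-> exists2 a, lamp (elt (ev x e)) a != 1%g & Q a.
Proof.
move=> C PQ; split=> [/hasP [c cs /PQ Qc]|[a /(SuppP _ _ C) [c cs <-] /PQ Pc]].
  by exists (vd c) => //; apply/(SuppP _ _ C); exists c.
by apply/hasP; exists c.
Qed.

Lemma tr_Eeq cx x y e : context (ev cx e) -> tr (Eeq cx x y) e = (elt (ev x e) == elt (ev y e)).
Proof.
move=> C; rewrite /Eeq /tr evA -/(tr _ _) /= tr_And tr_All ev_Cat codeK all_cat.
rewrite (@tr_Veq n); last exact: ev_Cn.
rewrite !ev_Nth ev_Cst !evV /= -!pos_elt.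
set P := fun a : nat => tr _ _.
pose Q a := lamp (elt (ev x e)) a = lamp (elt (ev y e)) a.
have PQ c : P c <-> Q (vd c).
  rewrite /Q /P tr_Eqn !ev_Lval ?evV //= (inj_eq index_inj); split=> /eqP //.
have C' : context (ev (Var 0) [:: ev cx e; ev x e; ev y e]) by [].
apply/idP/eqP => [/and3P [/eqP pxy /(all_Supp _ C' PQ) Hx /(all_Supp _ C' PQ) Hy]|E].
  rewrite !evV /= in Hx Hy; apply: wreath_eq => // a.
  have [xa|/Hx //] := eqVneq (lamp (elt (ev x e)) a) 1%g.
  by have [ya|/Hy //] := eqVneq (lamp (elt (ev y e)) a) 1%g; rewrite xa ya.
rewrite E eqxx /=; apply/andP; split; apply/(all_Supp _ C' PQ) => a _; by rewrite /Q E.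
Qed.

Lemma tr_Ple nn R b a e : ev nn e = n ->
  tr (Ple nn R b a) e = ple (md n (ev R e)) (vd (ev b e)) (vd (ev a e)).
Proof.
move=> en; rewrite /Ple /tr evA -/(tr _ _) /= /ple.
have keyE v i : (i < n)%N ->
    nthc (ev (Vm nn v R) e) i = key (md n (ev R e)) (vd (ev v e)) i.
  by move=> lt_in; rewrite /key /cr -(@vd_Vm n nn v R e en) co_vd // zdK.
have keyb := keyE b; have keya := keyE a.
rewrite /tr evR !evV /= ev_Cst en.
move: (ev (Vm nn b R) e) (ev (Vm nn a R) e) keyb keya => kb ka keyb keya.
set body := Or _ _; set e' := [:: n; kb; ka].
set k1 := key _ (vd (ev b e)); set k2 := key _ (vd (ev a e)).
suff H m : (m <= n)%N -> (iteri m (fun m acc => ev body [:: m, acc & e']) 1%N != 0%N) = lexle m k1 k2.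
  exact: H.
elim: m => [//|m IH] lt_mn.
rewrite -[LHS]/(tr body [:: m, iteri m (fun m acc => ev body [:: m, acc & e']) 1%N & e']).
rewrite tr_Or tr_And tr_Ltn tr_Eqn !ev_Nth !evV [nth _ _ 3]/= [nth _ _ 4]/= [nth _ _ 0]/= keyb ?keya //.
by rewrite {1}/tr evV [nth _ _ 1]/= (IH (ltnW lt_mn)).
Qed.

Lemma BoxP nn c e : ev nn e = n ->
  (forall v, v \in dec (ev (Box nn c) e) -> box (ev c e) (vd v)) /\
  forall z : V, box (ev c e) z -> exists2 v, v \in dec (ev (Box nn c) e) & vd v = z.
Proof.
move=> en; set C := ev c e.
suff H v : v \in dec (ev (Box nn c) e) <-> size (dec v) = n /\ all (leq^~ (2 * C)%N) (dec v).
  split=> [v /H [sv /allP Hv] i lt_in|z bz].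
    have lt_iv : (i < size (dec v))%N by rewrite sv.
    have := Hv _ (mem_nth 0%N lt_iv); rewrite -/(nthc v i) co_vd //.
    by have E := int_codeE (zd (nthc v i)); rewrite zdK in E; case: ifP E; lia.
  exists (vcode z); last exact: vcodeK.
  apply/H; rewrite codeK size_map size_iota; split=> //.
  apply/allP => x /mapP [i]; rewrite mem_iota => /andP [_ lt_in] ->.
  by have := bz i lt_in; have := int_codeE (co z i); case: ifP; lia.
rewrite /Box evA /= evR !evV /= en ev_Lst /= evZ -/C.
set e' := [:: n; C]; elim: (n) v => [|m IH] v /=.
  rewrite codeK inE; split=> [/eqP ->|[]]; first by [].
  by move/size0nil => dv _; rewrite -[v]decodeK dv.
rewrite ev_Flat evM !codeK !evV /=; split.
  move=> /flattenP [_ /mapP [_ /mapP [u /IH [su Hu] ->] ->]].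
  rewrite evM ev_Iota evS ev_Mul ev_Cst evV [nth _ _ _]/= !codeK => /mapP [i].
  rewrite mem_iota add0n ltnS => /andP [_ le_i] ->.
  by rewrite evC !evV /= codeK /= su le_i.
case vE: (dec v) => [|i s] [] //= [sz] /andP [le_i Hs].
apply/flattenP; set f := fun a : nat => ev _ _.
exists (dec (f (cod s))).
  by apply/mapP; exists (f (cod s)) => //; apply/mapP; exists (cod s) => //; apply/IH; rewrite codeK.
rewrite /f evM ev_Iota evS ev_Mul ev_Cst evV [nth _ _ _]/= !codeK; apply/mapP; exists i.
  by rewrite mem_iota add0n ltnS.
by rewrite evC !evV /= codeK -vE decodeK.
Qed.
End Elements.

#[local] Opaque hdc tlc consc CodeSeq.code CodeSeq.decode.

(** * Programs checking certificates *)

(* The data of a certificate are coded by [:: cx; R; d; us; i0; Bs; c; posmx us]. *)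
Definition Pcx p := Nth p Zro.
Definition Pn p := Cn (Pcx p).
Definition PR p := Nth p (Cst 1).
Definition Pd p := Nth p (Cst 2).
Definition Pus p := Nth p (Cst 3).
Definition Pi0 p := Nth p (Cst 4).
Definition PB p := Nth p (Cst 5).
Definition Pc p := Nth p (Cst 6).
Definition PA p := Nth p (Cst 7).
Definition Pt p := Nth (Pus p) (Pi0 p).

Definition Letter p z j := Call (Emul (Pn (Var 0))
   (Emul (Pn (Var 0)) (Esh (Vm (Pn (Var 0)) (Var 1) (PA (Var 0)))) (Nth (PB (Var 0)) (Var 2)))
   (Esh (Vopp (Pn (Var 0)) (Vm (Pn (Var 0)) (Var 1) (PA (Var 0)))))) [:: p; z; j].
Definition Letter2 p w := Letter p (Nth w Zro) (Nth w (Cst 1)).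
Definition Word p s := Call (Eprod (Pn (Var 0)) (Map (Var 1) (Letter2 (Var 1) (Var 0)))) [:: p; s].
Definition Dominated p x y z := Call (All (Supp (Pcx (Var 0)) (Var 1))
  (Has (Cat (Supp (Pcx (Var 1)) (Var 3)) (Supp (Pcx (Var 1)) (Var 4)))
     (Ple (Pn (Var 2)) (PR (Var 2)) (Var 1) (Var 0)))) [:: p; x; y; z].
Definition StrictlyDominated p x y z := Call (All (Supp (Pcx (Var 0)) (Var 1))
  (Has (Cat (Supp (Pcx (Var 1)) (Var 3)) (Supp (Pcx (Var 1)) (Var 4)))
     (Not (Ple (Pn (Var 2)) (PR (Var 2)) (Var 0) (Var 1))))) [:: p; x; y; z].
Definition Quot p t u w := Call (And
  (Eeq (Pcx (Var 0)) (Var 2) (Emul (Pn (Var 0)) (Emul (Pn (Var 0)) (Var 1) (Letter2 (Var 0) (Var 3)))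
                          (Word (Var 0) (Nth (Var 3) (Cst 2)))))
  (And (Dominated (Var 0) (Letter2 (Var 0) (Var 3)) (Var 1) (Var 2))
       (All (Nth (Var 3) (Cst 2)) (StrictlyDominated (Var 1) (Letter2 (Var 1) (Var 0)) (Var 2) (Var 3))))) [:: p; t; u; w].
Definition Conj p t u w := Call (And
  (Eeq (Pcx (Var 0)) (Emul (Pn (Var 0)) (Var 2) (Var 1))
     (Emul (Pn (Var 0)) (Var 1) (Word (Var 0) (Nth (Var 3) (Cst 2)))))
  (All (Nth (Var 3) (Cst 2)) (Dominated (Var 1) (Letter2 (Var 1) (Var 0)) (Var 3) Zro))) [:: p; t; u; w].
Definition Pair p ws t u := Call (And (Has (Var 1) (Quot (Var 1) (Var 3) (Var 4) (Var 0)))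
  (Has (Var 1) (Conj (Var 1) (Var 3) (Var 4) (Var 0)))) [:: p; ws; t; u].
Definition Pairs p ws := Call (All (Box (Pn (Var 0)) (Pc (Var 0)))
  (All (Box (Pn (Var 1)) (Pc (Var 1))) (All (Iota (Suc (Size (PB (Var 2)))))
    (All (Iota (Suc (Size (PB (Var 3)))))
       (Pair (Var 4) (Var 5) (Letter (Var 4) (Var 3) (Var 1)) (Letter (Var 4) (Var 2) (Var 0)))))))
  [:: p; ws].
Definition Coord p v i := Nth (Vm (Pn p) v (PR p)) i.
Definition Far p y := Call (And (Veq (Pn (Var 0)) (Epos (Var 1)) Zro)
  (All (Supp (Pcx (Var 0)) (Var 1)) (All (Supp (Pcx (Var 1)) (Pt (Var 1)))
     (Zlt (Coord (Var 2) (Var 0) (Pi0 (Var 2))) (Coord (Var 2) (Var 1) (Pi0 (Var 2))))))) [:: p; y].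
Definition TwistEq p x y k := Call (And
  (Eeq (Pcx (Var 0)) (Emul (Pn (Var 0)) (Epow (Pn (Var 0)) (Pt (Var 0)) (Nth (Var 3) Zro)) (Var 1))
    (Emul (Pn (Var 0)) (Word (Var 0) (Nth (Var 3) (Cst 1)))
       (Emul (Pn (Var 0)) (Epow (Pn (Var 0)) (Pt (Var 0)) (Nth (Var 3) Zro)) (Var 2))))
  (Far (Var 0) (Word (Var 0) (Nth (Var 3) (Cst 1))))) [:: p; x; y; k].
Definition Upto p a x := Call (All (Supp (Pcx (Var 0)) (Var 2))
  (Ple (Pn (Var 1)) (PR (Var 1)) (Var 0) (Var 2))) [:: p; a; x].
Definition Irreducible p y a c := Call (And (Veq (Pn (Var 0)) (Epos (Var 1)) Zro)
  (And (Not (Eqn (Lval (Pcx (Var 0)) (Var 1) (Var 2)) (Ce (Pcx (Var 0)))))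
  (And (Upto (Var 0) (Var 2) (Var 1))
  (And (All (Iota (Pn (Var 0))) (Leq (Add (Zabs (Coord (Var 1) (Var 3) (Var 0))) (Pc (Var 1))) (Var 4)))
       (All (Box (Pn (Var 0)) (Var 3)) (All (Iota (Suc (Size (PB (Var 1)))))
          (Not (And (Upto (Var 2) (Var 4) (Letter (Var 2) (Var 1) (Var 0)))
             (Eqn (Lval (Pcx (Var 2)) (Letter (Var 2) (Var 1) (Var 0)) (Var 4))
                  (Lval (Pcx (Var 2)) (Var 3) (Var 4)))))))))))
  [:: p; y; a; c].
Definition NotTwistEq p x y k := Call (And
  (Eeq (Pcx (Var 0)) (Emul (Pn (Var 0)) (Epow (Pn (Var 0)) (Pt (Var 0)) (Nth (Var 3) Zro)) (Var 1))
    (Emul (Pn (Var 0)) (Emul (Pn (Var 0)) (Word (Var 0) (Nth (Var 3) (Cst 1))) (Nth (Var 3) (Cst 2)))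
       (Emul (Pn (Var 0)) (Epow (Pn (Var 0)) (Pt (Var 0)) (Nth (Var 3) Zro)) (Var 2))))
  (And (Far (Var 0) (Emul (Pn (Var 0)) (Word (Var 0) (Nth (Var 3) (Cst 1))) (Nth (Var 3) (Cst 2))))
       (Irreducible (Var 0) (Nth (Var 3) (Cst 2)) (Nth (Var 3) (Cst 3)) (Nth (Var 3) (Cst 4)))))
  [:: p; x; y; k].

Definition Zeq a b := Eqn a b.
Lemma tr_Zeq a b e : tr (Zeq a b) e = (zd (ev a e) == zd (ev b e)).
Proof. by rewrite tr_Eqn (inj_eq zd_inj). Qed.

Definition Outside p h f := Call (And (Ltn (Nth (Var 2) Zro) (Pn (Var 0)))
  (Or (And (Eqn (Nth (Pd (Var 0)) (Nth (Var 2) Zro)) Zro)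
           (Not (Zeq (Coord (Var 0) (Epos (Var 1)) (Nth (Var 2) Zro)) Zro)))
      (And (Zeq (Coord (Var 0) (Epos (Var 1)) (Nth (Var 2) Zro))
        (Zadd (Zmul (Znat (Nth (Pd (Var 0)) (Nth (Var 2) Zro))) (Nth (Var 2) (Cst 1))) (Znat (Nth (Var 2) (Cst 2)))))
      (And (Ltn Zro (Nth (Var 2) (Cst 2))) (Ltn (Nth (Var 2) (Cst 2)) (Nth (Pd (Var 0)) (Nth (Var 2) Zro)))))))
  [:: p; h; f].

Lemma index_inj_enum (gT : finGroupType) (r : seq gT) : enumerates r -> injective (fun g => index g r).
Proof. by case=> _ all_r g h E; rewrite -(nth_index 1%g (all_r g)) E nth_index. Qed.

Section Accessors.
Variables (gT : finGroupType) (r : seq gT) (n tb : nat).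
Hypotheses (r_enum : enumerates r) (tbP : table_ok r tb).
Notation V := 'rV[int]_n.
Notation W := (wreath gT n).
Notation vd := (vd n).
Notation elt := (elt r n).
Variable P : nat.
Hypothesis cxP : context r n tb (nthc P 0).
Let R := md n (nthc P 1).
Let d := nthc (nthc P 2).
Let us := [seq elt u | u <- dec (nthc P 3)].
Let i0 := nthc P 4.
Let Bs := [seq elt b | b <- dec (nthc P 5)].
Let c := nthc P 6.
Let A := posmx us.
Hypothesis AP : md n (nthc P 7) = A.
Let t := nth 1%g us i0.

Variables (p : prog) (e : seq nat).
Hypothesis pP : ev p e = P.

Lemma ctx_Pcx : context r n tb (ev (Pcx p) e).
Proof. by rewrite /Pcx ev_Nth pP. Qed.
Lemma ev_Pn : ev (Pn p) e = n. Proof. exact: (ev_Cn ctx_Pcx). Qed.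
Lemma ev_PR : ev (PR p) e = nthc P 1. Proof. by rewrite ev_Nth ev_Cst pP. Qed.
Lemma ev_Pi0 : ev (Pi0 p) e = i0. Proof. by rewrite ev_Nth ev_Cst pP. Qed.
Lemma ev_PB : ev (PB p) e = nthc P 5. Proof. by rewrite ev_Nth ev_Cst pP. Qed.
Lemma ev_Pc : ev (Pc p) e = c. Proof. by rewrite ev_Nth ev_Cst pP. Qed.
Lemma ev_PA : ev (PA p) e = nthc P 7. Proof. by rewrite ev_Nth ev_Cst pP. Qed.
Lemma elt_Pt : elt (ev (Pt p) e) = t.
Proof. by rewrite !ev_Nth !ev_Cst pP elt_nth. Qed.
End Accessors.

Section Checkers.
Variables (gT : finGroupType) (r : seq gT) (n tb : nat).
Hypotheses (r_enum : enumerates r) (tbP : table_ok r tb).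
Notation V := 'rV[int]_n.
Notation W := (wreath gT n).
Notation vd := (vd n).
Notation elt := (elt r n).
Variable P : nat.
Hypothesis cxP : context r n tb (nthc P 0).
Local Notation R := (md n (nthc P 1)).
Local Notation us := [seq elt u | u <- dec (nthc P 3)].
Local Notation i0 := (nthc P 4).
Local Notation Bs := [seq elt b | b <- dec (nthc P 5)].
Local Notation c := (nthc P 6).
Local Notation A := (posmx us).
Hypothesis AP : md n (nthc P 7) = A.
Local Notation t := (nth 1%g us i0).
Local Notation letter := (letter A Bs).
Local Notation word := (word A Bs).

Implicit Types (p : prog) (e : seq nat).

Lemma elt_Letter p z j e : ev p e = P -> elt (ev (Letter p z j) e) = letter (vd (ev z e)) (ev j e).
Proof.
move=> pP; rewrite /Letter evA /=; set e' := [:: _; _; _].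
have nE : ev (Pn (Var 0)) e' = n by apply: (ev_Pn cxP).
rewrite !elt_Emul // !elt_Esh (@vd_Vopp n) // (@vd_Vm n) // (ev_PA (P := P)) // AP.
by rewrite ev_Nth (ev_PB (P := P)) // elt_nth shV /letter /shc !evV.
Qed.

Definition dec_word (l : nat) : seq (V * nat) := [seq (vd (nthc q 0), nthc q 1) | q <- dec l].

Lemma elt_Letter2 p w e : ev p e = P ->
  elt (ev (Letter2 p w) e) = letter (vd (nthc (ev w e) 0)) (nthc (ev w e) 1).
Proof. by move=> pP; rewrite elt_Letter // !ev_Nth ev_Cst evZ. Qed.

Lemma elt_Word p s e : ev p e = P -> elt (ev (Word p s) e) = word (dec_word (ev s e)).
Proof.
move=> pP; rewrite /Word evA /=; set e' := [:: _; _].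
rewrite elt_Eprod; last exact: (ev_Pn cxP).
rewrite evM codeK evV [nth _ _ _]/= /word /dec_word !big_map.
by apply: eq_bigr => q _; rewrite elt_Letter2 ?evV.
Qed.

Lemma tr_dom_body (f : prog) (rel : rel V) p x y z e :
  ev p e = P ->
  (forall a b e', tr f [:: b, a, ev p e & e'] = rel (vd a) (vd b)) ->
  tr (Call (All (Supp (Pcx (Var 0)) (Var 1))
     (Has (Cat (Supp (Pcx (Var 1)) (Var 3)) (Supp (Pcx (Var 1)) (Var 4))) f)) [:: p; x; y; z]) e <->
  dominated rel (supp2 (elt (ev y e)) (elt (ev z e))) (elt (ev x e)).
Proof.
move=> pP fE; rewrite /tr evA -/(tr _ _) /= tr_All; set e' := [:: _; _; _; _].
have C0 : context r n tb (ev (Pcx (Var 0)) e') by apply: (ctx_Pcx cxP).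
apply: (all_Supp (Q := fun a => exists2 b, supp2 (elt (ev y e)) (elt (ev z e)) b & rel a b) r_enum tbP _ C0) => a.
rewrite tr_Has ev_Cat codeK has_cat.
have C1 : context r n tb (ev (Pcx (Var 1)) (a :: e')) by apply: (ctx_Pcx cxP).
pose Q b := rel (vd a) b : Prop.
have fQ b : tr f (b :: a :: e') <-> Q (vd b) by rewrite fE.
split=> [/orP [/(has_Supp r_enum tbP _ C1 fQ) [b yb]|/(has_Supp r_enum tbP _ C1 fQ) [b zb]]|[b [yb|zb] rab]].
- by exists b => //; left.
- by exists b => //; right.
- by apply/orP; left; apply/(has_Supp r_enum tbP _ C1 fQ); exists b.
- by apply/orP; right; apply/(has_Supp r_enum tbP _ C1 fQ); exists b.
Qed.

Lemma tr_Dominated p x y z e : ev p e = P -> tr (Dominated p x y z) e <->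
  dominated (ple R) (supp2 (elt (ev y e)) (elt (ev z e))) (elt (ev x e)).
Proof.
move=> pP; apply: (tr_dom_body x y z pP) => a b e'.
by rewrite (@tr_Ple n) ?(ev_PR (P := P)) ?evV //; apply: (ev_Pn cxP).
Qed.

Lemma tr_StrictlyDominated p x y z e : ev p e = P -> tr (StrictlyDominated p x y z) e <->
  dominated (prec (ple R)) (supp2 (elt (ev y e)) (elt (ev z e))) (elt (ev x e)).
Proof.
move=> pP; apply: (tr_dom_body x y z pP) => a b e'.
by rewrite tr_Not (@tr_Ple n) ?(ev_PR (P := P)) ?evV //; apply: (ev_Pn cxP).
Qed.

Lemma dec_word_onto (l : seq (V * nat)) : exists a, dec_word a = l.
Proof.
exists (cod [seq cod [:: vcode q.1; q.2] | q <- l]); rewrite /dec_word codeK -map_comp.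
rewrite -[RHS]map_id; apply: eq_map => -[z j] /=.
by rewrite !nthc_cod /= vcodeK.
Qed.

Lemma all_word (l : nat) (Q : W -> Prop) :
  (forall q, q \in dec l -> Q (letter (vd (nthc q 0)) (nthc q 1))) <->
  (forall q, q \in dec_word l -> Q (letter q.1 q.2)).
Proof.
split=> [H _ /mapP [q ql ->] /=|H q ql]; first exact: H.
by apply: (H (vd (nthc q 0), nthc q 1)); apply/mapP; exists q.
Qed.

Definition quot_witness (x y : W) (w : nat) :=
  [/\ y = (x * letter (vd (nthc w 0)) (nthc w 1) * word (dec_word (nthc w 2)))%g,
    dominated (ple R) (supp2 x y) (letter (vd (nthc w 0)) (nthc w 1))
    & forall q, q \in dec_word (nthc w 2) ->
        dominated (prec (ple R)) (supp2 x y) (letter q.1 q.2)].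

Definition conj_witness (x y : W) (w : nat) :=
  (y * x = x * word (dec_word (nthc w 2)))%g /\
  forall q, q \in dec_word (nthc w 2) ->
    dominated (ple R) (fun a => lamp y a != 1%g) (letter q.1 q.2).

Lemma crit_quotP (x y : W) : crit_quot R A Bs x y <-> exists w : nat, quot_witness x y w.
Proof.
split=> [[z [j [l [E dl ds]]]]|[w [E dl ds]]]; last by do 3!eexists; split; eauto.
have [a aE] := dec_word_onto l.
by exists (cod [:: vcode z; j; a]); rewrite /quot_witness !nthc_cod /= vcodeK aE.
Qed.

Lemma crit_conjP (x y : W) : crit_conj R A Bs x y <-> exists w : nat, conj_witness x y w.
Proof.
split=> [[l [E ds]]|[w [E ds]]]; last by eexists; split; eauto.
have [a aE] := dec_word_onto l.
by exists (cod [:: 0%N; 0%N; a]); rewrite /conj_witness !nthc_cod /= aE.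
Qed.

Lemma all_equiv (S : nat -> bool) (Q : nat -> Prop) l : (forall a, S a <-> Q a) ->
  all S l <-> forall a, a \in l -> Q a.
Proof. by move=> SQ; split=> [/allP H a /H /SQ|H]; last by apply/allP => a /H /SQ. Qed.

Lemma has_equiv (S : nat -> bool) (Q : nat -> Prop) l : (forall a, S a <-> Q a) ->
  has S l <-> exists2 a, a \in l & Q a.
Proof.
move=> SQ; split=> [/hasP [a al /SQ Qa]|[a al /SQ Sa]]; first by exists a.
by apply/hasP; exists a.
Qed.

Lemma tr_Quot p x y w e : ev p e = P ->
  tr (Quot p x y w) e <-> quot_witness (elt (ev x e)) (elt (ev y e)) (ev w e).
Proof.
move=> pP; rewrite /Quot /tr evA -/(tr _ _) /=; set e' := [:: _; _; _; _].
have pE : ev (Var 0) e' = P by [].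
have nE : ev (Pn (Var 0)) e' = n by apply: (ev_Pn cxP).
have C0 : context r n tb (ev (Pcx (Var 0)) e') by apply: (ctx_Pcx cxP).
rewrite !tr_And (tr_Eeq r_enum tbP _ _ C0).
rewrite 2!(elt_Emul _ _ _ nE) (elt_Letter2 _ pE) (elt_Word _ pE) ev_Nth ev_Cst.
have D := tr_Dominated (Letter2 (Var 0) (Var 3)) (Var 1) (Var 2) pE.
rewrite (elt_Letter2 _ pE) in D.
have SD : tr (All (Nth (Var 3) (Cst 2)) (StrictlyDominated (Var 1) (Letter2 (Var 1) (Var 0)) (Var 2) (Var 3))) e' <->
   forall q, q \in dec_word (nthc (ev w e) 2) ->
        dominated (prec (ple R)) (supp2 (elt (ev x e)) (elt (ev y e))) (letter q.1 q.2).
  rewrite -(all_word _ (fun u => dominated (prec (ple R)) (supp2 (elt (ev x e)) (elt (ev y e))) u)).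
  rewrite tr_All ev_Nth ev_Cst; apply: all_equiv => q.
  have qE : ev (Var 1) (q :: e') = P by [].
  by have := tr_StrictlyDominated (Letter2 (Var 1) (Var 0)) (Var 2) (Var 3) qE; rewrite (elt_Letter2 _ qE).
split=> [/and3P [/eqP E /D dl /SD ds]|[E /D dl /SD ds]]; first by split.
by apply/and3P; split=> //; apply/eqP.
Qed.

Lemma tr_Conj p x y w e : ev p e = P ->
  tr (Conj p x y w) e <-> conj_witness (elt (ev x e)) (elt (ev y e)) (ev w e).
Proof.
move=> pP; rewrite /Conj /tr evA -/(tr _ _) /=; set e' := [:: _; _; _; _].
have pE : ev (Var 0) e' = P by [].
have nE : ev (Pn (Var 0)) e' = n by apply: (ev_Pn cxP).
have C0 : context r n tb (ev (Pcx (Var 0)) e') by apply: (ctx_Pcx cxP).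
rewrite !tr_And (tr_Eeq r_enum tbP _ _ C0).
rewrite 2!(elt_Emul _ _ _ nE) (elt_Word _ pE) ev_Nth ev_Cst.
have SD : tr (All (Nth (Var 3) (Cst 2)) (Dominated (Var 1) (Letter2 (Var 1) (Var 0)) (Var 3) Zro)) e' <->
   forall q, q \in dec_word (nthc (ev w e) 2) ->
        dominated (ple R) (fun a => lamp (elt (ev y e)) a != 1%g) (letter q.1 q.2).
  rewrite -(all_word _ (fun u => dominated (ple R) (fun a => lamp (elt (ev y e)) a != 1%g) u)).
  rewrite tr_All ev_Nth ev_Cst; apply: all_equiv => q.
  have qE : ev (Var 1) (q :: e') = P by [].
  have := tr_Dominated (Letter2 (Var 1) (Var 0)) (Var 3) Zro qE; rewrite (elt_Letter2 _ qE) evZ elt0 => ->.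
  have s2 a : supp2 (elt (ev y e)) 1%g a <-> lamp (elt (ev y e)) a != 1%g.
    by rewrite /supp2 lamp1 eqxx; split=> [[] //|ya]; left.
  by split=> H b /H [a /s2 ya ba]; exists a.
split=> [/andP [/eqP E /SD ds]|[E /SD ds]]; first by split.
by apply/andP; split=> //; apply/eqP.
Qed.

Lemma tr_Pair p ws x y e : ev p e = P -> tr (Pair p ws x y) e <->
  (exists2 w : nat, w \in dec (ev ws e) & quot_witness (elt (ev x e)) (elt (ev y e)) w) /\
  (exists2 w : nat, w \in dec (ev ws e) & conj_witness (elt (ev x e)) (elt (ev y e)) w).
Proof.
move=> pP; rewrite /Pair /tr evA -/(tr _ _) /=; set e' := [:: _; _; _; _].
rewrite tr_And !tr_Has !evV [nth _ _ _]/=.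
have pE (a : nat) : ev (Var 1) (a :: e') = P by [].
split=> [/andP []|[Hq Hc]].
  by split; [apply/(has_equiv _ (fun a => tr_Quot (Var 3) (Var 4) (Var 0) (pE a)))
            |apply/(has_equiv _ (fun a => tr_Conj (Var 3) (Var 4) (Var 0) (pE a)))].
by apply/andP; split; [apply/(has_equiv _ (fun a => tr_Quot (Var 3) (Var 4) (Var 0) (pE a)))
            |apply/(has_equiv _ (fun a => tr_Conj (Var 3) (Var 4) (Var 0) (pE a)))].
Qed.

Definition boxes (C : nat) := dec (ev (Box (Var 0) (Var 1)) [:: n; C]).
Lemma ev_Box nn C e : ev nn e = n -> dec (ev (Box nn C) e) = boxes (ev C e).
Proof. by move=> en; rewrite /boxes /Box !evA /= en. Qed.
Lemma mem_boxes (C : nat) : (forall a, a \in boxes C -> box C (vd a)) /\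
  forall z : V, box C z -> exists2 a, a \in boxes C & vd a = z.
Proof. exact: (@BoxP n (Var 0) (Var 1) [:: n; C] erefl). Qed.

Lemma ev_indices p e : ev p e = P ->
  dec (ev (Iota (Suc (Size (PB p)))) e) = iota 0 (size Bs).+1.
Proof. by move=> pP; rewrite ev_Iota codeK evS ev_Size (ev_PB pP) size_map. Qed.

(** All indices past the end denote the trivial letter, so testing the indices up to and including
    [size Bs] covers all of them. *)
Lemma letter_minn z j : letter z (minn j (size Bs)) = letter z j.
Proof.
by have [//|le_j] := ltnP j (size Bs); rewrite !letter_default.
Qed.

Definition pair_ok (l : nat) (x y : W) :=
  (exists2 w : nat, w \in dec l & quot_witness x y w) /\
  (exists2 w : nat, w \in dec l & conj_witness x y w).

Lemma tr_Pair_val p ws x y e X Y : ev p e = P -> elt (ev x e) = X -> elt (ev y e) = Y ->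
  tr (Pair p ws x y) e <-> pair_ok (ev ws e) X Y.
Proof. by move=> pP <- <-; apply: tr_Pair. Qed.

Lemma tr_Pairs p ws e : ev p e = P -> tr (Pairs p ws) e <->
  forall a, a \in boxes c -> forall b, b \in boxes c ->
  forall i, i \in iota 0 (size Bs).+1 -> forall j, j \in iota 0 (size Bs).+1 ->
    pair_ok (ev ws e) (letter (vd a) i) (letter (vd b) j).
Proof.
move=> pP; rewrite /Pairs /tr evA -/(tr _ _) /=; set e' := [:: _; _].
have pE0 : ev (Var 0) e' = P by [].
rewrite tr_All (ev_Box _ (ev_Pn cxP pE0)) (ev_Pc pE0); apply: all_equiv => a.
have pE1 : ev (Var 1) (a :: e') = P by [].
rewrite tr_All (ev_Box _ (ev_Pn cxP pE1)) (ev_Pc pE1); apply: all_equiv => b.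
have pE2 : ev (Var 2) (b :: a :: e') = P by [].
rewrite tr_All (ev_indices pE2); apply: all_equiv => i.
have pE3 : ev (Var 3) (i :: b :: a :: e') = P by [].
rewrite tr_All (ev_indices pE3); apply: all_equiv => j.
have pE4 : ev (Var 4) [:: j, i, b, a & e'] = P by [].
have E1 := elt_Letter (Var 3) (Var 1) pE4; have E2 := elt_Letter (Var 2) (Var 0) pE4.
exact: (tr_Pair_val (Var 5) pE4 E1 E2).
Qed.

Lemma pairs_sound p ws e : ev p e = P -> tr (Pairs p ws) e ->
  forall (z1 z2 : V) (j1 j2 : nat), box c z1 -> box c z2 ->
  crit_quot R A Bs (letter z1 j1) (letter z2 j2) /\ crit_conj R A Bs (letter z1 j1) (letter z2 j2).
Proof.
move=> pP /(tr_Pairs _ pP) H z1 z2 j1 j2.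
have [_ onto] := mem_boxes c => /onto [a ac <-] /onto [b bc <-].
have idx j : minn j (size Bs) \in iota 0 (size Bs).+1 by rewrite mem_iota add0n ltnS geq_minr.
have [] := H a ac b bc _ (idx j1) _ (idx j2); rewrite !letter_minn => -[w _ Hq] [w' _ Hc].
by split; [apply/crit_quotP; exists w|apply/crit_conjP; exists w'].
Qed.

(** The boxes are finite, so the witnesses for all pairs and for both kinds of identity fit in one
    list, which the program searches for each pair. *)
Lemma pairs_complete :
  (forall (z1 z2 : V) (j1 j2 : nat), box c z1 -> box c z2 ->
    crit_quot R A Bs (letter z1 j1) (letter z2 j2) /\ crit_conj R A Bs (letter z1 j1) (letter z2 j2)) ->
  exists l : nat, forall p ws e, ev p e = P -> ev ws e = l -> tr (Pairs p ws) e.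
Proof.
move=> H; have [inb _] := mem_boxes c.
pose I := iota 0 (size Bs).+1.
pose L := [seq (ab, ij) | ab <- [seq (a, b) | a <- boxes c, b <- boxes c], ij <- [seq (i, j) | i <- I, j <- I]].
pose x (q : nat * nat * (nat * nat)) := letter (vd q.1.1) q.2.1.
pose y (q : nat * nat * (nat * nat)) := letter (vd q.1.2) q.2.2.
have exq q : q \in L -> exists ww : nat * nat, quot_witness (x q) (y q) ww.1 /\ conj_witness (x q) (y q) ww.2.
  move=> /allpairsP [[ab ij] [/allpairsP [[a b] [/inb ba /inb bb ->]] _ ->]] /=.
  have [/crit_quotP [w Hw] /crit_conjP [w' Hw']] := H _ _ ij.1 ij.2 ba bb.
  by exists (w, w').
have [l [_ Hl _]] := seq_choice exq.
exists (cod (map fst l ++ map snd l)) => p ws e pP wsE; apply/(tr_Pairs _ pP) => a ac b bc i iI j jI; rewrite {}wsE.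
have qL : (a, b, (i, j)) \in L by apply: allpairs_f; apply: allpairs_f.
have {Hl} := Hl _ qL; rewrite /pair_ok codeK; elim: l => [/List.Exists_nil //|ww l IH].
case/List.Exists_cons => [[Hq Hc]|/IH [[w wl Hq] [w' wl' Hc]]].
  split; [exists ww.1|exists ww.2] => //=; first by rewrite mem_head.
  by rewrite inE mem_cat inE eqxx !orbT.
split; [exists w|exists w'] => //; move: wl wl'; rewrite !mem_cat /= !inE.
  by move=> /orP [->|->] _; rewrite !orbT.
by move=> _ /orP [->|->]; rewrite !orbT.
Qed.

Lemma zd_Coord p v i e : ev p e = P -> zd (ev (Coord p v i) e) = cr R (vd (ev v e)) (ev i e).
Proof.
move=> pP; have nE := ev_Pn cxP pP.
rewrite /Coord ev_Nth; have [lt_in|le_ni] := ltnP (ev i e) n.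
  by rewrite /cr -(ev_PR pP) -(@vd_Vm n _ v _ _ nE) co_vd.
rewrite /cr co_ge // /Vm evA /= evM ev_Iota evV [nth _ _ _]/= nE codeK.
by rewrite nthc_cod nth_default // size_map size_iota.
Qed.

Lemma tr_Zlt_val a b e u v : zd (ev a e) = u -> zd (ev b e) = v -> tr (Zlt a b) e = (u < v).
Proof. by rewrite tr_Zlt => -> ->. Qed.

Lemma tr_Eqn_val a b e u v : ev a e = u -> ev b e = v -> tr (Eqn a b) e = (u == v).
Proof. by rewrite tr_Eqn => -> ->. Qed.

Lemma tr_Far p y e : ev p e = P -> tr (Far p y) e <-> far (fun a => cr R a i0) t (elt (ev y e)).
Proof.
move=> pP; rewrite /Far /tr evA -/(tr _ _) /=; set e' := [:: _; _].
have pE0 : ev (Var 0) e' = P by [].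
have C0 : context r n tb (ev (Pcx (Var 0)) e') by apply: (ctx_Pcx cxP).
rewrite tr_And (@tr_Veq n) ?(ev_Pn cxP pE0) // ev_Nth ev_Cst evV -(pos_elt r) evZ vd0 tr_All.
have Q a : all (fun b => tr (Zlt (Coord (Var 2) (Var 0) (Pi0 (Var 2))) (Coord (Var 2) (Var 1) (Pi0 (Var 2)))) [:: b, a & e'])
     (dec (ev (Supp (Pcx (Var 1)) (Pt (Var 1))) (a :: e'))) <->
     forall b, lamp t b != 1%g -> cr R b i0 < cr R (vd a) i0.
  have pE1 : ev (Var 1) (a :: e') = P by [].
  have C1 : context r n tb (ev (Pcx (Var 1)) (a :: e')) by apply: (ctx_Pcx cxP).
  rewrite -(elt_Pt r n pE1).
  apply: (all_Supp (Q := fun b => cr R b i0 < cr R (vd a) i0) r_enum tbP _ C1) => b.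
  have pE2 : ev (Var 2) [:: b, a & e'] = P by [].
  have E0 := zd_Coord (Var 0) (Pi0 (Var 2)) pE2; have E1 := zd_Coord (Var 1) (Pi0 (Var 2)) pE2.
  by rewrite (tr_Zlt_val E0 E1) (ev_Pi0 pE2).
have Q2 a : tr (All (Supp (Pcx (Var 1)) (Pt (Var 1)))
     (Zlt (Coord (Var 2) (Var 0) (Pi0 (Var 2))) (Coord (Var 2) (Var 1) (Pi0 (Var 2))))) (a :: e') <->
     forall b, lamp t b != 1%g -> cr R b i0 < cr R (vd a) i0 by rewrite tr_All.
have Q3 := all_Supp (Q := fun a => forall b, lamp t b != 1%g -> cr R b i0 < cr R a i0) r_enum tbP (Var 1) C0 Q2.
split=> [/andP [/eqP py /Q3 H]|[py H]]; first by split=> // a b ya tb'; apply: H.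
by apply/andP; split; [apply/eqP|apply/Q3 => a ya b tb'; apply: H].
Qed.

Definition twist_witness (x y : W) (k : nat) :=
  (t ^+ nthc k 0 * x)%g = (word (dec_word (nthc k 1)) * (t ^+ nthc k 0 * y))%g /\
  far (fun a => cr R a i0) t (word (dec_word (nthc k 1))).

(** The tail [m] of the witness is left free because the generator check stores two lists of
    exponents behind it, at entries 2 and 3. *)
Lemma twist_equalP (x y : W) : twist_equal R us i0 Bs x y <-> exists N l, forall m, twist_witness x y (cod [:: N, l & m]).
Proof.
split=> [[N [q [E f]]]|[N [l /(_ [::]) [E f]]]]; last by do 2!eexists; split; eauto.
have [l lE] := dec_word_onto q.
by exists N, l => m; rewrite /twist_witness !nthc_cod /= lE.
Qed.

Lemma twist_witness_sound (x y : W) k : twist_witness x y k -> twist_equal R us i0 Bs x y.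
Proof. by case=> E f; do 2!eexists; split; eauto. Qed.

Lemma tr_TwistEq p x y k e : ev p e = P -> tr (TwistEq p x y k) e <-> twist_witness (elt (ev x e)) (elt (ev y e)) (ev k e).
Proof.
move=> pP; rewrite /TwistEq /tr evA -/(tr _ _) /=; set e' := [:: _; _; _; _].
have pE : ev (Var 0) e' = P by [].
have nE := ev_Pn cxP pE.
have C0 : context r n tb (ev (Pcx (Var 0)) e') by apply: (ctx_Pcx cxP).
rewrite tr_And (tr_Eeq r_enum tbP _ _ C0) 3!(elt_Emul _ _ _ nE) !(elt_Epow _ _ _ nE) (elt_Pt r n pE).
rewrite (elt_Word _ pE) !ev_Nth ev_Cst evZ.
have F := tr_Far (Word (Var 0) (Nth (Var 3) (Cst 1))) pE.
rewrite (elt_Word _ pE) ev_Nth ev_Cst in F.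
by split=> [/andP [/eqP E /F f]|[E /F f]]; [split|apply/andP; split=> //; apply/eqP].
Qed.

Lemma tr_Upto p a x e : ev p e = P -> tr (Upto p a x) e <->
  forall b, lamp (elt (ev x e)) b != 1%g -> ple R b (vd (ev a e)).
Proof.
move=> pP; rewrite /Upto /tr evA -/(tr _ _) /=; set e' := [:: _; _; _].
have C0 : context r n tb (ev (Pcx (Var 0)) e') by apply: (ctx_Pcx cxP).
rewrite tr_All.
apply: (all_Supp (Q := fun b => ple R b (vd (ev a e))) r_enum tbP _ C0) => b.
have pE : ev (Var 1) (b :: e') = P by [].
by rewrite (@tr_Ple n) ?(ev_Pn cxP pE) // (ev_PR pE).
Qed.

Definition irreducible_at (y : W) (a : V) (C : nat) :=
  [/\ pos y = 0, lamp y a != 1%g, upto (ple R) a y,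
      forall i, (i < n)%N -> `|cr R a i| + c%:Z <= C%:Z
    & forall z j, box C z -> ~ (upto (ple R) a (letter z j) /\ lamp (letter z j) a = lamp y a)].

Lemma tr_Irreducible p y a C e : ev p e = P -> (forall j, pos (nth 1%g Bs j) = 0) ->
  tr (Irreducible p y a C) e <-> irreducible_at (elt (ev y e)) (vd (ev a e)) (ev C e).
Proof.
move=> pP Bs0; rewrite /Irreducible /tr evA -/(tr _ _) /=; set e' := [:: _; _; _; _].
have pE : ev (Var 0) e' = P by [].
have nE := ev_Pn cxP pE.
have C0 : context r n tb (ev (Pcx (Var 0)) e') by apply: (ctx_Pcx cxP).
have U := tr_Upto (Var 2) (Var 1) pE.
rewrite 4!tr_And (@tr_Veq n) // ev_Nth ev_Cst -(pos_elt r) evZ vd0.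
rewrite tr_Not tr_Eqn (ev_Lval r_enum tbP _ _ C0) (ev_Ce C0).
have iinj := index_inj_enum r_enum.
rewrite (inj_eq iinj).
have B1 : tr (All (Iota (Pn (Var 0))) (Leq (Add (Zabs (Coord (Var 1) (Var 3) (Var 0))) (Pc (Var 1))) (Var 4))) e' <->
    forall i, i \in iota 0 n -> `|cr R (vd (ev a e)) i| + c%:Z <= (ev C e)%:Z.
  rewrite tr_All ev_Iota codeK nE; apply: all_equiv => i.
  have pE1 : ev (Var 1) (i :: e') = P by [].
  rewrite tr_Leq ev_Add ev_Zabs (zd_Coord (Var 3) (Var 0) pE1) (ev_Pc pE1) -lez_nat PoszD abszE.
  by split.
have B2 : tr (All (Box (Pn (Var 0)) (Var 3)) (All (Iota (Suc (Size (PB (Var 1)))))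
          (Not (And (Upto (Var 2) (Var 4) (Letter (Var 2) (Var 1) (Var 0)))
             (Eqn (Lval (Pcx (Var 2)) (Letter (Var 2) (Var 1) (Var 0)) (Var 4))
                  (Lval (Pcx (Var 2)) (Var 3) (Var 4))))))) e' <->
   forall z, z \in boxes (ev C e) -> forall j, j \in iota 0 (size Bs).+1 ->
     ~ (upto (ple R) (vd (ev a e)) (letter (vd z) j) /\
        lamp (letter (vd z) j) (vd (ev a e)) = lamp (elt (ev y e)) (vd (ev a e))).
  rewrite tr_All (ev_Box _ nE); apply: all_equiv => z.
  have pE1 : ev (Var 1) (z :: e') = P by [].
  rewrite tr_All (ev_indices pE1); apply: all_equiv => j.
  have pE2 : ev (Var 2) [:: j, z & e'] = P by [].
  have C2 : context r n tb (ev (Pcx (Var 2)) [:: j, z & e']) by apply: (ctx_Pcx cxP).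
  have L1 := ev_Lval r_enum tbP (Letter (Var 2) (Var 1) (Var 0)) (Var 4) C2.
  rewrite (elt_Letter _ _ pE2) in L1.
  have L2 := ev_Lval r_enum tbP (Var 3) (Var 4) C2.
  rewrite tr_Not tr_And (tr_Eqn_val L1 L2) (inj_eq iinj).
  have U2 := tr_Upto (Var 4) (Letter (Var 2) (Var 1) (Var 0)) pE2.
  rewrite (elt_Letter _ _ pE2) in U2.
  have up (x : W) : pos x = 0 -> upto (ple R) (vd (ev a e)) x <-> 
      forall b, lamp x b != 1%g -> ple R b (vd (ev a e)) by move=> px; split=> [[]|].
  have pl : pos (letter (vd z) j) = 0 by apply: pos_letter.
  split=> [/negP H [/(up _ pl)/U2 u E]|H]; first by apply: H; rewrite u E eqxx.
  by apply/negP => /andP [/U2 u /eqP E]; apply: H; split=> //; apply/(up _ pl).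
have [inb onto] := mem_boxes (ev C e).
split=> [/and5P [/eqP py ya /U u /B1 b1 /B2 b2]|[py ya [_ u] b1 b2]].
  split=> // [i lt_in|z j /onto [v vC <-]]; first by apply: b1; rewrite mem_iota.
  have := b2 v vC (minn j (size Bs)); rewrite letter_minn; apply.
  by rewrite mem_iota add0n ltnS geq_minr.
apply/and5P; split=> //; first exact/eqP.
- exact/U.
- by apply/B1 => i; rewrite mem_iota => /andP [_ lt_in]; apply: b1.
- by apply/B2 => z /inb bz j _; apply: b2.
Qed.

Definition not_twist_witness (x y : W) (k : nat) :=
  [/\ (t ^+ nthc k 0 * x)%g =
         (word (dec_word (nthc k 1)) * elt (nthc k 2) * (t ^+ nthc k 0 * y))%g,
      far (fun a => cr R a i0) t (word (dec_word (nthc k 1)) * elt (nthc k 2))%g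
    & irreducible_at (elt (nthc k 2)) (vd (nthc k 3)) (nthc k 4)].

(** Again the tail is free; the exponents are read from the two entries behind the first five. *)
Lemma not_twist_equalP (x y : W) : not_twist_equal R us i0 Bs c x y <->
  exists2 l, size l = 5 & forall m, not_twist_witness x y (cod (l ++ m)).
Proof.
split=> [[N [q [x0 [E f [a [C irr]]]]]]|[l _ /(_ [::]) [E f irr]]]; last by do 3!eexists; split; eauto; do 2!eexists; eauto.
have [l lE] := dec_word_onto q; have [x0c x0E] := elt_onto r_enum x0.
exists [:: N; l; x0c; vcode a; C] => // m.
by rewrite /not_twist_witness !nthc_cod /= lE x0E vcodeK; split.
Qed.

Lemma tr_NotTwistEq p x y k e : ev p e = P -> (forall j, pos (nth 1%g Bs j) = 0) ->
  tr (NotTwistEq p x y k) e <-> not_twist_witness (elt (ev x e)) (elt (ev y e)) (ev k e).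
Proof.
move=> pP Bs0; rewrite /NotTwistEq /tr evA -/(tr _ _) /=; set e' := [:: _; _; _; _].
have pE : ev (Var 0) e' = P by [].
have nE := ev_Pn cxP pE.
have C0 : context r n tb (ev (Pcx (Var 0)) e') by apply: (ctx_Pcx cxP).
rewrite 2!tr_And (tr_Eeq r_enum tbP _ _ C0) 4!(elt_Emul _ _ _ nE) !(elt_Epow _ _ _ nE) (elt_Pt r n pE).
rewrite (elt_Word _ pE) !ev_Nth !ev_Cst evZ.
have F := tr_Far (Emul (Pn (Var 0)) (Word (Var 0) (Nth (Var 3) (Cst 1))) (Nth (Var 3) (Cst 2))) pE.
rewrite (elt_Emul _ _ _ nE) (elt_Word _ pE) !ev_Nth !ev_Cst in F.
have I := tr_Irreducible (Nth (Var 3) (Cst 2)) (Nth (Var 3) (Cst 3)) (Nth (Var 3) (Cst 4)) pE Bs0.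
rewrite !ev_Nth !ev_Cst in I.
split=> [/and3P [/eqP E /F f /I i]|[E /F f /I i]]; first by split.
by apply/and3P; split=> //; apply/eqP.
Qed.

Definition outside_witness (h : W) (f : nat) :=
  (nthc f 0 < n)%N /\ let dd := nthc (nthc P 2) (nthc f 0) in let z := cr R (pos h) (nthc f 0) in
  (dd = 0%N /\ z <> 0) \/
  [/\ z = dd%:Z * zd (nthc f 1) + (nthc f 2)%:Z, (0 < nthc f 2)%N & (nthc f 2 < dd)%N].

Lemma outside_latticeP (h : W) :
  outside_lattice R (nthc (nthc P 2)) h <-> exists l, forall m, outside_witness h (cod (l ++ m)).
Proof.
split=> [[i lt_in H]|[l /(_ [::]) [lt_in H]]].
  case: H => [H|[q [s [E s0 sd]]]].
    by exists [:: i; 0%N; 0%N] => m; split; rewrite !nthc_cod //=; left.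
  by exists [:: i; int_code q; s] => m; split; rewrite !nthc_cod //= int_codeK; right.
by exists (nthc (cod (l ++ [::])) 0) => //; case: H => [H|[E s0 sd]]; [left|right; do 2!eexists; split; eauto].
Qed.

#[local] Opaque Zeq Eqn.
Lemma tr_Outside p h f e : ev p e = P -> tr (Outside p h f) e <-> outside_witness (elt (ev h e)) (ev f e).
Proof.
move=> pP; rewrite /Outside /tr evA -/(tr _ _) /=; set e' := [:: _; _; _].
have pE : ev (Var 0) e' = P by [].
have nE := ev_Pn cxP pE.
have Z := zd_Coord (Epos (Var 1)) (Nth (Var 2) Zro) pE.
rewrite [ev (Epos _) _]ev_Nth -(pos_elt r) ev_Nth evZ in Z.
have dE : ev (Nth (Pd (Var 0)) (Nth (Var 2) Zro)) e' = nthc (nthc P 2) (nthc (ev f e) 0).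
  by rewrite !ev_Nth ev_Cst pE.
have E1 : tr (Zeq (Coord (Var 0) (Epos (Var 1)) (Nth (Var 2) Zro)) Zro) e' =
     (cr R (pos (elt (ev h e))) (nthc (ev f e) 0) == 0).
  by rewrite tr_Zeq Z.
have E2 : tr (Zeq (Coord (Var 0) (Epos (Var 1)) (Nth (Var 2) Zro)) 
      (Zadd (Zmul (Znat (Nth (Pd (Var 0)) (Nth (Var 2) Zro))) (Nth (Var 2) (Cst 1))) (Znat (Nth (Var 2) (Cst 2))))) e' =
     (cr R (pos (elt (ev h e))) (nthc (ev f e) 0) ==
       (nthc (nthc P 2) (nthc (ev f e) 0))%:Z * zd (nthc (ev f e) 1) + (nthc (ev f e) 2)%:Z).
  by rewrite tr_Zeq Z ev_Zadd ev_Zmul !int_codeK !zd_Znat dE !ev_Nth !ev_Cst.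
have E3 : tr (Eqn (Nth (Pd (Var 0)) (Nth (Var 2) Zro)) Zro) e' = (nthc (nthc P 2) (nthc (ev f e) 0) == 0%N).
  by rewrite tr_Eqn dE.
have E4 : tr (Ltn (Nth (Var 2) (Cst 2)) (Nth (Pd (Var 0)) (Nth (Var 2) Zro))) e' =
   (nthc (ev f e) 2 < nthc (nthc P 2) (nthc (ev f e) 0))%N.
  by rewrite tr_Ltn dE ev_Nth ev_Cst.
rewrite tr_And tr_Or 3!tr_And tr_Not E1 E2 E3 E4 !tr_Ltn nE !ev_Nth ev_Cst evZ.
split=> [/andP [lt_in /orP [/andP [/eqP d0 /eqP nz]|/and3P [/eqP E s0 sd]]]|[lt_in [[d0 nz]|[E s0 sd]]]].
- by split=> //; left.
- by split=> //; right.
- by apply/andP; split=> //; apply/orP; left; apply/andP; split; apply/eqP.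
- by apply/andP; split=> //; apply/orP; right; apply/and3P; split=> //; apply/eqP.
Qed.
End Checkers.

Lemma tr_Call f args e : tr (Call f args) e = tr f [seq ev a e | a <- args]. Proof. by []. Qed.
Lemma tr_AndP a b e (A B : Prop) : (tr a e <-> A) -> (tr b e <-> B) -> tr (And a b) e <-> A /\ B.
Proof. by move=> [a1 a2] [b1 b2]; rewrite tr_And; split=> [/andP []|[]] *; [split|apply/andP; split]; auto. Qed.
(** The meaning of the second test may depend on the first: exponent vectors are read correctly only
    if [us] has length [n], and irreducibility only if the letters have position 0. *)
Lemma tr_AndD a b e (A B : Prop) : (tr a e <-> A) -> (A -> tr b e <-> B) -> tr (And a b) e <-> A /\ B.
Proof.
move=> [a1 a2] H; rewrite tr_And.
by split=> [/andP [/a1 HA /(H HA)]|[HA /(H HA) HB]]; [split|rewrite a2].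
Qed.
Lemma tr_OrP a b e (A B : Prop) : (tr a e <-> A) -> (tr b e <-> B) -> tr (Or a b) e <-> A \/ B.
Proof.
move=> [a1 a2] [b1 b2]; rewrite tr_Or.
by split=> [/orP [/a1|/b1]|[/a2|/b2]] H; first [by left|by right|by rewrite H ?orbT].
Qed.
Lemma tr_AllP l f e (Q : nat -> Prop) : (forall a, tr f (a :: e) <-> Q a) ->
  tr (All l f) e <-> forall a, a \in dec (ev l e) -> Q a.
Proof. by rewrite tr_All => H; apply: all_equiv. Qed.
Lemma tr_HasP l f e (Q : nat -> Prop) : (forall a, tr f (a :: e) <-> Q a) ->
  tr (Has l f) e <-> exists2 a, a \in dec (ev l e) & Q a.
Proof. by rewrite tr_Has => H; apply: has_equiv. Qed.
Lemma tr_AllN l f e m (Q : nat -> Prop) : ev l e = m ->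
  (forall i, (i < m)%N -> tr f (i :: e) <-> Q i) ->
  tr (All (Iota l) f) e <-> forall i, (i < m)%N -> Q i.
Proof.
move=> lm H; rewrite tr_All ev_Iota codeK lm; split=> [/allP A i im|A].
  by apply/H => //; apply: A; rewrite mem_iota.
by apply/allP => i; rewrite mem_iota => /andP [_ im]; apply/H => //; apply: A.
Qed.

(** * Checking all parts of a separating certificate *)

Definition Posmx us := Map us (Epos (Var 0)).

(** The inverse matrix [ri] is supplied by the certificate, so invertibility needs only one product.
    [Cst 2] is the code of the integer 1. *)
Definition BasisChk p ri := Call (And
  (All (Iota (Pn (Var 0))) (All (Iota (Pn (Var 1)))
    (Zeq (Nth (Vm (Pn (Var 2)) (Nth (PR (Var 2)) (Var 1)) (Var 3)) (Var 0))
       (If (Eqn (Var 1) (Var 0)) (Cst 2) Zro))))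
  (Eqn (Size (Pus (Var 0))) (Pn (Var 0)))) [:: p; ri].
Definition DiagonalChk p := Call (All (Iota (Pn (Var 0))) (All (Iota (Pn (Var 1)))
    (Zeq (Coord (Var 2) (Epos (Nth (Pus (Var 2)) (Var 1))) (Var 0))
       (If (Eqn (Var 1) (Var 0)) (Znat (Nth (Pd (Var 2)) (Var 1))) Zro)))) [:: p].
Definition TrivialChk p := Call (All (Iota (Pn (Var 0))) (Or (Ltn Zro (Nth (Pd (Var 1)) (Var 0)))
  (Eeq (Pcx (Var 1)) (Nth (Pus (Var 1)) (Var 0)) Zro))) [:: p].
Definition AxisChk p := Call (Or (And (Ltn (Pi0 (Var 0)) (Pn (Var 0))) (Ltn Zro (Nth (Pd (Var 0)) (Pi0 (Var 0)))))
  (And (All (Iota (Pn (Var 0))) (Eqn (Nth (Pd (Var 1)) (Var 0)) Zro))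
       (Eeq (Pcx (Var 0)) (Pt (Var 0)) Zro))) [:: p].
Definition LettersChk p := Call (And (Ltn Zro (Pc (Var 0)))
  (All (PB (Var 0)) (And (Veq (Pn (Var 1)) (Epos (Var 0)) Zro)
    (All (Supp (Pcx (Var 1)) (Var 0)) (All (Iota (Pn (Var 2)))
       (Leq (Add (Mul (Cst 5) (Zabs (Coord (Var 3) (Var 1) (Var 0)))) (Cst 1)) (Pc (Var 3)))))))) [:: p].
Definition CommuteChk p ks := Call (All (Iota (Pn (Var 0))) (All (Iota (Pn (Var 1)))
  (Has (Var 3) (TwistEq (Var 3) (Emul (Pn (Var 3)) (Nth (Pus (Var 3)) (Var 2)) (Nth (Pus (Var 3)) (Var 1)))
     (Emul (Pn (Var 3)) (Nth (Pus (Var 3)) (Var 1)) (Nth (Pus (Var 3)) (Var 2))) (Var 0))))) [:: p; ks].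
Definition GeneratorsChk p hs ks := Call (All (Var 1) (Has (Var 3)
  (TwistEq (Var 2) (Emul (Pn (Var 2)) (Epows (Pn (Var 2)) (Pus (Var 2)) (Nth (Var 0) (Cst 2))) (Var 1))
     (Epows (Pn (Var 2)) (Pus (Var 2)) (Nth (Var 0) (Cst 3))) (Var 0)))) [:: p; hs; ks].
Definition TargetChk p h f := Call (Or (Outside (Var 0) (Var 1) (Var 2))
  (NotTwistEq (Var 0) (Emul (Pn (Var 0)) (Epows (Pn (Var 0)) (Pus (Var 0)) (Nth (Var 2) (Cst 5))) (Var 1))
     (Epows (Pn (Var 0)) (Pus (Var 0)) (Nth (Var 2) (Cst 6))) (Var 2))) [:: p; h; f].

Section Certificate_checks.
Variables (gT : finGroupType) (r : seq gT) (n tb : nat).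
Hypotheses (r_enum : enumerates r) (tbP : table_ok r tb).
Notation V := 'rV[int]_n.
Notation W := (wreath gT n).
Notation vd := (vd n).
Notation elt := (elt r n).

Lemma md_Posmx us e : md n (ev (Posmx us) e) = posmx [seq elt u | u <- dec (ev us e)].
Proof.
apply/row_matrixP => i; rewrite md_row evM nthc_cod.
have -> : row i (posmx [seq elt u | u <- dec (ev us e)]) = pos (nth 1%g [seq elt u | u <- dec (ev us e)] i).
  by apply/rowP => j; rewrite !mxE.
have [lt_i|le_i] := ltnP i (size (dec (ev us e))); last first.
  by rewrite !nth_default ?size_map // vd0.
by rewrite !(nth_map 0%N) // ev_Nth ev_Cst evV pos_elt.
Qed.

Variable P : nat.
Hypothesis cxP : context r n tb (nthc P 0).
Local Notation R := (md n (nthc P 1)).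
Local Notation d := (nthc (nthc P 2)).
Local Notation us := [seq elt u | u <- dec (nthc P 3)].
Local Notation i0 := (nthc P 4).
Local Notation Bs := [seq elt b | b <- dec (nthc P 5)].
Local Notation c := (nthc P 6).
Local Notation A := (posmx us).
Hypothesis AP : md n (nthc P 7) = A.
Local Notation t := (nth 1%g us i0).
Implicit Types (p : prog) (e : seq nat).

Lemma ev_Pus p e : ev p e = P -> ev (Pus p) e = nthc P 3.
Proof. by move=> pP; rewrite ev_Nth ev_Cst pP. Qed.
Lemma ev_Pd p e i : ev p e = P -> ev (Nth (Pd p) i) e = d (ev i e).
Proof. by move=> pP; rewrite !ev_Nth ev_Cst pP. Qed.
Lemma elt_Pus p e i : ev p e = P -> elt (ev (Nth (Pus p) i) e) = nth 1%g us (ev i e).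
Proof. by move=> pP; rewrite ev_Nth (ev_Pus pP) elt_nth. Qed.

Lemma tr_BasisChk p ri e : ev p e = P ->
  tr (BasisChk p ri) e <-> R *m md n (ev ri e) = 1%:M /\ size us = n.
Proof.
move=> pP; rewrite /BasisChk tr_Call /=; set e' := [:: _; _].
have nE := ev_Pn cxP (pP : ev (Var 0) e' = P).
apply: tr_AndP; last first.
  rewrite tr_Eqn nE ev_Size (ev_Pus (pP : ev (Var 0) e' = P)) size_map.
  by split=> /eqP.
have H i j : (i < n)%N -> (j < n)%N -> tr (Zeq (Nth (Vm (Pn (Var 2)) (Nth (PR (Var 2)) (Var 1)) (Var 3)) (Var 0))
       (If (Eqn (Var 1) (Var 0)) (Cst 2) Zro)) [:: j, i & e'] <->
      co (vd (nthc (nthc P 1) i) *m md n (ev ri e)) j = (i == j)%:Z.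
  move=> lt_in lt_jn; have p2 : ev (Var 2) [:: j, i & e'] = P by [].
  rewrite tr_Zeq ev_Nth ev_If tr_Eqn ev_Cst evZ !evV [nth _ _ _]/=.
  rewrite -(@co_vd n) // (@vd_Vm n _ _ _ _ (ev_Pn cxP p2)) ev_Nth (ev_PR p2) evV.
  rewrite [nth 0%N [:: j, i & e'] 1]/=.
  have -> : zd (if i == j then 2 else 0)%N = (i == j)%:Z by case: (i == j).
  by split=> /eqP.
rewrite (tr_AllN nE (Q := fun i => forall j, (j < n)%N -> co (vd (nthc (nthc P 1) i) *m md n (ev ri e)) j = (i == j)%:Z)).
  split=> [HR|E i lt_in j lt_jn].
    apply/matrixP => i j; have := HR i (ltn_ord i) j (ltn_ord j).
    by rewrite co_ord -md_row -row_mul !mxE => ->; case: eqP => [/val_inj ->|ne]; rewrite ?eqxx //; case: eqP => // ij; case: ne; rewrite ij.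
  rewrite -[i]/(val (Ordinal lt_in)) -md_row -row_mul E (co_ord _ (Ordinal lt_jn)) !mxE.
  by rewrite -val_eqE /=; case: eqP.
move=> i lt_in; apply: (tr_AllN (m := n)); first exact: (ev_Pn cxP).
by move=> j lt_jn; apply: H.
Qed.

Lemma tr_DiagonalChk p e : ev p e = P -> tr (DiagonalChk p) e <-> forall i, (i < n)%N -> forall j, (j < n)%N ->
       cr R (pos (nth 1%g us i)) j = if i == j then (d i)%:Z else 0.
Proof.
move=> pP; rewrite /DiagonalChk tr_Call /=; set e' := [:: _].
have nE := ev_Pn cxP (pP : ev (Var 0) e' = P).
apply: (tr_AllN nE) => i lt_in.
apply: (tr_AllN (ev_Pn cxP (pP : ev (Var 1) (i :: e') = P))) => j lt_jn.
have p2 : ev (Var 2) [:: j, i & e'] = P by [].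
rewrite tr_Zeq (zd_Coord cxP _ _ p2) ev_Nth ev_Cst -(pos_elt r) (elt_Pus _ p2) !evV ev_If tr_Eqn !evV evZ.
have dE := zd_Znat (Nth (Pd (Var 2)) (Var 1)) [:: j, i & e'].
rewrite (ev_Pd _ p2) evV in dE.
rewrite [nth 0%N _ 0]/= [nth 0%N [:: j, i & e'] 1]/=.
case: ifP => _; last by split=> /eqP.
by rewrite dE; split=> /eqP.
Qed.

Lemma tr_TrivialChk p e : ev p e = P -> tr (TrivialChk p) e <-> forall i, (i < n)%N -> (0 < d i)%N \/ nth 1%g us i = 1%g.
Proof.
move=> pP; rewrite /TrivialChk tr_Call /=; set e' := [:: _].
have nE := ev_Pn cxP (pP : ev (Var 0) e' = P).
apply: (tr_AllN nE) => i lt_in.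
have p1 : ev (Var 1) (i :: e') = P by [].
apply: tr_OrP; first by rewrite tr_Ltn (ev_Pd _ p1).
rewrite (tr_Eeq r_enum tbP _ _ (ctx_Pcx cxP p1)) (elt_Pus _ p1) evZ elt0 evV.
by split=> /eqP.
Qed.

Lemma tr_AxisChk p e : ev p e = P -> tr (AxisChk p) e <->
   ((i0 < n)%N /\ (0 < d i0)%N) \/ (forall i, (i < n)%N -> d i = 0%N) /\ t = 1%g.
Proof.
move=> pP; rewrite /AxisChk tr_Call /=; set e' := [:: _].
have p0 : ev (Var 0) e' = P by [].
have nE := ev_Pn cxP p0; apply: tr_OrP; apply: tr_AndP.
- by rewrite tr_Ltn nE (ev_Pi0 p0).
- by rewrite tr_Ltn (ev_Pd _ p0) (ev_Pi0 p0).
- apply: (tr_AllN nE) => i lt_in.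
  have p1 : ev (Var 1) (i :: e') = P by [].
  by rewrite tr_Eqn (ev_Pd _ p1) evZ evV; split=> /eqP.
- rewrite (tr_Eeq r_enum tbP _ _ (ctx_Pcx cxP p0)) (elt_Pt r n p0) evZ elt0.
  by split=> /eqP.
Qed.

Lemma tr_LettersChk p e : ev p e = P -> tr (LettersChk p) e <-> (0 < c)%N /\ forall b, b \in dec (nthc P 5) ->
   pos (elt b) = 0 /\ forall a, lamp (elt b) a != 1%g -> forall i, (i < n)%N -> `|cr R a i| *+ 5 + 1 <= c%:Z.
Proof.
move=> pP; rewrite /LettersChk tr_Call /=; set e' := [:: _].
have p0 : ev (Var 0) e' = P by [].
apply: tr_AndP; first by rewrite tr_Ltn (ev_Pc p0).
rewrite -(ev_PB p0); apply: tr_AllP => b.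
have p1 : ev (Var 1) (b :: e') = P by [].
apply: tr_AndP.
  have E : vd (ev (Epos (Var 0)) (b :: e')) = pos (elt b) by rewrite ev_Nth ev_Cst -(pos_elt r) evV.
  by rewrite (@tr_Veq n _ _ _ _ (ev_Pn cxP p1)) E evZ vd0; split=> /eqP.
rewrite tr_All; apply: (all_Supp (Q := fun a => forall i, (i < n)%N -> `|cr R a i| *+ 5 + 1 <= c%:Z) r_enum tbP (Var 0) (ctx_Pcx cxP p1)) => a.
have p2 : ev (Var 2) [:: a, b & e'] = P by [].
apply: (tr_AllN (ev_Pn cxP p2)) => i lt_in.
have p3 : ev (Var 3) [:: i, a, b & e'] = P by [].
rewrite tr_Leq (ev_Pc p3) ev_Add ev_Mul !ev_Cst ev_Zabs (zd_Coord cxP _ _ p3) !evV.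
rewrite [nth 0%N _ _]/= [nth 0%N _ _]/=.
by split; lia.
Qed.

Lemma tr_CommuteChk p ks e : ev p e = P -> tr (CommuteChk p ks) e <->
  forall i, (i < n)%N -> forall j, (j < n)%N -> exists2 k : nat, k \in dec (ev ks e) &
    twist_witness r P (nth 1%g us i * nth 1%g us j)%g (nth 1%g us j * nth 1%g us i)%g k.
Proof.
move=> pP; rewrite /CommuteChk tr_Call /=; set e' := [:: _; _].
have p0 : ev (Var 0) e' = P by [].
apply: (tr_AllN (ev_Pn cxP p0)) => i lt_in.
have p1 : ev (Var 1) (i :: e') = P by [].
apply: (tr_AllN (ev_Pn cxP p1)) => j lt_jn.
apply: tr_HasP => k.
have p3 : ev (Var 3) [:: k, j, i & e'] = P by [].
have T := tr_TwistEq r_enum tbP cxP AP (Emul (Pn (Var 3)) (Nth (Pus (Var 3)) (Var 2)) (Nth (Pus (Var 3)) (Var 1)))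
     (Emul (Pn (Var 3)) (Nth (Pus (Var 3)) (Var 1)) (Nth (Pus (Var 3)) (Var 2))) (Var 0) p3.
by rewrite 2!(elt_Emul _ _ _ (ev_Pn cxP p3)) 2!(elt_Pus _ p3) in T.
Qed.

Lemma tr_GeneratorsChk p hs ks e : ev p e = P -> size us = n -> tr (GeneratorsChk p hs ks) e <->
  forall g, g \in dec (ev hs e) -> exists2 k : nat, k \in dec (ev ks e) &
    twist_witness r P (powers us (nthc (nthc k 2)) * elt g)%g (powers us (nthc (nthc k 3))) k.
Proof.
move=> pP sz; rewrite /GeneratorsChk tr_Call /=; set e' := [:: _; _; _].
apply: tr_AllP => g; apply: tr_HasP => k.
have p2 : ev (Var 2) [:: k, g & e'] = P by [].
have T := tr_TwistEq r_enum tbP cxP AP (Emul (Pn (Var 2)) (Epows (Pn (Var 2)) (Pus (Var 2)) (Nth (Var 0) (Cst 2))) (Var 1))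
     (Epows (Pn (Var 2)) (Pus (Var 2)) (Nth (Var 0) (Cst 3))) (Var 0) p2.
have sz' : size (dec (ev (Pus (Var 2)) [:: k, g & e'])) = n.
  by rewrite (ev_Pus p2) -[RHS]sz size_map.
rewrite (elt_Emul _ _ _ (ev_Pn cxP p2)) 2!(elt_Epows _ _ (ev_Pn cxP p2) sz') (ev_Pus p2) in T.
by rewrite !ev_Nth !ev_Cst in T.
Qed.

Lemma tr_TargetChk p h f e : ev p e = P -> size us = n -> (forall j, pos (nth 1%g Bs j) = 0) -> tr (TargetChk p h f) e <->
  outside_witness P (elt (ev h e)) (ev f e) \/
  not_twist_witness r P (powers us (nthc (nthc (ev f e) 5)) * elt (ev h e))%g
    (powers us (nthc (nthc (ev f e) 6))) (ev f e).
Proof.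
move=> pP sz Bs0; rewrite /TargetChk tr_Call /=; set e' := [:: _; _; _].
have p0 : ev (Var 0) e' = P by [].
apply: tr_OrP; first exact: (tr_Outside cxP (Var 1) (Var 2) p0).
have T := tr_NotTwistEq r_enum tbP cxP AP (Emul (Pn (Var 0)) (Epows (Pn (Var 0)) (Pus (Var 0)) (Nth (Var 2) (Cst 5))) (Var 1))
     (Epows (Pn (Var 0)) (Pus (Var 0)) (Nth (Var 2) (Cst 6))) (Var 2) p0 Bs0.
have sz' : size (dec (ev (Pus (Var 0)) e')) = n.
  by rewrite (ev_Pus p0) -[RHS]sz size_map.
rewrite (elt_Emul _ _ _ (ev_Pn cxP p0)) 2!(elt_Epows _ _ (ev_Pn cxP p0) sz') (ev_Pus p0) in T.
by rewrite !ev_Nth !ev_Cst in T.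
Qed.

Definition checks (ri ws ks f hs h : nat) :=
  (R *m md n ri = 1%:M /\ size us = n) /\
  (forall i, (i < n)%N -> forall j, (j < n)%N ->
       cr R (pos (nth 1%g us i)) j = if i == j then (d i)%:Z else 0) /\
  (forall i, (i < n)%N -> (0 < d i)%N \/ nth 1%g us i = 1%g) /\
  (((i0 < n)%N /\ (0 < d i0)%N) \/ (forall i, (i < n)%N -> d i = 0%N) /\ t = 1%g) /\
  ((0 < c)%N /\ forall b, b \in dec (nthc P 5) ->
   pos (elt b) = 0 /\ forall a, lamp (elt b) a != 1%g -> forall i, (i < n)%N -> `|cr R a i| *+ 5 + 1 <= c%:Z) /\
  tr (Pairs (Var 0) (Var 1)) [:: P; ws] /\
  (forall i, (i < n)%N -> forall j, (j < n)%N -> exists2 k : nat, k \in dec ks &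
    twist_witness r P (nth 1%g us i * nth 1%g us j)%g (nth 1%g us j * nth 1%g us i)%g k) /\
  (forall g, g \in dec hs -> exists2 k : nat, k \in dec ks &
    twist_witness r P (powers us (nthc (nthc k 2)) * elt g)%g (powers us (nthc (nthc k 3))) k) /\
  (outside_witness P (elt h) f \/
  not_twist_witness r P (powers us (nthc (nthc f 5)) * elt h)%g (powers us (nthc (nthc f 6))) f).

Lemma Bs_pos0 : (forall b, b \in dec (nthc P 5) -> pos (elt b) = 0) -> forall j, pos (nth 1%g Bs j) = 0.
Proof.
move=> H j; have [lt_j|le_j] := ltnP j (size (dec (nthc P 5))); last by rewrite nth_default ?size_map.
by rewrite (nth_map 0%N) //; apply: H; apply: mem_nth.
Qed.

Lemma tr_checks p ri ws ks f hs h e : ev p e = P ->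
  tr (And (BasisChk p ri) (And (DiagonalChk p) (And (TrivialChk p) (And (AxisChk p) (And (LettersChk p) (And (Pairs p ws)
    (And (CommuteChk p ks) (And (GeneratorsChk p hs ks) (TargetChk p h f))))))))) e <->
  checks (ev ri e) (ev ws e) (ev ks e) (ev f e) (ev hs e) (ev h e).
Proof.
move=> pP; rewrite /checks.
apply: tr_AndD; [exact: tr_BasisChk|case=> _ sz].
apply: tr_AndP; [exact: tr_DiagonalChk|].
apply: tr_AndP; [exact: tr_TrivialChk|].
apply: tr_AndP; [exact: tr_AxisChk|].
apply: tr_AndD; [exact: tr_LettersChk|case=> _ H5].
have Bs0 : forall j, pos (nth 1%g Bs j) = 0 by apply: Bs_pos0 => b /H5 [].
apply: tr_AndP; [by rewrite -pP|].
apply: tr_AndP; [exact: tr_CommuteChk|].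
apply: tr_AndP; [exact: tr_GeneratorsChk|exact: tr_TargetChk].
Qed.

Lemma checks_sound ri ws ks f hs h : checks ri ws ks f hs h ->
  separating R d us i0 Bs c [seq elt g | g <- dec hs] (elt h).
Proof.
move=> [[Rri sz] [H2 [H3 [H4 [[c0 H5] [H6 [H7 [H8 H9]]]]]]]]; split.
- split=> //.
  + by case: (mulmx1_unit Rri).
  + by move=> i j lt_in; apply: H2.
  + by move=> i lt_in d0; case: (H3 i lt_in) => //; rewrite d0.
  + by case: H4 => [[-> ->]|]; [left|right].
- split=> //.
  + by apply: Bs_pos0 => b /H5 [].
  + move=> j a ja i lt_in; have [lt_j|le_j] := ltnP j (size (dec (nthc P 5))).
      have [_] := H5 _ (mem_nth 0%N lt_j); apply=> //.
      by move: ja; rewrite (nth_map 0%N).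
    by move: ja; rewrite nth_default ?size_map // lamp1 eqxx.
  + exact: (pairs_sound r_enum tbP cxP AP (e := [:: P; ws]) (p := Var 0) (ws := Var 1) erefl H6).
- move=> i j lt_in lt_jn; have [k _] := H7 i lt_in j lt_jn; exact: twist_witness_sound.
- move=> _ /mapP [g g_hs ->]; have [k _ Hk] := H8 g g_hs; do 2!eexists; exact: (twist_witness_sound Hk).
- case: H9 => [[lt_in H9]|[E F I]]; [left|right].
    exists (nthc f 0) => //; case: H9 => [H9|[E s0 sd]]; [by left|right; by exists (zd (nthc f 1)), (nthc f 2)].
  exists (nthc (nthc f 5)), (nthc (nthc f 6)), (nthc f 0), (dec_word n (nthc f 1)), (elt (nthc f 2)); split=> //.
  by exists (vd (nthc f 3)), (nthc f 4).
Qed.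

Lemma choose_witnesses (T : eqType) (L : seq T) (Q : T -> nat -> Prop) :
  (forall q, q \in L -> exists w, Q q w) ->
  exists ks : seq nat, forall q, q \in L -> exists2 w, w \in ks & Q q w.
Proof.
elim: L => [|q L IH] H; first by exists [::].
have [w Hw] := H q (mem_head _ _).
have [|ks Hks] := IH; first by move=> q' q'L; apply: H; rewrite inE q'L orbT.
exists (w :: ks) => q'; rewrite inE => /predU1P [->|/Hks [v vks Hv]].
  by exists w; rewrite ?mem_head.
by exists v; rewrite // inE vks orbT.
Qed.

Lemma tab_onto (m : nat) (p : nat -> nat) : exists a : nat, forall i, (i < m)%N -> nthc a i = p i.
Proof. by exists (cod [seq p i | i <- iota 0 m]) => i; apply: nthc_tab. Qed.

Lemma powers_tab (l : seq W) (p : nat -> nat) : exists a : nat, powers l (nthc a) = powers l p.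
Proof.
have [a aE] := tab_onto (size l) p; exists a.
by apply: eq_bigr => i _; rewrite aE.
Qed.

Lemma checks_complete hs h : separating R d us i0 Bs c [seq elt g | g <- dec hs] (elt h) ->
  exists ri ws ks f, checks ri ws ks f hs h.
Proof.
move=> [[uR sz H2 H3 H4] [c0 Bs0 H5 H6] H7 H8 H9].
have [ws Hws] := pairs_complete r_enum tbP cxP AP H6.
have [k7 Hk7] : exists ks : seq nat, forall q, q \in [seq (i, j) | i <- iota 0 n, j <- iota 0 n] ->
    exists2 k : nat, k \in ks & twist_witness r P (nth 1%g us q.1 * nth 1%g us q.2)%g (nth 1%g us q.2 * nth 1%g us q.1)%g k.
  apply: choose_witnesses => _ /allpairsP [[i j] /= [i_n j_n ->]] /=.
  rewrite !mem_iota in i_n j_n.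
  have /twist_equalP [N [l Hl]] := H7 i j i_n j_n; by eexists; apply: (Hl [::]).
have [k8 Hk8] : exists ks : seq nat, forall g, g \in dec hs -> exists2 k : nat, k \in ks &
    twist_witness r P (powers us (nthc (nthc k 2)) * elt g)%g (powers us (nthc (nthc k 3))) k.
  apply: choose_witnesses => g g_hs.
  have [p [q]] := H8 _ (map_f (fun g => elt g) g_hs).
  have [a <-] := powers_tab us p; have [b <-] := powers_tab us q.
  case/twist_equalP => N [l Hl]; exists (cod [:: N; l; a; b]).
  by have := Hl [:: a; b]; rewrite !nthc_cod.
have [f Hf] : exists f : nat, outside_witness P (elt h) f \/
  not_twist_witness r P (powers us (nthc (nthc f 5)) * elt h)%g (powers us (nthc (nthc f 6))) f.
  case: H9 => [/outside_latticeP [l Hl]|[p [q]]]; first by eexists; left; apply: (Hl [::]).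
  have [a <-] := powers_tab us p; have [b <-] := powers_tab us q.
  case/not_twist_equalP => // l sz5 Hl; exists (cod (l ++ [:: a; b])); right.
  by have := Hl [:: a; b]; rewrite !nthc_cod !nth_cat sz5.
exists (mcode (invmx R)), ws, (cod (k7 ++ k8)), f; rewrite /checks mcodeK mulmxV // codeK.
split=> //; split; first by move=> i lt_in j; apply: H2.
split; first by move=> i lt_in; have [d0|] := posnP (d i); [right; apply: H3|left].
split; first by case: H4 => [/andP|]; [left|right].
split.
  split=> // b /(nthP 0%N) [j lt_j <-]; have := Bs0 j; have := H5 j.
  by rewrite (nth_map 0%N).
split; first exact: Hws.
split.
  move=> i lt_in j lt_jn; have [|k kk Hk] := Hk7 (i, j).
    by apply: allpairs_f; rewrite mem_iota.
  by exists k => //; rewrite mem_cat kk.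
split=> //; move=> g /Hk8 [k kk Hk].
by exists k => //; rewrite mem_cat kk orbT.
Qed.
End Certificate_checks.

(** * Programs for membership and non-membership *)

Definition Params cx k := Lst [:: cx; Nth k Zro; Nth k (Cst 1); Nth k (Cst 2); Nth k (Cst 3);
  Nth k (Cst 4); Nth k (Cst 5); Posmx (Nth k (Cst 2))].
Definition SeparatingChk p k hs h := And (BasisChk p (Nth k (Cst 6))) (And (DiagonalChk p) (And (TrivialChk p) (And (AxisChk p) (And (LettersChk p)
   (And (Pairs p (Nth k (Cst 7))) (And (CommuteChk p (Nth k (Cst 8))) (And (GeneratorsChk p hs (Nth k (Cst 8)))
   (TargetChk p h (Nth k (Cst 9)))))))))).
Definition NonMember cx k hs h := Call (Call (SeparatingChk (Var 0) (Var 1) (Var 2) (Var 3))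
  [:: Params (Var 0) (Var 1); Var 1; Var 2; Var 3]) [:: cx; k; hs; h].
Definition Member cx k hs h := Call (And
  (All (Var 1) (Has (Var 3) (Or (Eeq (Var 2) (Var 1) (Var 0))
     (Eeq (Var 2) (Emul (Cn (Var 2)) (Var 1) (Var 0)) Zro))))
  (Eeq (Var 0) (Eprod (Cn (Var 0)) (Var 1)) (Var 3))) [:: cx; k; hs; h].

(** Inverse generators are recognised by [w * g = 1], so a checking program needs multiplication
    only. *)
Lemma in_generated_words (W : groupType) (hs : seq W) (h : W) : in_generated hs h <->
  exists2 ws : seq W, (forall w, w \in ws -> exists2 g, g \in hs & w = g \/ w * g = 1)%g
    & (\prod_(w <- ws) w)%g = h.
Proof.
split=> [H|[ws wsP <-]]; last first.
  have sH := in_generated_subgroup hs; apply: (subgroup_prod sH) => w /wsP [g g_hs].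
  have Hg : in_generated hs g by move=> S _; apply.
  by case=> [-> //|/(canRL (mulgK g))]; rewrite mul1g => ->; case: sH => _ _; apply.
pose Q (ws : seq W) := forall w, w \in ws -> exists2 g, g \in hs & w = g \/ (w * g = 1)%g.
apply: (H (fun h => exists2 ws : seq W, Q ws & (\prod_(w <- ws) w)%g = h)); last first.
  by move=> g g_hs; exists [:: g]; rewrite ?big_seq1 // => w; rewrite inE => /eqP ->; exists g; [|left].
split.
- by exists [::]; rewrite ?big_nil.
- move=> _ _ [xs xsP <-] [ys ysP <-]; exists (xs ++ ys); rewrite ?big_cat // => w.
  by rewrite mem_cat => /orP [/xsP|/ysP].
- move=> _ [xs xsP <-]; exists (rev [seq w^-1 | w <- xs])%g.
    move=> w; rewrite mem_rev => /mapP [x /xsP [g g_hs xg] ->]; exists g => //.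
    by case: xg => [->|/(canRL (mulgK g)) ->]; [right; rewrite mulVg|left; rewrite mul1g invgK].
  elim: xs {xsP} => [|x xs IH]; first by rewrite !big_nil invg1.
  by rewrite /= rev_cons big_rcons IH big_cons invMg.
Qed.

Section Certificates.
Variables (gT : finGroupType) (r : seq gT) (n tb : nat).
Hypotheses (r_enum : enumerates r) (tbP : table_ok r tb).
Notation V := 'rV[int]_n.
Notation W := (wreath gT n).
Notation vd := (vd n).
Notation elt := (elt r n).

Lemma Params_posmx cx k e (P := ev (Params cx k) e) :
  md n (nthc P 7) = posmx [seq elt u | u <- dec (nthc P 3)].
Proof. by rewrite /P ev_Lst !nthc_cod /= (md_Posmx r n). Qed.

Lemma tr_NonMember cx k hs h e (K := ev k e)
    (P := ev (Params (Var 0) (Var 1)) [:: ev cx e; K; ev hs e; ev h e]) : context r n tb (ev cx e) ->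
  tr (NonMember cx k hs h) e <->
  checks r n P (nthc K 6) (nthc K 7) (nthc K 8) (nthc K 9) (ev hs e) (ev h e).
Proof.
move=> cxP; rewrite /NonMember !tr_Call /= !evV /= -/K -/P; set e' := [:: _; _; _; _].
have cP : context r n tb (nthc P 0) by rewrite /P ev_Lst nthc_cod.
have := tr_checks r_enum tbP cP (Params_posmx _ _ _) (Nth (Var 1) (Cst 6)) (Nth (Var 1) (Cst 7))
  (Nth (Var 1) (Cst 8)) (Nth (Var 1) (Cst 9)) (Var 2) (Var 3) (erefl : ev (Var 0) e' = P).
by rewrite !ev_Nth !ev_Cst.
Qed.

Lemma NonMember_sound cx k hs h e : context r n tb (ev cx e) -> tr (NonMember cx k hs h) e ->
  ~ in_generated [seq elt g | g <- dec (ev hs e)] (elt (ev h e)).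
Proof.
move=> cxP /(tr_NonMember _ _ _ cxP) H.
have cP : context r n tb (nthc (ev (Params (Var 0) (Var 1)) [:: ev cx e; ev k e; ev hs e; ev h e]) 0) by rewrite ev_Lst nthc_cod.
exact: separating_sound (checks_sound r_enum tbP cP (Params_posmx _ _ _) H).
Qed.

(** A certificate stores only the first [n] values of [d]. *)
Lemma separating_ext R (d d' : nat -> nat) us i0 Bs c (hs : seq W) h :
  (forall i, (i < n)%N -> d i = d' i) -> separating R d us i0 Bs c hs h -> separating R d' us i0 Bs c hs h.
Proof.
move=> E [[uR sz H2 H3 H4] H5 H7 H8 H9]; split=> //.
  split=> //; first by move=> i j lt_in lt_jn; rewrite H2 // E.
    by move=> i lt_in; rewrite -E //; apply: H3.
  case: H4 => [/andP [lt_i0 d0]|[d0 t1]]; [left|right]; first by rewrite lt_i0 -E.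
  by split=> // i lt_in; rewrite -E //; apply: d0.
case: H9 => [[i lt_in]|]; [left; exists i => //|by right].
by rewrite -E.
Qed.

Lemma elts_onto (ws : seq W) : exists s : seq nat, [seq elt w | w <- s] = ws.
Proof.
elim: ws => [|w ws [s <-]]; first by exists [::].
by have [c <-] := elt_onto r_enum w; exists (c :: s).
Qed.

Lemma NonMember_complete C HS H : context r n tb C ->
  ~ in_generated [seq elt g | g <- dec HS] (elt H) ->
  exists k : nat, tr (NonMember (Var 0) (Var 1) (Var 2) (Var 3)) [:: C; k; HS; H].
Proof.
move=> cxP /separating_complete [R [d [us [i0 [Bs [c sep]]]]]].
have [u uE] := elts_onto us; have [b bE] := elts_onto Bs; have [a aE] := tab_onto n d.
pose K l := cod [:: mcode R, a, cod u, i0, cod b, c & l] : nat.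
pose P := ev (Params (Var 0) (Var 1)) [:: C; K [::]; HS; H].
(* The parameters are read from the first six entries only, so they are fixed before the witnesses,
   which depend on them, are appended. *)
have PE l : ev (Params (Var 0) (Var 1)) [:: C; K l; HS; H] = P.
  rewrite /P !ev_Lst /= !ev_Nth !ev_Cst !evV evZ [nth _ _ _]/= [nth _ _ _]/= !nthc_cod /=.
  by rewrite !evM !ev_Nth !ev_Cst !evV [nth _ _ _]/= [nth _ _ _]/= !nthc_cod.
have P_ i : nthc P i.+1 = nth 0%N [:: mcode R; a; cod u; i0; cod b; c] i \/ (5 < i)%N.
  rewrite /P ev_Lst nthc_cod; case: i => [|[|[|[|[|[|i]]]]]];
    first [by right|by left; rewrite /= ev_Nth ?ev_Cst ?evZ evV /= nthc_cod].
have [P1|//] := P_ 0%N; have [P2|//] := P_ 1%N; have [P3|//] := P_ 2; have [P4|//] := P_ 3.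
have [P5|//] := P_ 4; have [P6|//] := P_ 5; rewrite /= in P1 P2 P3 P4 P5 P6.
have cP : context r n tb (nthc P 0) by rewrite /P ev_Lst nthc_cod.
have sep' : separating (md n (nthc P 1)) (nthc (nthc P 2)) [seq elt u | u <- dec (nthc P 3)]
   (nthc P 4) [seq elt b | b <- dec (nthc P 5)] (nthc P 6) [seq elt g | g <- dec HS] (elt H).
  rewrite P1 P2 P3 P4 P5 P6 mcodeK !codeK uE bE.
  by apply: separating_ext sep => i lt_in; rewrite aE.
have [ri [ws [ks [f Hk]]]] := checks_complete r_enum tbP cP (Params_posmx _ _ _) sep'.
exists (K [:: ri; ws; ks; f]).
have cx0 : context r n tb (ev (Var 0) [:: C; K [:: ri; ws; ks; f]; HS; H]) by [].
apply/(tr_NonMember (Var 1) (Var 2) (Var 3) cx0).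
by rewrite PE evV /K !nthc_cod.
Qed.

Lemma tr_Member cx k hs h e : context r n tb (ev cx e) ->
  tr (Member cx k hs h) e <-> (forall w, w \in dec (ev k e) -> exists2 g, g \in dec (ev hs e) &
      elt w = elt g \/ (elt w * elt g)%g = 1%g) /\
  (\prod_(w <- dec (ev k e)) elt w)%g = elt (ev h e).
Proof.
move=> cxP; rewrite /Member tr_Call /=; set e' := [:: _; _; _; _].
apply: tr_AndP.
  apply: tr_AllP => w; apply: tr_HasP => g.
  have c2 : context r n tb (ev (Var 2) [:: g, w & e']) by [].
  apply: tr_OrP; rewrite (tr_Eeq r_enum tbP _ _ c2) ?(elt_Emul _ _ _ (ev_Cn c2)) ?evZ ?elt0.
    by split=> /eqP.
  by split=> /eqP.
have c0 : context r n tb (ev (Var 0) e') by [].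
rewrite (tr_Eeq r_enum tbP _ _ c0) (elt_Eprod _ _ (ev_Cn c0)).
by split=> /eqP.
Qed.

Lemma Member_sound cx k hs h e : context r n tb (ev cx e) -> tr (Member cx k hs h) e ->
  in_generated [seq elt g | g <- dec (ev hs e)] (elt (ev h e)).
Proof.
move=> cxP /(tr_Member _ _ _ cxP) [Hw <-]; apply/in_generated_words.
exists [seq elt w | w <- dec (ev k e)]; last by rewrite big_map.
move=> _ /mapP [w /Hw [g g_hs wg] ->]; exists (elt g) => //; exact: map_f.
Qed.

Lemma Member_complete C HS H : context r n tb C ->
  in_generated [seq elt g | g <- dec HS] (elt H) ->
  exists k : nat, tr (Member (Var 0) (Var 1) (Var 2) (Var 3)) [:: C; k; HS; H].
Proof.
move=> cxP /in_generated_words [ws wsP wsE]; have [s sE] := elts_onto ws.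
exists (cod s); have cx0 : context r n tb (ev (Var 0) [:: C; cod s; HS; H]) by [].
apply/(tr_Member (Var 1) (Var 2) (Var 3) cx0); rewrite !evV /= codeK; split; last first.
  by rewrite -wsE -sE big_map.
move=> w ws_w; have ww : elt w \in ws by rewrite -sE map_f.
by have [_ /mapP [g g_hs ->] wg] := wsP (elt w) ww; exists g.
Qed.
End Certificates.

Local Close Scope ring_scope.

(** * Multiplication tables *)

Lemma tr_HasN l f e m (Q : nat -> Prop) : ev l e = m ->
  (forall i, i < m -> tr f (i :: e) <-> Q i) ->
  tr (Has (Iota l) f) e <-> exists2 i, i < m & Q i.
Proof.
move=> lm H; rewrite tr_Has ev_Iota codeK lm; split=> [/hasP [i]|[i im Qi]].
  by rewrite mem_iota => /andP [_ im] /H Qi; exists i => //; apply: Qi.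
by apply/hasP; exists i; [rewrite mem_iota|apply/H].
Qed.

Definition Tmul t a b := Nth (Nth t a) b.
Definition Valid t e := Call (And (Ltn (Var 1) (Size (Var 0)))
  (All (Iota (Size (Var 0))) (And (Eqn (Tmul (Var 1) (Var 2) (Var 0)) (Var 0))
    (And (Has (Iota (Size (Var 1))) (Eqn (Tmul (Var 2) (Var 0) (Var 1)) (Var 3)))
      (All (Iota (Size (Var 1))) (And (Ltn (Tmul (Var 2) (Var 1) (Var 0)) (Size (Var 2)))
        (All (Iota (Size (Var 2))) (Eqn (Tmul (Var 3) (Tmul (Var 3) (Var 2) (Var 1)) (Var 0))
           (Tmul (Var 3) (Var 2) (Tmul (Var 3) (Var 1) (Var 0)))))))))))
  [:: t; e].

Definition tmul tb i j := nthc (nthc tb i) j.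

(** Closure, associativity, a left identity and left inverses: enough for a group, and bounded
    quantifiers make it checkable. *)
Definition group_table tb e (m := size (dec tb)) :=
  e < m /\ forall i, i < m -> tmul tb e i = i /\
    (exists2 j, j < m & tmul tb j i = e) /\
    forall j, j < m -> tmul tb i j < m /\
      forall l, l < m -> tmul tb (tmul tb i j) l = tmul tb i (tmul tb j l).

Lemma tr_Valid t x e : tr (Valid t x) e <-> group_table (ev t e) (ev x e).
Proof.
rewrite /Valid tr_Call /=; set e' := [:: _; _].
have eqP' (T : eqType) (a b : T) : a == b <-> a = b by split=> /eqP.
apply: tr_AndP; first by rewrite tr_Ltn ev_Size.
apply: tr_AllN => [|i _]; first exact: ev_Size.
apply: tr_AndP; first by rewrite tr_Eqn !ev_Nth; apply: eqP'.
apply: tr_AndP.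
  apply: tr_HasN => [|j _]; first exact: ev_Size.
  by rewrite tr_Eqn !ev_Nth; apply: eqP'.
apply: tr_AllN => [|j _]; first exact: ev_Size.
apply: tr_AndP; first by rewrite tr_Ltn !ev_Nth ev_Size.
apply: tr_AllN => [|l _]; first exact: ev_Size.
by rewrite tr_Eqn !ev_Nth; apply: eqP'.
Qed.

Section TableGroup.
Variables (tb e : nat) (H : group_table tb e).
Let m := size (dec tb).
(** The proof is an argument of the type so that the group structure, which depends on it, can be
    attached as an instance. *)
Definition table_group of group_table tb e := 'I_(size (dec tb)).
HB.instance Definition _ := Finite.on (table_group H).
Notation T := (table_group H).

Lemma tmul_lt (i j : 'I_m) : tmul tb i j < m.
Proof. by have [_ /(_ i (ltn_ord i)) [_ [_ /(_ j (ltn_ord j)) []]]] := H. Qed.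
Lemma tinv_ex (i : 'I_m) : exists j : 'I_m, tmul tb j i == e.
Proof. by have [_ /(_ i (ltn_ord i)) [_ [[j jm /eqP ji] _]]] := H; exists (Ordinal jm). Qed.

Definition table_mul (i j : T) : T := Ordinal (tmul_lt i j).
Definition table_one : T := Ordinal H.1.
Definition table_inv (i : T) : T := xchoose (tinv_ex i).

Lemma table_mulA : associative table_mul.
Proof.
move=> i j l; apply: val_inj => /=.
have [_ /(_ i (ltn_ord i)) [_ [_ /(_ j (ltn_ord j)) [_ /(_ l (ltn_ord l))]]]] := H.
by [].
Qed.
Lemma table_mul1 : left_id table_one table_mul.
Proof. by move=> i; apply: val_inj => /=; have [_ /(_ i (ltn_ord i)) []] := H. Qed.
Lemma table_mulV : left_inverse table_one table_inv table_mul.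
Proof. by move=> i; apply: val_inj => /=; apply/eqP; apply: (xchooseP (tinv_ex i)). Qed.
HB.instance Definition _ := Finite_isGroup.Build T table_mulA table_mul1 table_mulV.

Lemma table_group_ok : enumerates (enum T) /\ table_ok (enum T) tb /\ index (1%g : T) (enum T) = e.
Proof.
have ind (x : T) : index x (enum T) = x by exact: index_enum_ord.
split; first by split; [exact: enum_uniq|move=> x; rewrite mem_enum].
split; last by rewrite ind.
split; first by rewrite size_enum_ord.
move=> i j; rewrite size_enum_ord => im jm; rewrite ind.
have nE (k : nat) (km : k < m) : nth (1%g : T) (enum T) k = Ordinal km.
  by apply: val_inj; rewrite /= nth_enum_ord.
by rewrite (nE i im) (nE j jm).
Qed.
End TableGroup.

Lemma table_code_ok (gT : finGroupType) (r : seq gT) : enumerates r ->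
  table_ok r (table_code r) /\ group_table (table_code r) (index 1%g r).
Proof.
move=> [ur all_r].
have ok : table_ok r (table_code r).
  split=> [|i j ir jr]; first by rewrite codeK size_map.
  by rewrite nthc_cod (nth_map 1%g) // nthc_cod (nth_map 1%g).
split=> //; have [sz okE] := ok; rewrite /group_table sz.
have lt x : index x r < size r by rewrite index_mem.
have ex i : i < size r -> exists x, i = index x r.
  by move=> ir; exists (nth 1%g r i); rewrite index_uniq.
have tE x y : tmul (table_code r) (index x r) (index y r) = index (x * y)%g r.
  by rewrite /tmul okE // !nth_index.
split=> // _ /ex [x ->]; split; first by rewrite tE mul1g.
split; first by exists (index x^-1%g r); rewrite ?tE ?mulVg.
move=> _ /ex [y ->]; rewrite tE; split=> // _ /ex [z ->].
by rewrite !tE mulgA.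
Qed.

(** The index [e] of a table identity names an idempotent of the group, and the only idempotent is
    1. So the identity named by a certificate is the true one. *)
Lemma group_table_one (gT : finGroupType) (r : seq gT) tb e : enumerates r -> table_ok r tb ->
  group_table tb e -> e = index 1%g r.
Proof.
move=> [ur all_r] [sz tbE] [em /(_ _ em) [+ _]]; rewrite sz in em; rewrite /tmul tbE // => E.
pose x := nth 1%g r e; have xx : (x * x = x)%g by rewrite -[LHS](nth_index 1%g (all_r _)) E.
by rewrite -{1}E -/x xx; congr index; apply: (mulgI x); rewrite mulg1.
Qed.

Section Codes.
Variables (gT : finGroupType) (r : seq gT) (n : nat).
Hypothesis r_enum : enumerates r.

Lemma vec_codeE (v : 'rV[int]_n) : vec_code v = vcode v.
Proof.
rewrite /vec_code /vcode -val_enum_ord -map_comp; congr cod.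
by apply: eq_map => i; rewrite /= co_ord.
Qed.

Lemma element_code_elt (w : wreath gT n) c : element_code r w c -> elt r n c = w.
Proof.
move=> [s sw ->].
rewrite vec_codeE; pose p a := cod [:: vcode a; index (lamp w a) r].
have -> : [seq cod [:: vec_code a; index (lamp w a) r] | a <- s] = map p s.
  by apply: eq_map => a; rewrite vec_codeE.
exact: elt_listing.
Qed.
End Codes.

(** * The decision procedure *)

Definition Table c := Nth c Zro.
Definition MemberCert k c := Member (Lst [:: Nth c (Cst 1); Table c; Nth k Zro]) (Nth k (Cst 1)) (Nth c (Cst 2)) (Nth c (Cst 3)).
Definition NonMemberCert k c := NonMember (Lst [:: Nth c (Cst 1); Table c; Nth k Zro]) (Nth k (Cst 1)) (Nth c (Cst 2)) (Nth c (Cst 3)).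
(** The search has to end on every number, also on those that code no instance. The first
    alternative disposes of tables that are not group tables. *)
Definition Decided := Or (Not (Has (Iota (Size (Table (Var 1)))) (Valid (Table (Var 2)) (Var 0))))
  (And (Valid (Table (Var 1)) (Nth (Var 0) Zro)) (Or (MemberCert (Var 0) (Var 1)) (NonMemberCert (Var 0) (Var 1)))).
Definition Answer := If (MemberCert (Var 0) (Var 1)) (Cst 1) Zro.

Lemma tr_valid_table k c : tr (Has (Iota (Size (Table (Var 1)))) (Valid (Table (Var 2)) (Var 0))) [:: k; c] <->
  exists e, group_table (nthc c 0) e.
Proof.
rewrite (@tr_HasN _ _ _ (size (dec (nthc c 0))) (group_table (nthc c 0))).
- by split=> [[e _ H]|[e H]]; exists e => //; case: H.
- by rewrite ev_Size ev_Nth.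
- by move=> i _; rewrite tr_Valid ev_Nth.
Qed.

Lemma tr_Member_ev cx k hs h e C K HS H :
  ev cx e = C -> ev k e = K -> ev hs e = HS -> ev h e = H ->
  tr (Member cx k hs h) e = tr (Member (Var 0) (Var 1) (Var 2) (Var 3)) [:: C; K; HS; H].
Proof. by move=> <- <- <- <-. Qed.
Lemma tr_NonMember_ev cx k hs h e C K HS H :
  ev cx e = C -> ev k e = K -> ev hs e = HS -> ev h e = H ->
  tr (NonMember cx k hs h) e = tr (NonMember (Var 0) (Var 1) (Var 2) (Var 3)) [:: C; K; HS; H].
Proof. by move=> <- <- <- <-. Qed.

(** A group table defines a group on the ordinals below its size, and in that group all numbers
    decode to elements. By excluded middle the decoded target is a member or not, and either case
    has a certificate. *)
Lemma Decided_total c : exists k, ev Decided [:: k; c] != 0.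
Proof.
have [[e He]|no] := classic (exists e, group_table (nthc c 0) e); last first.
  exists 0; rewrite -/(tr Decided _) tr_Or tr_Not; apply/orP; left; apply/negP => /tr_valid_table; exact: no.
have [r_enum [tbP eE]] := table_group_ok He.
set r := enum _ in r_enum tbP eE; pose n := nthc c 1.
pose C := cod [:: n; nthc c 0; e].
have cxP : context r n (nthc c 0) C by split; rewrite nthc_cod //= eE.
suff [kk H] : exists kk : nat, tr (Or (Member (Var 0) (Var 1) (Var 2) (Var 3)) (NonMember (Var 0) (Var 1) (Var 2) (Var 3)))
    [:: C; kk; nthc c 2; nthc c 3].
  exists (cod [:: e; kk]); rewrite -/(tr Decided _) tr_Or tr_And; apply/orP; right.
  apply/andP; split; first by apply/tr_Valid; rewrite !ev_Nth !evV evZ /= nthc_cod.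
  have cE : ev (Lst [:: Nth (Var 1) (Cst 1); Table (Var 1); Nth (Var 0) Zro]) [:: cod [:: e; kk]; c] = C.
    by rewrite ev_Lst /= !ev_Nth ev_Cst !evV evZ /= nthc_cod.
  have kE : ev (Nth (Var 0) (Cst 1)) [:: cod [:: e; kk]; c] = kk by rewrite ev_Nth ev_Cst evV /= nthc_cod.
  have hs' : ev (Nth (Var 1) (Cst 2)) [:: cod [:: e; kk]; c] = nthc c 2 by rewrite ev_Nth ev_Cst.
  have h' : ev (Nth (Var 1) (Cst 3)) [:: cod [:: e; kk]; c] = nthc c 3 by rewrite ev_Nth ev_Cst.
  move: H; rewrite !tr_Or /MemberCert /NonMemberCert.
  by rewrite (tr_Member_ev cE kE hs' h') (tr_NonMember_ev cE kE hs' h').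
have [yes|no] := classic (in_generated [seq elt r n g | g <- dec (nthc c 2)] (elt r n (nthc c 3))).
  by have [kk H] := Member_complete r_enum tbP cxP yes; exists kk; rewrite tr_Or H.
by have [kk H] := NonMember_complete r_enum tbP cxP no; exists kk; rewrite tr_Or H orbT.
Qed.

Theorem theorem1p2 :
  exists D : 1.-tuple nat -> nat, recursive D /\
    forall (gT : finGroupType) (r : seq gT), enumerates r ->
    forall (n : nat) (hs : seq (wreath gT n)) (h : wreath gT n) (c : nat),
      instance_code r hs h c ->
      (in_generated hs h -> D [tuple c] = 1) /\
      (~ in_generated hs h -> D [tuple c] = 0).
Proof.
have [D [rD DE]] := recursive_search Answer Decided_total.
exists D; split=> // gT r r_enum n hs h c [cs [d [sz csP dP cE]]].
(* Only the existence of [k] used the group built from the table. Its meaning is now read in [gT],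
   which has the same table, and soundness there shows that the answer is right. *)
have [k Hk Dk] := DE c; rewrite {}Dk /Answer ev_If ev_Cst evZ.
have [tbP valid] := table_code_ok r_enum.
have c0 : nthc c 0 = table_code r by rewrite cE nthc_cod.
have hE : elt r n (nthc c 3) = h by rewrite cE nthc_cod /=; apply: element_code_elt.
have hsE : [seq elt r n g | g <- dec (nthc c 2)] = hs.
  rewrite cE nthc_cod /= codeK; apply: (@eq_from_nth _ 1%g); rewrite size_map // => i lt_i.
  by rewrite (nth_map 0) //; apply: element_code_elt => //; apply: csP; rewrite -sz.
move: Hk; rewrite -/(tr Decided _) tr_Or tr_Not tr_And => /orP [/negP []|/andP [/tr_Valid V YN]].
  by apply/tr_valid_table; exists (index 1%g r); rewrite c0.
rewrite [ev (Table _) _]ev_Nth evV c0 in V.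
have cxP : context r n (table_code r) (ev (Lst [:: Nth (Var 1) (Cst 1); Table (Var 1); Nth (Var 0) Zro]) [:: k; c]).
  rewrite ev_Lst /=; split; rewrite nthc_cod /=.
  - by rewrite ev_Nth ev_Cst cE nthc_cod.
  - by rewrite ev_Nth.
  - exact: (group_table_one r_enum tbP V).
have hs' : ev (Nth (Var 1) (Cst 2)) [:: k; c] = nthc c 2 by rewrite ev_Nth ev_Cst.
have h' : ev (Nth (Var 1) (Cst 3)) [:: k; c] = nthc c 3 by rewrite ev_Nth ev_Cst.
have [yes|no] := boolP (tr (MemberCert (Var 0) (Var 1)) [:: k; c]).
  have := Member_sound r_enum tbP cxP yes; rewrite hs' h' hsE hE => gen.
  by split=> // /(_ gen).
rewrite tr_Or (negbTE no) /= in YN.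
have := NonMember_sound r_enum tbP cxP YN; rewrite hs' h' hsE hE => ngen.
by split=> // /ngen.
Qed.
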